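(* For each $\alpha\ge0$ the operator $\check T\colon L^{\alpha}_{\mathrm{exp}}\to L^{\alpha+1}_{\mathrm{exp}}$ is bounded. In particular, $\check T\colon L^\infty\to L_{\mathrm{exp}}$ is bounded.
   Context: All function spaces are over the interval $(-1,1)$ with Lebesgue measure $\mu$, functions are complex-valued and identified when equal a.e.; $L^0$ is the space of all measurable functions, $L^p=L^p(-1,1)$. Finite Hilbert transform: for $f\in L^1$, $T(f)(t):=\lim_{\varepsilon\to0^+}\frac1\pi\left(\int_{-1}^{t-\varepsilon}+\int_{t+\varepsilon}^1\right)\frac{f(x)}{x-t}\,dx$, which exists for a.e. $t\in(-1,1)$ and is measurable. $w(x):=\sqrt{1-x^2}$ for $x\in(-1,1)$. For $f\in L^1$ with $f/w\in L^1$, $\check T(f):=-w\,T(f/w)\in L^0$. $f^*\colon[0,2]\to[0,\infty]$ is the decreasing rearrangement of $f\in L^0$. For $\alpha\ge0$, the Zygmund space $L^\alpha_{\mathrm{exp}}$ consists of all $f\in L^0$ with $\|f\|_{L^\alpha_{\mathrm{exp}}}:=\sup_{0<t<2}\frac{\int_0^t f^*(s)\,ds}{t(\log(2e/t))^\alpha}<\infty$ (for $\alpha>0$, equivalently, $\int_{-1}^1\exp\big((\lambda|f|)^{1/\alpha}\big)\,d\mu<\infty$ for some $\lambda>0$). For $\alpha=0$ this is $L^\infty$, and $L_{\mathrm{exp}}:=L^1_{\mathrm{exp}}$ is the case $\alpha=1$. One has $L^\alpha_{\mathrm{exp}}\subseteq L^p$ for all $1\le p<\infty$. *)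

(* Defs.v *)
From HB Require Import structures.
From mathcomp Require Import all_boot all_order all_algebra complex.
From mathcomp Require Import all_classical all_reals all_analysis.

Set Implicit Arguments.
Unset Strict Implicit.
Unset Printing Implicit Defensive.

Import Order.TTheory GRing.Theory Num.Theory.
Import numFieldNormedType.Exports.

Local Open Scope classical_set_scope.
Local Open Scope ring_scope.

(** Functions on (-1,1) are represented by functions [R -> R[i]] of which only
    the values on (-1,1) are used.  Functions that are equal a.e. are not
    identified: integrals, norms and [fht] are invariant under changes on null
    sets.
    Measurability is Borel measurability; every Lebesgue measurable function is
    a.e. equal to a Borel measurable one.
    [cmod z : R] is the modulus of [z : R[i]] as a real number. *)

Notation cmod := ComplexField.Normc.normc.

Definition dom11 {R : realType} : set R := `]-1, 1[%classic.

Definition L0 {R : realType} (f : R -> R[i]) : Prop :=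
  measurable_fun dom11 (fun x => complex.Re (f x)) /\
  measurable_fun dom11 (fun x => complex.Im (f x)).

Definition L1 {R : realType} (f : R -> R[i]) : Prop :=
  L0 f /\
  (\int[lebesgue_measure]_(x in dom11) (cmod (f x))%:E < +oo)%E.

Definition Cintegral {R : realType} (D : set R) (f : R -> R[i]) : R[i] :=
  Complex (Rintegral lebesgue_measure D (fun x => complex.Re (f x)))
          (Rintegral lebesgue_measure D (fun x => complex.Im (f x))).

Definition truncated_fht {R : realType} (f : R -> R[i]) (t e : R) : R[i] :=
  (real_complex R pi)^-1 *
    (Cintegral `]-1, t - e[%classic (fun x => f x / real_complex R (x - t)) +
     Cintegral `]t + e, 1[%classic (fun x => f x / real_complex R (x - t))).

(** The limit in [R[i]]; [lim] returns a default value at the points [t],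
    forming a null set when [f] is in [L1], where it does not exist. *)
Definition fht {R : realType} (f : R -> R[i]) (t : R) : R[i] :=
  lim (truncated_fht f t e @[e --> 0^'+] : set_system (R[i])^o).

Definition weight {R : realType} (x : R) : R := Num.sqrt (1 - x ^+ 2).

Definition div_w {R : realType} (f : R -> R[i]) (x : R) : R[i] :=
  f x / real_complex R (weight x).

Definition checkT_dom {R : realType} (f : R -> R[i]) : Prop :=
  L1 f /\ L1 (div_w f).

Definition checkT {R : realType} (f : R -> R[i]) (t : R) : R[i] :=
  - (real_complex R (weight t) * fht (div_w f) t).

(** [ereal_inf] of the empty set is [+oo]. *)
Definition rearrangement {R : realType} (f : R -> R[i]) (s : R) : \bar R :=
  ereal_inf [set l%:E | l in [set l : R | 0 <= l /\
    (lebesgue_measure (dom11 `&` [set x | (l < cmod (f x))%R]) <= s%:E)%E]].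

Definition norm_Lexp {R : realType} (alpha : R) (f : R -> R[i]) : \bar R :=
  ereal_sup [set ((\int[lebesgue_measure]_(s in `]0%R, t[) rearrangement f s) *
                  ((t * (ln (2 * expR 1 / t)) `^ alpha)^-1)%:E)%E
            | t in `]0, 2[%classic].

Definition norm_Linfty {R : realType} (f : R -> R[i]) : \bar R :=
  'N[mrestr lebesgue_measure (measurable_itv `](-1 : R), 1[)]_+oo
    [(fun x => (cmod (f x))%:E)].

Definition function_space {R : realType} (N : (R -> R[i]) -> \bar R)
    : set (R -> R[i]) :=
  [set f | L0 f /\ (N f < +oo)%E].

(** [S] is defined on all of [X], maps [X] into [Y], and
    [NY (S f) <= C * NX f] with [C] independent of [f], where [X] and [Y] are
    the function spaces with norms [NX] and [NY]. *)
Definition bounded_operator {R : realType} (domS : (R -> R[i]) -> Prop)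
    (S : (R -> R[i]) -> (R -> R[i])) (NX NY : (R -> R[i]) -> \bar R) : Prop :=
  exists2 C : R, 0 <= C & forall f, function_space NX f ->
    [/\ domS f, function_space NY (S f) & (NY (S f) <= C%:E * NX f)%E].

(* Main.v *)
(** Substituting [x = cos phi] turns [checkT f] into the conjugate function of
    the even function [f (cos phi)]: with the Poisson factor [r < 1] and the sum
    truncated at [N], it is the imaginary part of a polynomial at [cis theta]
    whose real part is, up to the constant coefficient, the Poisson mean of [f].
    Integrating the pointwise inequality behind M. Riesz' theorem,
    [v^(2m) <= 2 Re (+-(u + iv)^(2m)) + 3 (7m)^(2m) u^(2m)], the mean value
    property reduces the first term to the constant coefficient, and Jensen's
    inequality for nonnegative kernels bounds what is left.  As [r -> 1] these means tend to the principal value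
    wherever it exists (an Abelian argument), so Fatou's lemma gives
    [\int |checkT f|^(2m) <= (140 m)^(2m) \int |f|^(2m) / w].  For [f] in
    [L^alpha_exp], the decay of the level sets of [f] makes the right-hand side at
    most [(C ||f|| m^(alpha + 1))^(2m)], and Markov's inequality with [2m] of the
    order of [log (2e/t)] turns this growth of moments into the bound on the
    rearrangement of [checkT f]. *)

Require Import Defs.
From mathcomp Require Import all_boot all_order all_algebra complex.
From mathcomp Require Import all_classical all_reals all_analysis.
From mathcomp Require Import measurable_realfun ess_sup_inf.
From mathcomp Require Import ring lra.
Set Implicit Arguments.
Unset Strict Implicit.
Unset Printing Implicit Defensive.
Import Order.TTheory GRing.Theory Num.Theory.
Import numFieldNormedType.Exports.
Local Open Scope classical_set_scope.
Local Open Scope ring_scope.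

(** * M. Riesz' inequality for trigonometric polynomials *)

(** Passing from [alpha] to [alpha + 1] is one extra factor [m] in the moment constant, so the
    growth in [m] of every constant has to be explicit; even integer exponents make Riesz' argument
    a matter of polynomial inequalities. Truncating the Poisson sum turns the conjugate function
    into the imaginary part of a genuine polynomial: the mean value property becomes orthogonality
    of cosines, and interchanges of integrals become finite sums. The price is that the truncated
    Poisson kernel need not be positive. Doubling its constant term repairs this for large [N]; the
    imaginary part is unchanged, and only the mass of the kernel doubles. The singular weight enters
    asymmetrically: [1/w >= 1] may be dropped in front of [checkT f], but it stays in front of [f],
    whose large values may sit near the end points. The exponential decay of level sets absorbs
    this, because the integral of [1/w] over a set is controlled by a fixed power of its measure. *)

Section complex_aux.
Context {R : realType}.
Implicit Types (z : R[i]) (u v : R) (n m : nat).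

Lemma normc_ge0 z : 0 <= cmod z.
Proof. by case: z => a b /=; rewrite sqrtr_ge0. Qed.

Lemma normcX z n : cmod (z ^+ n) = cmod z ^+ n.
Proof.
elim: n => [|n IH]; first by rewrite !expr0 ComplexField.Normc.normc1.
by rewrite !exprS ComplexField.Normc.normcM IH.
Qed.

Lemma Re_le_normc z : `|complex.Re z| <= cmod z.
Proof. by have := normc_ge_Re z; rewrite lecR. Qed.

Lemma normc_real u : cmod (real_complex R u) = `|u|.
Proof. by rewrite /= expr0n/= addr0 sqrtr_sqr. Qed.

Lemma normc_imag v : cmod (Complex 0 v) = `|v|.
Proof. by rewrite /= expr0n/= add0r sqrtr_sqr. Qed.

Lemma Im_le_normc z : `|complex.Im z| <= cmod z.
Proof.
case: z => a b /=; rewrite -[leLHS]sqrtr_sqr ler_sqrt ?lerDr ?sqr_ge0//.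
by rewrite addr_ge0 ?sqr_ge0.
Qed.

Lemma normc_le_ReIm z : cmod z <= `|complex.Re z| + `|complex.Im z|.
Proof.
case: z => a b; have -> : Complex a b = real_complex R a + Complex 0 b.
  by apply/eqP; rewrite eq_complex /= addr0 add0r !eqxx.
apply: le_trans (le_normcD _ _) _.
by rewrite normc_real normc_imag /= addr0 add0r.
Qed.

(** Every term of the binomial expansion except [(i v)^n] is estimated by its modulus; the induction
    replaces writing the expansion out. *)
Lemma normc_subX_imag u v n :
  cmod (Complex u v ^+ n - Complex 0 v ^+ n) <= (`|u| + `|v|) ^+ n - `|v| ^+ n.
Proof.
elim: n => [|n IH].
  by rewrite !expr0 !subrr ComplexField.Normc.normc0.
have -> : Complex u v ^+ n.+1 - Complex 0 v ^+ n.+1 =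
    real_complex R u * Complex u v ^+ n +
    Complex 0 v * (Complex u v ^+ n - Complex 0 v ^+ n).
  have E : real_complex R u = Complex u v - Complex 0 v.
    by apply/eqP; rewrite eq_complex /= subr0 subrr !eqxx.
  by rewrite E !exprS; ring.
apply: le_trans (le_normcD _ _) _.
rewrite !ComplexField.Normc.normcM normc_real normc_imag normcX.
have h1 : cmod (Complex u v) ^+ n <= (`|u| + `|v|) ^+ n.
  by rewrite lerXn2r ?nnegrE ?addr_ge0 ?normc_ge0// (normc_le_ReIm (Complex u v)).
have h2 := ler_wpM2l (normr_ge0 u) h1.
have h3 := ler_wpM2l (normr_ge0 v) IH.
apply: le_trans (lerD h2 h3) _.
by rewrite !exprS le_eqVlt; apply/orP; left; apply/eqP; ring.
Qed.

(** An upper bound [1 / (1 - n s)] for [(1 + s)^n], multiplied out. The induction step only drops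
    the term [(n + 1) s^2]. *)
Lemma bernoulli_inv (s : R) n : 0 <= s -> (1 - n%:R * s) * (1 + s) ^+ n <= 1.
Proof.
move=> s0; elim: n => [|n IH]; first by rewrite mul0r subr0 mul1r expr0.
apply: le_trans IH; rewrite exprS mulrA ler_wpM2r ?exprn_ge0 ?addr_ge0//.
rewrite -natr1.
have : 0 <= (n%:R + 1) * s ^+ 2 by rewrite mulr_ge0 ?sqr_ge0 ?addr_ge0.
by nra.
Qed.

Lemma imag_expr_double v m : Complex 0 v ^+ (2 * m) = real_complex R ((-1) ^+ m * v ^+ (2 * m)).
Proof.
rewrite !exprM -exprMn rmorphXn; congr (_ ^+ _).
rewrite !expr2; apply/eqP; rewrite eq_complex /=.
by rewrite !mul0r !mulr0 !add0r mulN1r !eqxx.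
Qed.

(* When [v] dominates [u], the term [(i v)^(2m)] dominates the expansion of
   [(u + i v)^(2m)]; otherwise everything is controlled by [u]. *)
Lemma riesz_pointwise u v m : (0 < m)%N ->
  v ^+ (2 * m) <= 2 * ((-1) ^+ m * complex.Re (Complex u v ^+ (2 * m)))
                  + 3 * (7 * m%:R) ^+ (2 * m) * u ^+ (2 * m).
Proof.
move=> m0.
have ev (x : R) : x ^+ (2 * m) = `|x| ^+ (2 * m).
  by rewrite !exprM real_normK ?num_real.
have m1 : 1 <= m%:R :> R by rewrite ler1n.
have [uv|vu] := leP (6 * m%:R * `|u|) `|v|.
- have := normc_subX_imag u v (2 * m).
  rewrite imag_expr_double.
  set z := _ ^+ _; set w := (-1) ^+ m * _ => H.
  have rz : `|complex.Re z - w| <= 2^-1 * v ^+ (2 * m).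
    have := Re_le_normc (z - real_complex R w).
    have -> : complex.Re (z - real_complex R w) = complex.Re z - w by case: (z).
    move=> /le_trans -> //; apply: le_trans H _.
    rewrite ev; have [v0|v0] := eqVneq v 0.
      move: uv; rewrite v0 normr0 => uv.
      have -> : `|u| = 0.
        apply/eqP; rewrite eq_le normr_ge0 andbT.
        by move: uv; rewrite pmulr_rle0//; nra.
      by rewrite addr0 subrr expr0n muln_eq0/= -leqn0 leqNgt m0 /= mulr0.
    have nv : 0 < `|v| by rewrite normr_gt0.
    have s0 : 0 <= `|u| / `|v| by rewrite divr_ge0.
    have := bernoulli_inv (2 * m) s0.
    (* The threshold [6 m] is made for this [1/3]: it gives [(1 + |u|/|v|)^(2m) <= 3/2], so the
       error is at most half of the main term. *)
    have sm : (2 * m)%:R * (`|u| / `|v|) <= 3^-1.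
      rewrite mulrA ler_pdivrMr// natrM; move: uv; lra.
    have e0 : 0 <= (1 + `|u| / `|v|) ^+ (2 * m) by rewrite exprn_ge0 ?addr_ge0.
    have -> : (`|u| + `|v|) ^+ (2 * m) = `|v| ^+ (2 * m) * (1 + `|u| / `|v|) ^+ (2 * m).
      by rewrite -exprMn mulrDr mulr1 mulrCA divff ?gt_eqF// mulr1 addrC.
    have : 0 <= `|v| ^+ (2 * m) by rewrite exprn_ge0.
    move: e0 sm; set e := _ ^+ _; set s := _ * (_ / _); set V := `|v| ^+ _.
    move=> e0 sm V0 B; have : e <= 3 / 2 by nra.
    by nra.
  have rest : 0 <= 3 * (7 * m%:R) ^+ (2 * m) * u ^+ (2 * m).
    by rewrite [u ^+ _]ev !(mulr_ge0, exprn_ge0).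
  have sg : ((-1) ^+ m * (-1) ^+ m = 1 :> R) by rewrite -exprMn mulrNN mulr1 expr1n.
  have : `|(-1) ^+ m * (complex.Re z - w)| <= 2^-1 * v ^+ (2 * m).
    by rewrite normrM normrX normrN1 expr1n mul1r.
  have -> : (-1) ^+ m * (complex.Re z - w) = (-1) ^+ m * complex.Re z - v ^+ (2 * m).
    by rewrite mulrBr /w [X in _ - X]mulrA sg mul1r.
  by move=> /ler_normlP []; lra.
(* The constant 7 is [6 + 1]. Both [v^(2m)] and the modulus of the real part are at most [P], and
   [P = 3 P - 2 P] explains the constant 3. *)
- have h : cmod (Complex u v) <= 7 * m%:R * `|u|.
    apply: le_trans (normc_le_ReIm _) _ => /=.
    have : `|u| <= m%:R * `|u| by rewrite ler_peMl.
    by move: vu; nra.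
  set P := (7 * m%:R * `|u|) ^+ (2 * m).
  have -> : 3 * (7 * m%:R) ^+ (2 * m) * u ^+ (2 * m) = 3 * P.
    by rewrite /P [in RHS]exprMn [u ^+ _]ev mulrA.
  have h1 : `|complex.Re (Complex u v ^+ (2 * m))| <= P.
    apply: le_trans (Re_le_normc _) _; rewrite normcX lerXn2r ?nnegrE ?normc_ge0//.
  have h2 : v ^+ (2 * m) <= P.
    rewrite ev lerXn2r ?nnegrE//.
    exact: le_trans (Im_le_normc (Complex u v)) h.
  have : `|(-1) ^+ m * complex.Re (Complex u v ^+ (2 * m))| <= P.
    by rewrite normrM normrX normrN1 expr1n mul1r.
  by move=> /ler_normlP []; lra.
Qed.

End complex_aux.

(** * Real polynomials on the unit circle and their mean value property *)

Section trig.
Context {R : realType}.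
Local Notation mu := (@lebesgue_measure R).
Implicit Types (p q : {poly R}) (x t : R) (n m : nat).

Lemma continuous_sum_ord (F : nat -> R -> R) n :
  (forall i, continuous (F i)) -> continuous (fun x => \sum_(i < n) F i x).
Proof.
move=> cF; elim: n => [|n IH] x.
  under eq_fun do rewrite big_ord0; exact: cvg_cst.
under eq_fun do rewrite big_ord_recr /=.
by apply: cvgD; [exact: IH | exact: cF].
Qed.

Lemma continuous_integrable_itv (f : R -> R) (a b : R) : continuous f ->
  mu.-integrable `[a, b] (EFin \o f).
Proof.
move=> cf; apply: continuous_compact_integrable; first exact: segment_compact.
exact: continuous_subspaceT.
Qed.

Lemma integrable_real_sum (I : Type) (s : seq I) (F : I -> R -> R) (D : set R) :
  measurable D -> (forall i, mu.-integrable D (EFin \o F i)) ->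
  mu.-integrable D (EFin \o (fun x => \sum_(i <- s) F i x)).
Proof.
move=> mD iF; have := @integrable_sum _ _ _ mu D mD I s xpredT
  (fun i x => (F i x)%:E) (fun i _ => iF i).
by congr (_.-integrable _ _); apply/funext => x /=; rewrite sumEFin.
Qed.

Lemma Rintegral_sum (I : Type) (s : seq I) (F : I -> R -> R) (D : set R) :
  measurable D -> (forall i, mu.-integrable D (EFin \o F i)) ->
  \int[mu]_(x in D) (\sum_(i <- s) F i x) = \sum_(i <- s) \int[mu]_(x in D) F i x.
Proof.
move=> mD iF; elim: s => [|i s IH].
  under eq_Rintegral do rewrite big_nil.
  by rewrite big_nil Rintegral_cst// mul0r.
under eq_Rintegral do rewrite big_cons.
by rewrite RintegralD ?IH ?big_cons//; exact: integrable_real_sum.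
Qed.

Lemma Rintegral_sum_ord (F : nat -> R -> R) n (D : set R) : measurable D ->
  (forall i, mu.-integrable D (EFin \o F i)) ->
  \int[mu]_(x in D) (\sum_(i < n) F i x) = \sum_(i < n) \int[mu]_(x in D) F i x.
Proof. by move=> mD iF; exact: Rintegral_sum. Qed.

Lemma continuous_cosM (c : R) : continuous (fun t : R => cos (c * t)).
Proof.
move=> t; apply: (@continuous_comp _ _ _ (fun t => c * t) cos).
  exact: mulrl_continuous.
exact: continuous_cos.
Qed.

Lemma continuous_sinM (c : R) : continuous (fun t : R => sin (c * t)).
Proof.
move=> t; apply: (@continuous_comp _ _ _ (fun t => c * t) sin).
  exact: mulrl_continuous.
exact: continuous_sin.
Qed.

Lemma sin_natpi n : sin (n%:R * pi : R) = 0.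
Proof.
elim: n => [|n IH]; first by rewrite mul0r sin0.
by rewrite -natr1 mulrDl mul1r sinDpi IH oppr0.
Qed.

Lemma Rintegral_cos n : \int[mu]_(t in `[0, pi]) cos (n%:R * t) = if n == 0%N then pi else 0.
Proof.
case: n => [|n] /=.
  under eq_Rintegral do rewrite mul0r cos0.
  rewrite Rintegral_cst// mul1r.
  transitivity (fine (pi%:E : \bar R)) => //; congr fine.
  apply: etrans (lebesgue_measure_itv `[0, pi]) _ => /=.
  by rewrite lte_fin pi_gt0 oppr0 addr0.
have n0 : n.+1%:R != 0 :> R by rewrite pnatr_eq0.
rewrite /Rintegral.
have der x : is_derive x 1 (fun t : R => n.+1%:R^-1 * sin (n.+1%:R * t)) (cos (n.+1%:R * x)).
  apply: is_derive_eq.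
  change (n.+1%:R^-1 * (cos (n.+1%:R * x) * (n.+1%:R * 1)) = cos (n.+1%:R * x)).
  by rewrite mulr1 mulrCA mulVf ?mulr1.
rewrite (@continuous_FTC2 _ _ (fun t : R => n.+1%:R^-1 * sin (n.+1%:R * t)))//.
- by rewrite sin_natpi !mulr0 sin0 mulr0 /= subrr.
- exact: pi_gt0.
- exact/continuous_subspaceT/continuous_cosM.
- split.
  + by move=> x _.
  + apply: cvg_at_right_filter.
    by apply: cvgM; [exact: cvg_cst|exact: continuous_sinM].
  + apply: cvg_at_left_filter.
    by apply: cvgM; [exact: cvg_cst|exact: continuous_sinM].
- by move=> x _; rewrite derive1E derive_val.
Qed.

Definition cis (t : R) : R[i] := Complex (cos t) (sin t).

Lemma cisD x t : cis (x + t) = cis x * cis t.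
Proof.
by apply/eqP; rewrite eq_complex /= cosD sinD eqxx [X in _ == X]addrC/=.
Qed.

Lemma cisX t n : cis t ^+ n = cis (n%:R * t).
Proof.
elim: n => [|n IH]; first by rewrite mul0r /cis cos0 sin0 expr0.
by rewrite exprS IH -cisD -natr1 mulrDl mul1r addrC.
Qed.

(** Keeping the polynomial, rather than its values, makes powers of the trigonometric expression
    into powers in [{poly R}], whose constant coefficient is explicit. *)
Definition cpoly p t : R[i] := (map_poly (real_complex R) p).[cis t].

Lemma cpoly_wide p t n : (size p <= n)%N ->
  cpoly p t = Complex (\sum_(i < n) p`_i * cos (i%:R * t))
                      (\sum_(i < n) p`_i * sin (i%:R * t)).
Proof.
move=> pn; rewrite /cpoly (@horner_coef_wide _ n) ?size_map_poly//.
apply: (big_ind3 (fun z x y => z = Complex x y)) => //.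
  by move=> z1 x1 y1 z2 x2 y2 -> ->.
move=> i _; rewrite coef_map cisX; apply/eqP; rewrite eq_complex /=.
by rewrite !mul0r subr0 addr0 !eqxx.
Qed.

Lemma cpolyE p t : cpoly p t = Complex (\sum_(i < size p) p`_i * cos (i%:R * t))
                                       (\sum_(i < size p) p`_i * sin (i%:R * t)).
Proof. exact: cpoly_wide. Qed.

Lemma continuous_Re_cpoly p : continuous (fun t => complex.Re (cpoly p t)).
Proof.
under eq_fun do rewrite cpolyE /=.
apply: (@continuous_sum_ord (fun i t => p`_i * cos (i%:R * t))) => i t.
by apply: cvgM; [exact: cvg_cst|exact: continuous_cosM].
Qed.

Lemma continuous_Im_cpoly p : continuous (fun t => complex.Im (cpoly p t)).
Proof.
under eq_fun do rewrite cpolyE /=.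
apply: (@continuous_sum_ord (fun i t => p`_i * sin (i%:R * t))) => i t.
by apply: cvgM; [exact: cvg_cst|exact: continuous_sinM].
Qed.

Lemma continuousX_fun (f : R -> R) n : continuous f -> continuous (fun t => f t ^+ n).
Proof. by move=> cf t; apply: (@continuous_comp _ _ _ f (fun x => x ^+ n)); [exact: cf|exact: exprn_continuous]. Qed.

(** Real coefficients leave only cosines in the real part, so half of the circle already isolates
    the constant coefficient. *)
Lemma mean_value_cpoly p :
  \int[mu]_(t in `[0, pi]) complex.Re (cpoly p t) = pi * p`_0.
Proof.
under eq_Rintegral do rewrite cpolyE /=.
have cF i : continuous (fun t : R => p`_i * cos (i%:R * t)).
  by move=> t; apply: cvgM; [exact: cvg_cst|exact: continuous_cosM].
rewrite (@Rintegral_sum_ord (fun i t => p`_i * cos (i%:R * t)))//; last first.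
  by move=> i; exact: continuous_integrable_itv.
under eq_bigr => i _.
  rewrite RintegralZl//; last exact/continuous_integrable_itv/continuous_cosM.
  rewrite Rintegral_cos; over.
case E : (size p) => [|n].
  by rewrite big_ord0 nth_default ?E// mulr0.
rewrite big_ord_recl /= big1 ?addr0 1?mulrC// => i _.
by rewrite mulr0.
Qed.

Lemma cpolyX p n t : cpoly (p ^+ n) t = cpoly p t ^+ n.
Proof. by rewrite /cpoly rmorphXn horner_exp. Qed.

(** The real part in [riesz_pointwise] is that of the polynomial [p ^+ (2 * m)], so its mean is the
    constant coefficient of [p] to the power [2m]; the sign [(-1)^m] is harmless. *)
Lemma riesz_cpoly p m : (0 < m)%N ->
  \int[mu]_(t in `[0, pi]) (complex.Im (cpoly p t)) ^+ (2 * m) <=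
  2 * (pi * p`_0 ^+ (2 * m)) +
  3 * (7 * m%:R) ^+ (2 * m) *
    \int[mu]_(t in `[0, pi]) (complex.Re (cpoly p t)) ^+ (2 * m).
Proof.
move=> m0.
have c0 : (p ^+ (2 * m))`_0 = p`_0 ^+ (2 * m).
  by rewrite -!horner_coef0 horner_exp.
have iRe : mu.-integrable `[0, pi]
    (EFin \o (fun t => 2 * ((-1) ^+ m * complex.Re (cpoly (p ^+ (2 * m)) t)))).
  apply: continuous_integrable_itv => t; apply: cvgM; first exact: cvg_cst.
  by apply: cvgM; [exact: cvg_cst|exact: continuous_Re_cpoly].
have iR : mu.-integrable `[0, pi] (EFin \o (fun t => complex.Re (cpoly p t) ^+ (2 * m))).
  by apply: continuous_integrable_itv; apply: continuousX_fun; exact: continuous_Re_cpoly.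
have iR' : mu.-integrable `[0, pi] (EFin \o (fun t => 
    3 * (7 * m%:R) ^+ (2 * m) * complex.Re (cpoly p t) ^+ (2 * m))).
  apply: continuous_integrable_itv => t; apply: cvgM; first exact: cvg_cst.
  by apply: continuousX_fun; exact: continuous_Re_cpoly.
have iI : mu.-integrable `[0, pi] (EFin \o (fun t => complex.Im (cpoly p t) ^+ (2 * m))).
  by apply: continuous_integrable_itv; apply: continuousX_fun; exact: continuous_Im_cpoly.
apply: le_trans.
  apply: (@le_Rintegral _ _ _ mu _ _ (fun t =>
    2 * ((-1) ^+ m * complex.Re (cpoly (p ^+ (2 * m)) t)) +
    3 * (7 * m%:R) ^+ (2 * m) * complex.Re (cpoly p t) ^+ (2 * m)) _ iI) => //.
    exact: integrableD iRe iR'.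
  move=> t _; rewrite cpolyX.
  by have := riesz_pointwise (complex.Re (cpoly p t)) (complex.Im (cpoly p t)) m0; case: (cpoly p t).
rewrite RintegralD// RintegralZl// lerD2r.
have iq : mu.-integrable `[0, pi] (EFin \o (fun t => complex.Re (cpoly (p ^+ (2 * m)) t))).
  exact/continuous_integrable_itv/continuous_Re_cpoly.
rewrite RintegralZl//; last first.
  apply: continuous_integrable_itv => t; apply: cvgM; first exact: cvg_cst.
  exact: continuous_Re_cpoly.
rewrite RintegralZl// mean_value_cpoly c0.
rewrite ler_pM2l//.
apply: le_trans (ler_norm _) _.
rewrite normrM normrX normrN1 expr1n mul1r ger0_norm// mulr_ge0 ?pi_ge0//.
by rewrite exprM exprn_ge0 ?sqr_ge0.
Qed.

End trig.

(** * The substitution [x = cos phi] *)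

Section change_of_variable.
Context {R : realType}.
Local Notation mu := (@lebesgue_measure R).
Implicit Types (x t c : R).

Lemma dom11E x : dom11 x <-> -1 < x < 1.
Proof. by rewrite /dom11 /= in_itv. Qed.

Lemma measurable_dom11 : measurable (@dom11 R).
Proof. exact: measurable_itv. Qed.

Lemma one_sub_sqr_gt0 x : dom11 x -> 0 < 1 - x ^+ 2.
Proof. by move=> /dom11E; nra. Qed.

Lemma weight_gt0 x : dom11 x -> 0 < weight x.
Proof. by move=> /one_sub_sqr_gt0; rewrite /weight sqrtr_gt0. Qed.

Lemma weight_ge0 x : 0 <= weight x.
Proof. exact: sqrtr_ge0. Qed.

Lemma weight_le1 x : weight x <= 1.
Proof. by rewrite /weight -[leRHS]sqrtr1 ler_wsqrtr// lerBlDr lerDl sqr_ge0. Qed.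

Lemma continuous_weight : continuous (@weight R).
Proof.
move=> x; apply: (@continuous_comp _ _ _ (fun x => 1 - x ^+ 2) Num.sqrt).
  by apply: cvgB; [exact: cvg_cst|exact: exprn_continuous].
exact: sqrt_continuous.
Qed.

Lemma continuous_inv_weight x : dom11 x -> {for x, continuous (fun y => (weight y)^-1)}.
Proof.
by move=> dx; apply: cvgV; [rewrite gt_eqF ?weight_gt0|exact: continuous_weight].
Qed.

Lemma segment_sub_dom11 c x : 0 <= c < 1 -> -c <= x <= c -> dom11 x.
Proof. by move=> c01 xc; apply/dom11E; lra. Qed.

Lemma is_derive_acos x : dom11 x -> is_derive x 1 acos (- (weight x)^-1).
Proof. by move=> /dom11E; exact: is_derive1_acos. Qed.

Lemma acos_decreasing : {in `[-1, 1] &, {homo (@acos R) : x y /~ x < y}}.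
Proof.
move=> x y x1 y1 yx.
have [x1' y1'] : -1 <= x <= 1 /\ -1 <= y <= 1 by move: x1 y1; rewrite !in_itv.
by rewrite -ltr_cos ?in_itv /= ?acos_ge0 ?acos_lepi// !acosK.
Qed.

(** [acos] is not differentiable at -1 and 1, hence the compact segments inside the open
    interval. *)
Lemma acos_subst_segment (G : R -> R) c : 0 < c < 1 -> continuous G ->
  (\int[mu]_(x in `[(- c)%R, c]) (G (acos x) / weight x)%:E =
   \int[mu]_(t in `[acos c, acos (- c)%R]) (G t)%:E)%E.
Proof.
move=> c01 cG.
have c01' : 0 <= c < 1 by lra.
have dE x : dom11 x -> derive1 (@acos R) x = - (weight x)^-1.
  by move=> dx; rewrite derive1E; have := is_derive_acos dx => h; rewrite derive_val.
have dc : dom11 c by apply/dom11E; lra.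
have dNc : dom11 (- c) by apply/dom11E; lra.
have cdv x : dom11 x -> (fun y => - (weight y)^-1) y @[y --> x] --> - (weight x)^-1.
  by move=> dx; apply: cvgN; exact: continuous_inv_weight.
have ndom x : dom11 x -> \forall y \near x, dom11 y.
  by move=> /dom11E dx; apply: near_in_itvoo; rewrite in_itv.
have ndE x : dom11 x -> \forall y \near x, - (weight y)^-1 = derive1 (@acos R) y.
  by move=> /ndom; apply: filterS => y dy; rewrite dE.
have cd x : dom11 x -> derive1 (@acos R) y @[y --> x] --> - (weight x)^-1.
  move=> dx; apply: cvg_trans (cdv _ dx); apply: near_eq_cvg.
  exact: ndE.
rewrite (@integration_by_substitution_decreasing _ acos G (- c) c)//.
- apply: eq_integral => x; rewrite inE /= in_itv /= => xc; congr EFin.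
  by rewrite /GRing.mul /= /GRing.opp /= dE ?opprK//; exact: segment_sub_dom11 xc.
- lra.
- move=> x y; rewrite !in_itv /= => xc yc; apply: acos_decreasing; rewrite in_itv /=; lra.
- move=> x; rewrite in_itv /= => xc.
  have dx : dom11 x by apply/dom11E; lra.
  by rewrite /continuous_at dE//; exact: cd.
- apply/cvg_ex; exists (- (weight (- c))^-1); exact/cvg_at_right_filter/cd.
- apply/cvg_ex; exists (- (weight c)^-1); exact/cvg_at_left_filter/cd.
- split.
  + move=> x; rewrite in_itv /= => xc.
    have dx : dom11 x by apply/dom11E; lra.
    by have [] := is_derive_acos dx.
  + by apply/cvg_at_right_filter/continuous_acos; apply/dom11E.
  + by apply/cvg_at_left_filter/continuous_acos; apply/dom11E.
- exact: continuous_subspaceT.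
Qed.

Lemma measurable_acos_weight (G : R -> R) : continuous G ->
  measurable_fun dom11 (fun x => G (acos x) / weight x).
Proof.
move=> cG; apply: open_continuous_measurable_fun; first exact: interval_open.
move=> x; rewrite inE => dx; apply: cvgM; last exact: continuous_inv_weight.
apply: (@continuous_comp _ _ _ acos G); last exact: cG.
by apply: continuous_acos; apply/dom11E.
Qed.

(** Monotone convergence along segments exhausting the open interval; each of them is mapped into
    [[0, pi]]. *)
Lemma acos_subst_le (G : R -> R) : continuous G -> (forall t, 0 <= G t) ->
  (\int[mu]_(x in dom11) (G (acos x) / weight x)%:E <=
   \int[mu]_(t in `[0%R, pi]) (G t)%:E)%E.
Proof.
move=> cG G0.
pose F n := (`[- (1 - n.+2%:R^-1), 1 - n.+2%:R^-1]%classic : set R).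
have c01 n : (0 : R) < 1 - n.+2%:R^-1 < (1 : R).
  have n0 : 0 < n.+2%:R^-1 :> R by rewrite invr_gt0.
  have : n.+2%:R^-1 < 1 :> R by rewrite invf_lt1// ltr1n.
  by move: n0; set e := _^-1; lra.
have FE : \bigcup_n F n = dom11.
  apply/seteqP; split => [x [n _]|x /dom11E x1].
    by rewrite /F /= in_itv /= => xn; apply/dom11E; have := c01 n; move: xn; set e := n.+2%:R^-1; lra.
  have [k] : exists k, `|x| + k.+1%:R^-1 < 1 by apply: ltr_add_invr; rewrite ltr_norml.
  move=> hk; exists k => //; rewrite /F /= in_itv /= -ler_norml.
  have : k.+2%:R^-1 <= k.+1%:R^-1 :> R by rewrite lef_pV2 ?posrE// ler_nat.
  by move: hk; set e := _^-1; set d := k.+2%:R^-1; lra.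
have Fmono : {homo F : n m / (n <= m)%N >-> (n <= m)%O}.
  move=> n m nm; apply/subsetPset => x; rewrite /F /= !in_itv /=.
  have : m.+2%:R^-1 <= n.+2%:R^-1 :> R by rewrite lef_pV2 ?posrE// ler_nat.
  by set e := m.+2%:R^-1; set d := n.+2%:R^-1; lra.
have Fdom n : F n `<=` dom11 by rewrite -FE; exact: bigcup_sup.
have mf : measurable_fun dom11 (fun x => (G (acos x) / weight x)%:E).
  by apply/measurable_EFinP; exact: measurable_acos_weight.
have := @ge0_nondecreasing_set_cvg_integral _ (measurableTypeR R) _ F (fun x => (G (acos x) / weight x)%:E) mu.
move=> /(_ Fmono (fun i => measurable_itv _)).
move=> /(_ (fun i => measurable_funS measurable_dom11 (Fdom i) mf)).
have f0 n x : F n x -> (0%R <= (G (acos x) / weight x)%:E)%E.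
  by move=> _; rewrite lee_fin mulr_ge0// invr_ge0 weight_ge0.
move=> /(_ f0); rewrite FE => cv.
rewrite -(cvg_lim _ cv)//; apply: lime_le; first by apply/cvg_ex; eexists; exact: cv.
apply: nearW => n; rewrite /F acos_subst_segment//.
apply: ge0_subset_integral => //.
- apply/measurable_EFinP/measurable_funTS; exact: continuous_measurable_fun.
- by move=> t _; rewrite lee_fin.
- move=> x; rewrite /= !in_itv /=.
  have := c01 n; set c := 1 - _ => c01n.
  have := @acos_ge0 R c; have := @acos_lepi R (- c).
  lra.
Qed.

End change_of_variable.

Section real_integrable.
Context {R : realType}.
Local Notation mu := (@lebesgue_measure R).
Implicit Types (D : set R) (f g : R -> R).

Lemma integrable_realD D f g : measurable D ->
  mu.-integrable D (EFin \o f) -> mu.-integrable D (EFin \o g) ->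
  mu.-integrable D (EFin \o (fun x => f x + g x)).
Proof. by move=> mD; exact: integrableD. Qed.

Lemma integrable_realB D f g : measurable D ->
  mu.-integrable D (EFin \o f) -> mu.-integrable D (EFin \o g) ->
  mu.-integrable D (EFin \o (fun x => f x - g x)).
Proof. by move=> mD; exact: integrableB. Qed.

Lemma integrable_realZl D f (k : R) : measurable D ->
  mu.-integrable D (EFin \o f) -> mu.-integrable D (EFin \o (fun x => k * f x)).
Proof. by move=> mD /(@integrableZl _ _ _ mu D mD k). Qed.

Lemma integrable_real_le D f g : measurable D -> measurable_fun D f ->
  (forall x, D x -> `|f x| <= g x) ->
  mu.-integrable D (EFin \o g) -> mu.-integrable D (EFin \o f).
Proof.
move=> mD mf fg; apply: le_integrable => //; first exact/measurable_EFinP.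
by move=> x Dx /=; rewrite lee_fin (le_trans (fg x Dx))// ler_norm.
Qed.

Lemma integrable_mul_bounded D f g (B : R) : measurable D -> measurable_fun D g ->
  (forall x, D x -> `|g x| <= B) ->
  mu.-integrable D (EFin \o f) -> mu.-integrable D (EFin \o (fun x => f x * g x)).
Proof.
move=> mD mg gB iF; have mf : measurable_fun D f.
  by apply/measurable_EFinP; exact: measurable_int iF.
apply: (@integrable_real_le _ _ (fun x => B * `|f x|)) => //.
- exact: measurable_funM.
- by move=> x Dx; rewrite normrM mulrC ler_wpM2r// gB.
- apply: integrable_realZl => //; exact: integrable_norm iF.
Qed.

Lemma normr_Rintegral_le D f g : measurable D ->
  mu.-integrable D (EFin \o f) -> mu.-integrable D (EFin \o g) ->
  (forall x, D x -> `|f x| <= g x) ->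
  `|\int[mu]_(x in D) f x| <= \int[mu]_(x in D) g x.
Proof.
move=> mD iF ig fg; apply: (@le_trans _ _ (\int[mu]_(x in D) `|f x|)).
  exact: le_normr_Rintegral.
by apply: le_Rintegral => //; exact: integrable_norm iF.
Qed.

End real_integrable.

(** * Jensen's inequality for even powers *)

Section jensen.
Context {R : realType}.
Local Notation mu := (@lebesgue_measure R).
Implicit Types (x c : R) (n m : nat).

Lemma bernoulli_ge n x : -1 <= x -> 1 + n%:R * x <= (1 + x) ^+ n.
Proof.
move=> x1; elim: n => [|n IH]; first by rewrite mul0r addr0 expr0.
have h := ler_wpM2l (_ : 0 <= 1 + x) IH.
rewrite exprS; apply: le_trans (h _); last lra.
rewrite -natr1; have : 0 <= n%:R * x ^+ 2 by rewrite mulr_ge0// sqr_ge0.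
by nra.
Qed.

(** Bernoulli's inequality for [x / c - 1], scaled by [c^(2m)]. If [x / c - 1 < -1], the tangent
    line is nonpositive while an even power is nonnegative. *)
Lemma tangent_expr x c m : (0 < m)%N ->
  c ^+ (2 * m) + (2 * m)%:R * c ^+ (2 * m).-1 * (x - c) <= x ^+ (2 * m).
Proof.
move=> m0.
have ev y : 0 <= y ^+ (2 * m) :> R by rewrite exprM exprn_ge0 ?sqr_ge0.
have [->|c0] := eqVneq c 0.
  case: m m0 ev => // m _ ev; rewrite mulnS /= !exprS !mul0r mulr0 mul0r add0r.
  by have := ev x; rewrite mulnS !exprS.
have e : c ^+ (2 * m) = c * c ^+ (2 * m).-1 by rewrite -exprS prednK// muln_gt0.
have xE : x ^+ (2 * m) = c ^+ (2 * m) * (1 + (x / c - 1)) ^+ (2 * m).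
  by rewrite -exprMn addrC subrK mulrC divfK.
have -> : c ^+ (2 * m) + (2 * m)%:R * c ^+ (2 * m).-1 * (x - c) =
          c ^+ (2 * m) * (1 + (2 * m)%:R * (x / c - 1)).
  by rewrite e; field.
rewrite xE ler_wpM2l//.
have [h|h] := leP (-1) (x / c - 1); first exact: bernoulli_ge.
apply: le_trans (ev _).
have : 1 <= (2 * m)%:R :> R by rewrite ler1n muln_gt0.
move: h; set y := x / c - 1; set k := _%:R; nra.
Qed.

(** Integrate the tangent inequality at [c = J / M]. Mass missing from [M] acts like a place where
    [f] vanishes, and the tangent at [c] has the nonpositive value [(1 - 2m) c^(2m)] at 0. *)
Lemma jensen_expr (D : set R) (f rho : R -> R) m (M : R) : (0 < m)%N -> 0 < M ->
  measurable D -> (forall x, D x -> 0 <= rho x) ->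
  mu.-integrable D (EFin \o rho) ->
  mu.-integrable D (EFin \o (fun x => f x * rho x)) ->
  mu.-integrable D (EFin \o (fun x => f x ^+ (2 * m) * rho x)) ->
  \int[mu]_(x in D) rho x <= M ->
  (\int[mu]_(x in D) (f x * rho x)) ^+ (2 * m) <=
  M ^+ (2 * m).-1 * \int[mu]_(x in D) (f x ^+ (2 * m) * rho x).
Proof.
move=> m0 M0 mD rho0 irho ifrho ifmrho rhoM.
set J := \int[mu]_(x in D) (f x * rho x); pose c := J / M.
set a := (2 * m)%:R * c ^+ (2 * m).-1.
have JE : J = c * M by rewrite /c divfK ?gt_eqF.
have ev y : 0 <= y ^+ (2 * m) :> R by rewrite exprM exprn_ge0 ?sqr_ge0.
have irho' k : mu.-integrable D (EFin \o (fun x => k * rho x)).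
  exact: integrable_realZl.
have ifrho' k : mu.-integrable D (EFin \o (fun x => k * (f x * rho x))).
  exact: integrable_realZl.
have h : \int[mu]_(x in D) ((c ^+ (2 * m) - a * c) * rho x + a * (f x * rho x)) <=
         \int[mu]_(x in D) (f x ^+ (2 * m) * rho x).
  apply: le_Rintegral => //.
    exact: integrable_realD.
  move=> x Dx; have := ler_wpM2r (rho0 x Dx) (tangent_expr (f x) c m0).
  by rewrite -/a; apply: le_trans; rewrite le_eqVlt; apply/orP; left; apply/eqP; ring.
rewrite RintegralD// !RintegralZl// -/J in h.
have M2 : M ^+ (2 * m) = M * M ^+ (2 * m).-1 by rewrite -exprS prednK// muln_gt0.
have M1 : 0 <= M ^+ (2 * m).-1 by rewrite exprn_ge0// ltW.
have -> : J ^+ (2 * m) = M ^+ (2 * m).-1 * (c ^+ (2 * m) * M).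
  by rewrite JE exprMn M2; ring.
rewrite ler_wpM2l//; apply: le_trans h.
have ac : a * c = (2 * m)%:R * c ^+ (2 * m).
  by rewrite /a -mulrA -exprSr prednK// muln_gt0.
have k1 : 1 <= (2 * m)%:R :> R by rewrite ler1n muln_gt0.
move: rhoM; set r := Rintegral _ _ _ => rhoM.
have aJ : a * J = (2 * m)%:R * c ^+ (2 * m) * M by rewrite JE mulrA ac.
rewrite aJ ac; have := ev c; move: k1; set k := _%:R; set C := c ^+ _ => k1 C0.
have : 0 <= C * ((k - 1) * (M - r)).
  by rewrite !mulr_ge0// ?subr_ge0.
by lra.
Qed.

End jensen.

(** * Truncated Poisson and conjugate Poisson means *)

Section kernel.
Context {R : realType}.
Local Notation mu := (@lebesgue_measure R).
Implicit Types (r th ph ps x : R) (n N m : nat).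

Lemma cos_rec n ps :
  cos (n.+2%:R * ps) = 2 * cos ps * cos (n.+1%:R * ps) - cos (n%:R * ps).
Proof.
have -> : n.+2%:R * ps = n.+1%:R * ps + ps by rewrite -natr1 mulrDl mul1r.
have -> : n%:R * ps = n.+1%:R * ps - ps by rewrite -natr1 mulrDl mul1r addrK.
by rewrite cosD cosB; ring.
Qed.

Lemma sin_rec n ps :
  sin (n.+2%:R * ps) = 2 * cos ps * sin (n.+1%:R * ps) - sin (n%:R * ps).
Proof.
have -> : n.+2%:R * ps = n.+1%:R * ps + ps by rewrite -natr1 mulrDl mul1r.
have -> : n%:R * ps = n.+1%:R * ps - ps by rewrite -natr1 mulrDl mul1r addrK.
by rewrite sinD sinB; ring.
Qed.

(** This is [|1 - r e^(i ps)|^2]. *)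
Definition poisson_den r ps : R := 1 - 2 * r * cos ps + r ^+ 2.

Lemma poisson_den_ge r ps : 0 <= r -> (1 - r) ^+ 2 <= poisson_den r ps.
Proof. by move=> r0; rewrite /poisson_den; have := cos_le1 ps; nra. Qed.

Lemma poisson_den_gt0 r ps : 0 < r < 1 -> 0 < poisson_den r ps.
Proof.
move=> r01; apply: lt_le_trans (poisson_den_ge ps _); last lra.
by rewrite exprn_gt0//; lra.
Qed.

Definition geo_cos r N ps : R := \sum_(i < N.+1) r ^+ i * cos (i%:R * ps).
Definition geo_sin r N ps : R := \sum_(i < N.+1) r ^+ i * sin (i%:R * ps).

(** The sum of a finite geometric series with ratio [r e^(i ps)], multiplied through by
    [|1 - r e^(i ps)|^2]. In real form the induction needs only the three-term recurrence
    [cos_rec]. *)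
Lemma geo_cosE r ps N : poisson_den r ps * geo_cos r N ps =
  1 - r * cos ps - r ^+ N.+1 * cos (N.+1%:R * ps) + r ^+ N.+2 * cos (N%:R * ps).
Proof.
rewrite /geo_cos; elim: N => [|N IH].
  by rewrite big_ord_recl big_ord0 /poisson_den /= !mul0r !mul1r cos0; ring.
by rewrite big_ord_recr /= mulrDr IH cos_rec /poisson_den !exprS; ring.
Qed.

Lemma geo_sinE r ps N : poisson_den r ps * geo_sin r N ps =
  r * sin ps - r ^+ N.+1 * sin (N.+1%:R * ps) + r ^+ N.+2 * sin (N%:R * ps).
Proof.
rewrite /geo_sin; elim: N => [|N IH].
  by rewrite big_ord_recl big_ord0 /poisson_den /= !mul0r !mul1r sin0; ring.
by rewrite big_ord_recr /= mulrDr IH sin_rec /poisson_den !exprS; ring.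
Qed.

(** In the closed form the complete series gives [1 - r cos ps >= 1 - r], and each of the two
    truncation terms costs at most [r^(N+1)]; hence the condition on [N]. *)
Lemma geo_cos_ge0 r ps N : 0 < r < 1 -> 2 * r ^+ N.+1 <= 1 - r -> 0 <= geo_cos r N ps.
Proof.
move=> r01 rN.
rewrite -(pmulr_rge0 _ (poisson_den_gt0 ps r01)) geo_cosE.
have a1 : r ^+ N.+1 * cos (N.+1%:R * ps) <= r ^+ N.+1.
  by rewrite ler_piMr ?exprn_ge0 ?cos_le1//; lra.
have a2 : - r ^+ N.+1 <= r ^+ N.+2 * cos (N%:R * ps).
  have q0 : 0 <= r ^+ N.+1 by rewrite exprn_ge0//; lra.
  have c1 : 0 <= 1 + r * cos (N%:R * ps) by have := cos_geN1 (N%:R * ps); nra.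
  have := mulr_ge0 q0 c1; rewrite (_ : r ^+ N.+2 = r * r ^+ N.+1) ?exprS//.
  by set q := _ ^+ _; lra.
have a3 : r * cos ps <= r by rewrite ler_piMr ?cos_le1//; lra.
lra.
Qed.

(* Twice the truncated Poisson kernel of even functions, raised by the
   constant that makes it nonnegative. *)
Definition even_kernel r N th ph : R :=
  2 * \sum_(i < N.+1) r ^+ i * cos (i%:R * th) * cos (i%:R * ph).

Lemma even_kernelE r N th ph :
  even_kernel r N th ph = geo_cos r N (th - ph) + geo_cos r N (th + ph).
Proof.
rewrite /even_kernel /geo_cos -big_split /= mulr_sumr; apply: eq_bigr => i _.
by rewrite mulrBr mulrDr cosB cosD; ring.
Qed.

Lemma even_kernel_ge0 r N th ph : 0 < r < 1 -> 2 * r ^+ N.+1 <= 1 - r ->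
  0 <= even_kernel r N th ph.
Proof. by move=> r01 rN; rewrite even_kernelE addr_ge0// geo_cos_ge0. Qed.

Lemma continuous_even_kernel r N th : continuous (even_kernel r N th).
Proof.
move=> ph; apply: cvgM; first exact: cvg_cst.
apply: (@continuous_sum_ord _ (fun i ph => r ^+ i * cos (i%:R * th) * cos (i%:R * ph))).
by move=> i t; apply: cvgM; [exact: cvg_cst|exact: continuous_cosM].
Qed.

(** Only the constant term has a nonzero integral. The mass [2 pi] instead of [pi] is what produces
    the factors [2 ^+ (2 * m)] below. *)
Lemma Rintegral_even_kernel r N th :
  \int[mu]_(ph in `[0, pi]) even_kernel r N th ph = 2 * pi.
Proof.
have cF i : continuous (fun ph : R => r ^+ i * cos (i%:R * th) * cos (i%:R * ph)).
  by move=> t; apply: cvgM; [exact: cvg_cst|exact: continuous_cosM].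
rewrite /even_kernel RintegralZl//; last first.
  apply: continuous_integrable_itv.
  exact: (@continuous_sum_ord _ (fun i ph => r ^+ i * cos (i%:R * th) * cos (i%:R * ph))).
rewrite (@Rintegral_sum_ord _ (fun i ph => r ^+ i * cos (i%:R * th) * cos (i%:R * ph)))//; last first.
  by move=> i; exact: continuous_integrable_itv.
congr (_ * _); rewrite big_ord_recl /= big1 ?addr0.
  under eq_Rintegral do rewrite expr0 mul0r cos0 !mul1r.
  exact: (Rintegral_cos 0).
move=> i _; rewrite RintegralZl//; last exact/continuous_integrable_itv/continuous_cosM.
by rewrite Rintegral_cos mulr0.
Qed.

Lemma inv_weight_integrable : mu.-integrable dom11 (EFin \o (fun x => (weight x)^-1)).
Proof.
apply/integrableP; split.
  apply/measurable_EFinP; apply: open_continuous_measurable_fun; first exact: interval_open.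
  by move=> x; rewrite inE => dx; exact: continuous_inv_weight.
have c1 : continuous (fun _ : R => 1 : R) by move=> x; exact: cvg_cst.
have := @acos_subst_le R (fun=> 1) c1 (fun=> ler01).
under eq_integral => x _ do rewrite mul1r.
move=> h; under eq_integral => x _.
  rewrite /= ger0_norm; last by rewrite invr_ge0 weight_ge0.
  over.
apply: le_lt_trans h _; rewrite integral_cst//= mul1e.
by rewrite lebesgue_measure_itv /= lte_fin pi_gt0 ltry.
Qed.

Lemma measurable_acos_comp (G : R -> R) : continuous G ->
  measurable_fun dom11 (fun x => G (acos x)).
Proof.
move=> cG; apply: open_continuous_measurable_fun; first exact: interval_open.
move=> x; rewrite inE => dx; apply: (@continuous_comp _ _ _ acos G); last exact: cG.
by apply: continuous_acos; apply/dom11E.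
Qed.

Lemma acos_subst_Rle (G : R -> R) : continuous G -> (forall t, 0 <= G t) ->
  (exists B, forall t, G t <= B) ->
  \int[mu]_(x in dom11) (G (acos x) / weight x) <= \int[mu]_(t in `[0, pi]) G t.
Proof.
move=> cG G0 [B GB].
have iG : mu.-integrable `[0, pi] (EFin \o G) by exact: continuous_integrable_itv.
have iGw : mu.-integrable dom11 (EFin \o (fun x => G (acos x) / weight x)).
  under [X in _ \o X]funext => x do rewrite mulrC.
  apply: (@integrable_mul_bounded _ _ _ _ B); first exact: measurable_dom11.
  - exact: measurable_acos_comp.
  - by move=> x _; rewrite ger0_norm.
  - exact: inv_weight_integrable.
rewrite -lee_fin /Rintegral !fineK ?integrable_fin_num//; last exact: measurable_dom11.
exact: acos_subst_le.
Qed.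

End kernel.

(** * Moments of the truncated conjugate Poisson mean *)

Section truncated_conjugate.
Context {R : realType}.
Local Notation mu := (@lebesgue_measure R).
Variables (f : R -> R) (m N : nat) (r : R).
Hypotheses (m0 : (0 < m)%N) (r01 : 0 < r < 1) (rN : 2 * r ^+ N.+1 <= 1 - r).
Hypothesis if1 : mu.-integrable dom11 (EFin \o (fun x => f x / weight x)).
Hypothesis ifm : mu.-integrable dom11 (EFin \o (fun x => f x ^+ (2 * m) / weight x)).

(** Chebyshev coefficients without normalization: [cos (i acos x)] is the Chebyshev polynomial [T_i]
    at [x]. *)
Definition cheb_coef (g : R -> R) (i : nat) : R :=
  \int[mu]_(x in dom11) (g x / weight x * cos (i%:R * acos x)).

Definition conj_kernel (th ph : R) : R :=
  2 * \sum_(i < N.+1) r ^+ i * sin (i%:R * th) * cos (i%:R * ph).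

Definition conj_poisson (th : R) : R :=
  pi^-1 * \int[mu]_(x in dom11) (f x / weight x * conj_kernel th (acos x)).

Lemma cheb_coef0 (g : R -> R) : cheb_coef g 0 = \int[mu]_(x in dom11) (g x / weight x).
Proof. by apply: eq_Rintegral => x _; rewrite mul0r cos0 mulr1. Qed.

Lemma integrable_cheb (g : R -> R) (c : R) i :
  mu.-integrable dom11 (EFin \o (fun x => g x / weight x)) ->
  mu.-integrable dom11 (EFin \o (fun x => g x / weight x * (c * cos (i%:R * acos x)))).
Proof.
move=> ig; apply: (@integrable_mul_bounded _ _ _ _ `|c|) => //.
- exact: measurable_dom11.
- apply: (@measurable_acos_comp R (fun t => c * cos (i%:R * t))).
  by move=> t; apply: cvgM; [exact: cvg_cst|exact: continuous_cosM].
- by move=> x _; rewrite normrM ler_piMr// cos_max.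
Qed.

Lemma Rintegral_cheb_sum (g : R -> R) (c : nat -> R) :
  mu.-integrable dom11 (EFin \o (fun x => g x / weight x)) ->
  \int[mu]_(x in dom11) (g x / weight x * (2 * \sum_(i < N.+1) c i * cos (i%:R * acos x))) =
  \sum_(i < N.+1) 2 * c i * cheb_coef g i.
Proof.
move=> ig.
have E x : g x / weight x * (2 * \sum_(i < N.+1) c i * cos (i%:R * acos x)) =
    \sum_(i < N.+1) g x / weight x * ((2 * c i) * cos (i%:R * acos x)).
  by rewrite !mulr_sumr; apply: eq_bigr => i _; ring.
under eq_Rintegral do rewrite E.
rewrite (@Rintegral_sum_ord _ (fun i x => g x / weight x * ((2 * c i) * cos (i%:R * acos x))))//; last 2 first.
- exact: measurable_dom11.
- by move=> i; exact: integrable_cheb.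
apply: eq_bigr => i _; rewrite /cheb_coef -RintegralZl//; last 2 first.
- exact: measurable_dom11.
- by have := integrable_cheb 1 i ig; under eq_fun do rewrite /= mul1r.
by apply: eq_Rintegral => x _; ring.
Qed.

(** The constant coefficient is twice the mean of [f]. Being real, it does not touch the imaginary
    part, and it makes [even_kernel] the kernel of the real part. *)
Let P : {poly R} := \poly_(i < N.+1) (2 * r ^+ i * (pi^-1 * cheb_coef f i)).

Let PE t : cpoly P t =
  Complex (pi^-1 * \int[mu]_(x in dom11) (f x / weight x * even_kernel r N t (acos x)))
          (conj_poisson t).
Proof.
rewrite (@cpoly_wide _ _ _ N.+1) ?size_poly//; congr Complex.
- rewrite (@Rintegral_cheb_sum f (fun i => r ^+ i * cos (i%:R * t)))// mulr_sumr.
  by apply: eq_bigr => i _; rewrite coef_poly ltn_ord; ring.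
- rewrite /conj_poisson (@Rintegral_cheb_sum f (fun i => r ^+ i * sin (i%:R * t)))// mulr_sumr.
  by apply: eq_bigr => i _; rewrite coef_poly ltn_ord; ring.
Qed.

Lemma continuous_conj_poisson : continuous conj_poisson.
Proof.
have -> : conj_poisson = (fun t => complex.Im (cpoly P t)) by apply/funext => t; rewrite PE.
exact: continuous_Im_cpoly.
Qed.

Let b0 : R := \int[mu]_(x in dom11) (f x ^+ (2 * m) / weight x).

(** Jensen's inequality with total mass [2 pi]; the constant is [pi^(-2m) (2 pi)^(2m-1)]. *)
Let jensen_kernel (G : R -> R) (B : R) : continuous G -> (forall t, 0 <= G t) ->
  (forall t, G t <= B) -> \int[mu]_(t in `[0, pi]) G t <= 2 * pi ->
  (pi^-1 * \int[mu]_(x in dom11) (f x / weight x * G (acos x))) ^+ (2 * m) <=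
  2 ^+ (2 * m) / (2 * pi) *
    \int[mu]_(x in dom11) (f x ^+ (2 * m) / weight x * G (acos x)).
Proof.
move=> cG G0 GB' iG.
have pi0 : 0 < pi :> R by exact: pi_gt0.
have mG := measurable_acos_comp cG.
have bG (g : R -> R) : mu.-integrable dom11 (EFin \o (fun x => g x / weight x)) ->
    mu.-integrable dom11 (EFin \o (fun x => g x * (G (acos x) / weight x))).
  move=> ig; under [X in _ \o X]funext => x do rewrite mulrCA mulrC.
  apply: (@integrable_mul_bounded _ _ _ _ B) => //; first exact: measurable_dom11.
  by move=> x _; rewrite ger0_norm.
have E (g : R -> R) : \int[mu]_(x in dom11) (g x / weight x * G (acos x)) =
    \int[mu]_(x in dom11) (g x * (G (acos x) / weight x)).
  by apply: eq_Rintegral => x _; rewrite mulrAC mulrA.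
rewrite !E exprMn.
have i1 : mu.-integrable dom11 (EFin \o (fun x => G (acos x) / weight x)).
  under [X in _ \o X]funext => x do rewrite mulrC.
  apply: (@integrable_mul_bounded _ _ _ _ B) => //; first exact: measurable_dom11.
  - by move=> x _; rewrite ger0_norm.
  - exact: inv_weight_integrable.
have rho0 x : dom11 x -> 0 <= G (acos x) / weight x.
  by move=> _; rewrite divr_ge0// weight_ge0.
have mass : \int[mu]_(x in dom11) (G (acos x) / weight x) <= 2 * pi.
  by apply: le_trans iG; apply: acos_subst_Rle => //; exists B.
have twopi0 : 0 < 2 * pi :> R by rewrite mulr_gt0.
have := jensen_expr m0 twopi0 measurable_dom11 rho0 i1 (bG _ if1) (bG _ ifm) mass.
have p0 : 0 <= (pi^-1 : R) ^+ (2 * m) by rewrite exprn_ge0// invr_ge0 ltW.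
move=> /(ler_wpM2l p0)/le_trans; apply.
rewrite mulrA ler_wpM2r//.
  apply: Rintegral_ge0 => x dx; rewrite mulr_ge0 ?rho0//.
  by rewrite exprM exprn_ge0 ?sqr_ge0.
have e : (2 * pi) ^+ (2 * m) = (2 * pi : R) * (2 * pi) ^+ (2 * m).-1.
  by rewrite -exprS prednK// muln_gt0.
rewrite ler_pdivlMr// -mulrA [_ * (2 * pi)]mulrC -e exprMn mulrCA -exprMn.
by rewrite mulVf ?gt_eqF// expr1n mulr1.
Qed.

Lemma conj_poisson_bound :
  \int[mu]_(t in `[0, pi]) conj_poisson t ^+ (2 * m) <= (35 * m%:R) ^+ (2 * m) * b0.
Proof.
have [/ltW r0 /ltW r1] := andP r01.
have pi0 : 0 < pi :> R by exact: pi_gt0.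
have b00 : 0 <= b0.
  apply: Rintegral_ge0 => x _; rewrite divr_ge0 ?weight_ge0//.
  by rewrite exprM exprn_ge0 ?sqr_ge0.
have -> : \int[mu]_(t in `[0, pi]) conj_poisson t ^+ (2 * m) =
    \int[mu]_(t in `[0, pi]) complex.Im (cpoly P t) ^+ (2 * m).
  by apply: eq_Rintegral => t _; rewrite PE.
apply: le_trans (riesz_cpoly P m0) _.
(* [field] would unfold [pi]. *)
have fe1 (p q b : R) : p != 0 -> p * (q / (2 * p) * (b * 2)) = q * b.
  by move=> ?; field.
have fe2 (p q b : R) : p != 0 -> q / (2 * p) * (2 * p * b) = q * b.
  by move=> ?; field.
have P0 : pi * P`_0 ^+ (2 * m) <= 2 ^+ (2 * m) * b0.
  rewrite coef_poly/= expr0 mulr1 mulrCA cheb_coef0.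
  have c2 : continuous (fun _ : R => 2 : R) by move=> x; exact: cvg_cst.
  (* The constant kernel 2 is [even_kernel] at [r = 0], [N = 0], so its mass is already known. *)
  have mass2 : \int[mu]_(t in `[0, pi]) (2 : R) <= 2 * pi.
    by have := Rintegral_even_kernel 0 0 (0 : R); rewrite /even_kernel;
      under eq_Rintegral do
        rewrite big_ord_recl big_ord0 /= expr0 !mul0r cos0 !mul1r addr0 mulr1; move=> ->.
  have := jensen_kernel c2 (fun=> ler0n _ 2) (fun=> lexx _) mass2.
  rewrite !RintegralZr//; try exact: measurable_dom11.
  rewrite -/b0 => h; have {h} := ler_wpM2l (ltW pi0) h.
  rewrite [_ * 2]mulrC => /le_trans; apply.
  by rewrite fe1 ?gt_eqF.
have Re0 : \int[mu]_(t in `[0, pi]) complex.Re (cpoly P t) ^+ (2 * m) <= 2 ^+ (2 * m) * b0.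
  pose B i := cheb_coef (fun x => f x ^+ (2 * m)) i.
  (* [g t] is the integral of [f^(2m) / w] against [even_kernel], written as a cosine sum in [t];
     integrating it term by term replaces Fubini's theorem. *)
  pose g t : R := \sum_(i < N.+1) 2 * r ^+ i * B i * cos (i%:R * t).
  have cg0 i : continuous (fun t : R => 2 * r ^+ i * B i * cos (i%:R * t)).
    by move=> t; apply: cvgM; [exact: cvg_cst|exact: continuous_cosM].
  have cg : continuous g.
    exact: (@continuous_sum_ord _ (fun i t => 2 * r ^+ i * B i * cos (i%:R * t))).
  have ig : \int[mu]_(t in `[0, pi]) g t = 2 * pi * b0.
    rewrite (@Rintegral_sum_ord _ (fun i t => 2 * r ^+ i * B i * cos (i%:R * t)))//; last first.
      by move=> i; exact: continuous_integrable_itv.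
    rewrite big_ord_recl /= big1 ?addr0.
      rewrite RintegralZl//; last exact/continuous_integrable_itv/continuous_cosM.
      by rewrite (Rintegral_cos 0) /= expr0 /B cheb_coef0 -/b0; ring.
    move=> i _; rewrite RintegralZl//; last exact/continuous_integrable_itv/continuous_cosM.
    by rewrite Rintegral_cos mulr0.
  apply: le_trans.
    apply: (@le_Rintegral _ _ _ mu _ _ (fun t => 2 ^+ (2 * m) / (2 * pi) * g t)) => //.
    - by apply: continuous_integrable_itv; apply: continuousX_fun; exact: continuous_Re_cpoly.
    - exact/integrable_realZl/continuous_integrable_itv.
    - move=> t _; rewrite PE /=.
      have kB ph : even_kernel r N t ph <= 2 * N.+1%:R.
        rewrite /even_kernel ler_wpM2l//.
        apply: (@le_trans _ _ (\sum_(i < N.+1) 1)); last by rewrite sumr_const card_ord.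
        apply: ler_sum => i _; apply: le_trans (ler_norm _) _.
        rewrite !normrM; have := cos_max (i%:R * t); have := cos_max (i%:R * ph).
        have : `|r ^+ i| <= 1 by rewrite normrX exprn_ile1// ger0_norm.
        move=> a1 b1 c1.
        by rewrite !mulr_ile1 ?mulr_ge0.
      have := jensen_kernel (@continuous_even_kernel R r N t)
        (fun ph => even_kernel_ge0 t ph r01 rN) kB.
      rewrite Rintegral_even_kernel => /(_ (lexx _)) /le_trans; apply.
      rewrite ler_wpM2l//; first by rewrite divr_ge0 ?exprn_ge0// mulr_ge0// ltW.
      rewrite (@Rintegral_cheb_sum (fun x => f x ^+ (2 * m)) (fun i => r ^+ i * cos (i%:R * t)))//.
      rewrite /g le_eqVlt; apply/orP; left; apply/eqP.
      by apply: eq_bigr => i _; rewrite -/(B i); ring.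
  rewrite RintegralZl//; last exact: continuous_integrable_itv.
  by rewrite ig fe2 ?gt_eqF.
have m1 : 1 <= m%:R :> R by rewrite ler1n.
have q0 : 0 <= 3 * (7 * m%:R) ^+ (2 * m) :> R by rewrite mulr_ge0// exprn_ge0// mulr_ge0.
apply: (le_trans (lerD (ler_wpM2l (ler0n _ 2) P0) (ler_wpM2l q0 Re0))).
have e1 : 2 ^+ (2 * m) <= (14 * m%:R : R) ^+ (2 * m).
  by rewrite lerXn2r ?nnegrE ?mulr_ge0//; lra.
have e2 : (7 * m%:R) ^+ (2 * m) * 2 ^+ (2 * m) = (14 * m%:R : R) ^+ (2 * m).
  by rewrite -exprMn; congr (_ ^+ _); ring.
(* The two terms contribute 2 and 3 copies of [(14 m)^(2m)]; the factor [5 <= (5/2)^2] is absorbed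
   by enlarging 14 to 35. *)
have e3 : 5 * (14 * m%:R) ^+ (2 * m) <= (35 * m%:R : R) ^+ (2 * m).
  have -> : 35 * m%:R = (5 / 2) * (14 * m%:R) :> R by field.
  rewrite [leRHS]exprMn ler_wpM2r ?exprn_ge0 ?mulr_ge0// exprM.
  have h : 5 <= (5 / 2) ^+ 2 :> R by lra.
  apply: le_trans h _; rewrite -[leLHS]expr1 ler_weXn2l//; lra.
have -> : 2 * (2 ^+ (2 * m) * b0) + 3 * (7 * m%:R) ^+ (2 * m) * (2 ^+ (2 * m) * b0) =
  (2 * 2 ^+ (2 * m) + 3 * ((7 * m%:R) ^+ (2 * m) * 2 ^+ (2 * m))) * b0 by ring.
by rewrite ler_wpM2r// e2; lra.
Qed.

End truncated_conjugate.

(** * Abelian limit of the conjugate Poisson means *)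

Section principal_value.
Context {R : realType}.
Local Notation mu := (@lebesgue_measure R).
Implicit Types (h : R -> R) (t e a x y z s L : R).

Lemma measurable_inv : measurable_fun setT (@GRing.inv R).
Proof.
have -> : [set: R] = [set 0] `|` ~` [set 0] by rewrite setUv.
apply/measurable_funU; first exact: measurable_set1.
  by apply: measurableC; exact: measurable_set1.
split; first exact: measurable_fun_set1.
apply: open_continuous_measurable_fun; first exact/closed_openC/accessible_closed_set1/hausdorff_accessible/Rhausdorff.
by move=> y /set_mem /= /eqP y0; exact: inv_continuous.
Qed.

(** With the cutoff in the integrand, the domain of integration no longer depends on [t] and [e]. *)
Definition cutoff_inv e y : R := if e < `|y| then y^-1 else 0.

Definition pv_trunc h t e : R := \int[mu]_(x in dom11) (h x * cutoff_inv e (x - t)).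

Definition pv_is h t L : Prop :=
  forall eta, 0 < eta -> exists2 e0, 0 < e0 &
    forall e, 0 < e < e0 -> `|pv_trunc h t e - L| <= eta.

Lemma measurable_cutoff_inv e (D : set R) : measurable_fun D (cutoff_inv e).
Proof.
apply: measurable_funTS; rewrite /cutoff_inv.
apply: measurable_fun_ifT => //.
- by apply: measurable_fun_ltr => //; exact: measurable_normr.
- exact: measurable_inv.
Qed.

Lemma cutoff_inv_le e y : 0 < e -> `|cutoff_inv e y| <= e^-1.
Proof.
move=> e0; rewrite /cutoff_inv; case: ifPn => [ey|_]; last by rewrite normr0 invr_ge0 ltW.
by rewrite normfV lef_pV2 ?posrE ?(ltW ey)// (lt_trans e0).
Qed.

Lemma integrable_cutoff h t e : 0 < e -> mu.-integrable dom11 (EFin \o h) ->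
  mu.-integrable dom11 (EFin \o (fun x => h x * cutoff_inv e (x - t))).
Proof.
move=> e0 ih; apply: (@integrable_mul_bounded _ _ _ _ e^-1) => //.
- exact: measurable_dom11.
- apply: (@measurableT_comp _ _ _ _ _ _ (cutoff_inv e) _ (fun x => x - t)).
    exact: measurable_cutoff_inv.
  exact: measurable_funB.
- by move=> x _; exact: cutoff_inv_le.
Qed.

(** Counts the sample points below [z]. The middle clause of the strengthened claim serves the step
    at which all earlier points are counted. *)
Lemma count_lt z n :
  0 <= z <= n.+1%:R -> z - 1 <= \sum_(i < n) (i.+1%:R < z)%R%:R <= z.
Proof.
suff H : 0 <= z -> [/\ \sum_(i < n) (i.+1%:R < z)%R%:R <= z,
    (n%:R < z -> \sum_(i < n) (i.+1%:R < z)%R%:R = n%:R :> R) &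
    (z <= n.+1%:R -> z - 1 <= \sum_(i < n) (i.+1%:R < z)%R%:R)].
  by move=> /andP[z0 zn]; have [-> _ ->] := H z0.
move=> z0; elim: n => [|n [A B C]].
  by rewrite big_ord0; split => //; lra.
rewrite big_ord_recr /=.
have [nz|zn] := ltP n.+1%:R z.
  have nz' : n%:R < z by apply: lt_trans nz; rewrite ltr_nat.
  have e1 : \sum_(i < n) (i.+1%:R < z)%R%:R + 1%:R = n.+1%:R :> R by rewrite B// natr1.
  rewrite e1; split => //; first exact: ltW.
  by rewrite -[n.+2%:R]natr1; lra.
by rewrite addr0; split => // _; exact: C.
Qed.

(** The value of [|y|] at which [y^2 / (y^2 + a)] equals [s]. *)
Definition level_radius a s : R := Num.sqrt (a * s / (1 - s)).

Lemma level_radius_lt a s y : 0 < a -> 0 < s < 1 ->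
  (level_radius a s < `|y|) = (s < y ^+ 2 / (y ^+ 2 + a)).
Proof.
move=> a0 s01; have y2 := sqr_ge0 y.
have h1 : 0 < 1 - s by lra.
have h2 : 0 < y ^+ 2 + a by lra.
rewrite ltr_pdivlMr// /level_radius -sqrtr_sqr.
have as0 : 0 <= a * s / (1 - s) by rewrite divr_ge0 ?mulr_ge0//; lra.
rewrite [LHS](_ : _ = (a * s / (1 - s) < y ^+ 2)).
  rewrite ltr_pdivrMr//; apply/idP/idP; lra.
have [yy|yy] := eqVneq y 0; last by rewrite ltr_sqrt// lt_neqAle eq_sym sqrf_eq0 yy.
rewrite yy expr0n/= sqrtr0.
by rewrite !ltNge sqrtr_ge0 as0.
Qed.

Lemma level_radius_gt0 a s : 0 < a -> 0 < s < 1 -> 0 < level_radius a s.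
Proof. by move=> a0 s01; rewrite sqrtr_gt0 divr_gt0 ?mulr_gt0//; lra. Qed.

(** The sample points avoid 0 and 1, where [level_radius] would be 0 and no longer a truncation
    radius. *)
Lemma level_bounds (K i : nat) : (i < K)%N -> (0 : R) < i.+1%:R / K.+1%:R < (1 : R).
Proof.
by move=> iK; rewrite divr_gt0//= ltr_pdivrMr// mul1r ltr_nat.
Qed.

(* Riemann-sum version of the layer-cake formula
   [y/(y^2+a) = \int_0^1 cutoff_inv (level_radius a s) y ds]. *)
Lemma layer_cake_error (K : nat) a y rho : 0 < a -> 0 < rho ->
  K.+1%:R^-1 <= a * rho ^+ 2 ->
  `|y / (y ^+ 2 + a) -
    K.+1%:R^-1 * \sum_(i < K) cutoff_inv (level_radius a (i.+1%:R / K.+1%:R)) y| <= rho.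
Proof.
move=> a0 rho0 Ka; have y2 := sqr_ge0 y.
set phi := y ^+ 2 / (y ^+ 2 + a).
have d0 : 0 < y ^+ 2 + a by lra.
have phi0 : 0 <= phi by rewrite divr_ge0// ltW.
have phi1 : phi <= 1 by rewrite ler_pdivrMr//; lra.
have K0 : 0 < K.+1%:R :> R by [].
set c := \sum_(i < K) (i.+1%:R < K.+1%:R * phi)%R%:R : R.
have sumE : \sum_(i < K) cutoff_inv (level_radius a (i.+1%:R / K.+1%:R)) y = y^-1 * c.
  rewrite /c mulr_sumr; apply: eq_bigr => i _.
  rewrite /cutoff_inv level_radius_lt ?level_bounds// -/phi.
  by rewrite ltr_pdivrMr// [phi * _]mulrC; case: ifP => _; rewrite ?mulr1 ?mulr0.
have cb : K.+1%:R * phi - 1 <= c <= K.+1%:R * phi.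
  by apply: count_lt; rewrite mulr_ge0//= ler_piMr.
have -> : y / (y ^+ 2 + a) = y^-1 * phi.
  have [->|yn] := eqVneq y 0; first by rewrite invr0 !mul0r.
  by rewrite /phi; field; rewrite yn gt_eqF.
rewrite sumE [K.+1%:R^-1 * _]mulrCA -mulrBr.
set k := K.+1%:R^-1; set d := phi - k * c.
have kK z : k * (K.+1%:R * z) = z by rewrite mulrA mulVf ?mul1r ?gt_eqF.
have k0 : 0 < k by rewrite invr_gt0.
have d1 : 0 <= d <= k.
  have := ler_wpM2l (ltW k0) (andP cb).1; have := ler_wpM2l (ltW k0) (andP cb).2.
  rewrite mulrBr mulr1 !kK /d => h1 h2.
  by apply/andP; split; lra.
have c0 : 0 <= c by apply: sumr_ge0.
have d2 : d <= phi by rewrite /d; have := mulr_ge0 (ltW k0) c0; lra.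
rewrite -(@ler_pXn2r _ 2) ?nnegrE//; last exact: ltW.
rewrite -normrX ger0_norm ?sqr_ge0// exprMn.
have [yn|yn] := eqVneq y 0.
  by rewrite yn invr0 expr0n /= mul0r sqr_ge0.
(* The geometric mean of the bounds [d <= k] and [d <= phi]: the factor [phi] cancels the
   singularity of [1/y^2], which makes the error uniform in [y]. *)
have dd : d ^+ 2 <= k * phi by rewrite expr2 ler_pM; lra.
apply: (@le_trans _ _ (y^-1 ^+ 2 * (k * phi))).
  by rewrite ler_wpM2l ?sqr_ge0.
have -> : y^-1 ^+ 2 * (k * phi) = k / (y ^+ 2 + a).
  by rewrite /phi; field; rewrite yn gt_eqF.
rewrite ler_pdivrMr//; apply: le_trans Ka _.
rewrite mulrC ler_wpM2l ?sqr_ge0//; lra.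
Qed.

Lemma measurable_shift t (D : set R) : measurable_fun D (fun x : R => x - t).
Proof. by apply: measurable_funTS; exact: measurable_funB. Qed.

Lemma measurable_odd_poisson t a (D : set R) : 0 < a ->
  measurable_fun D (fun x : R => (x - t) / ((x - t) ^+ 2 + a)).
Proof.
move=> a0; apply: measurable_funTS; apply: continuous_measurable_fun => x.
have cs : {for x, continuous (fun x : R => x - t)}.
  by apply: cvgB; [exact: cvg_id|exact: cvg_cst].
apply: cvgM; first exact: cs.
apply: cvgV; first by rewrite gt_eqF// ltr_wpDl ?sqr_ge0.
apply: cvgD; last exact: cvg_cst.
by apply: (@continuous_comp _ _ _ (fun x => x - t) (fun x => x ^+ 2)) => //; exact: exprn_continuous.
Qed.

Lemma integrable_odd_poisson h t a : 0 < a -> mu.-integrable dom11 (EFin \o h) ->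
  mu.-integrable dom11 (EFin \o (fun x => h x * ((x - t) / ((x - t) ^+ 2 + a)))).
Proof.
move=> a0 ih; have mD := @measurable_dom11 R.
apply: (@integrable_mul_bounded _ _ _ _ (a^-1 + 1)) => //.
  exact: measurable_odd_poisson.
move=> x _; set y := x - t; have d0 : 0 < y ^+ 2 + a by rewrite ltr_wpDl ?sqr_ge0.
rewrite normrM normfV (gtr0_norm d0) ler_pdivrMr//.
have -> : (a^-1 + 1) * (y ^+ 2 + a) = `|y| ^+ 2 / a + `|y| ^+ 2 + 1 + a.
  by rewrite real_normK ?num_real//; field; exact: lt0r_neq0.
have : 0 <= `|y| ^+ 2 / a by rewrite divr_ge0 ?exprn_ge0// ltW.
by have := sqr_ge0 (`|y| - 1); have := sqr_ge0 `|y|; lra.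
Qed.

(** By [layer_cake_error] the integral is nearly a mean of truncated integrals over the radii
    [level_radius a s]. For small [a] all but a small fraction of these radii are below [e0]; at the
    others the distance to [L] is at most [B]. *)
Lemma abel_pv h t L : mu.-integrable dom11 (EFin \o h) -> pv_is h t L ->
  forall eta, 0 < eta -> exists2 a0, 0 < a0 & forall a, 0 < a < a0 ->
    `|\int[mu]_(x in dom11) (h x * ((x - t) / ((x - t) ^+ 2 + a))) - L| <= eta.
Proof.
move=> ih cvT eta eta0.
have mD := @measurable_dom11 R.
set H := \int[mu]_(x in dom11) `|h x|.
have H0 : 0 <= H by exact: Rintegral_ge0.
have [e0 e00 Te] := cvT (eta / 4) (divr_gt0 eta0 (ltr0n _ 4)).
pose B := H / e0 + `|L|.
have B0 : 0 <= B by rewrite addr_ge0// divr_ge0// ltW.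
have inh : mu.-integrable dom11 (EFin \o (fun x => `|h x|)) by exact: integrable_norm ih.
have TB e : e0 <= e -> `|pv_trunc h t e - L| <= B.
  move=> e0e; have e_gt0 : 0 < e by exact: lt_le_trans e0e.
  apply: le_trans (ler_normB _ _) _; rewrite lerD2r /pv_trunc.
  rewrite -RintegralZr//; apply: normr_Rintegral_le => //.
  - exact: integrable_cutoff.
  - by under [X in _ \o X]funext => x do rewrite mulrC; exact: integrable_realZl.
  - move=> x _; rewrite normrM ler_wpM2l//.
    by apply: le_trans (cutoff_inv_le _ e_gt0) _; rewrite lef_pV2 ?posrE.
(* Chosen to give [B (1 - s0) <= eta / 4], where [1 - s0 = a / (e0^2 + a)] is the fraction of radii
   not below [e0]. *)
exists (e0 ^+ 2 * eta / (4 * (B + 1))).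
  by rewrite divr_gt0 ?mulr_gt0 ?exprn_gt0//; lra.
move=> a /andP[a0 aB].
pose rho := eta / (4 * (H + 1)).
have rho0 : 0 < rho by rewrite divr_gt0// mulr_gt0//; lra.
(* The first bound controls the Riemann sum. The second pays for [k L]: [K] terms of weight
   [k = 1 / (K + 1)] miss the total weight 1 by [k]. *)
have [K KK] : exists K : nat, K.+1%:R^-1 < Num.min (a * rho ^+ 2) (eta / (4 * (`|L| + 1))).
  have : 0 < Num.min (a * rho ^+ 2) (eta / (4 * (`|L| + 1))).
    rewrite lt_min; apply/andP; split; first by rewrite mulr_gt0 ?exprn_gt0.
    by rewrite divr_gt0 ?mulr_gt0 ?ltr_wpDl.
  by move=> /ltr_add_invr[K]; rewrite add0r; exists K.
move: KK; rewrite lt_min => /andP[/ltW K1 /ltW K2].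
set k := K.+1%:R^-1 in K1 K2.
have k0 : 0 < k by rewrite invr_gt0.
pose e i := level_radius a (i.+1%:R / K.+1%:R).
have e_gt0 (i : 'I_K) : 0 < e i by apply: level_radius_gt0 => //; exact: level_bounds.
pose avg x := k * \sum_(i < K) cutoff_inv (e i) (x - t).
have iavg : mu.-integrable dom11 (EFin \o (fun x => h x * avg x)).
  have -> : (EFin \o (fun x => h x * avg x)) =
      (EFin \o (fun x => k * \sum_(i < K) (h x * cutoff_inv (e i) (x - t)))).
    by apply/funext => x /=; rewrite /avg -mulr_sumr mulrCA.
  apply: integrable_realZl => //.
  by apply: integrable_real_sum => // i; exact: integrable_cutoff.
have avgE : \int[mu]_(x in dom11) (h x * avg x) = k * \sum_(i < K) pv_trunc h t (e i).
  under eq_Rintegral do rewrite /avg mulrCA mulr_sumr.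
  rewrite RintegralZl//.
    by rewrite Rintegral_sum// => i; exact: integrable_cutoff.
  by apply: integrable_real_sum => // i; exact: integrable_cutoff.
have ipo := integrable_odd_poisson t a0 ih.
have err : `|\int[mu]_(x in dom11) (h x * ((x - t) / ((x - t) ^+ 2 + a))) -
            k * \sum_(i < K) pv_trunc h t (e i)| <= eta / 4.
  rewrite -avgE -RintegralB//.
  apply: (@le_trans _ _ (\int[mu]_(x in dom11) (rho * `|h x|))).
    apply: normr_Rintegral_le => //.
    - exact: integrable_realB.
    - exact: integrable_realZl.
    - move=> x _; rewrite -mulrBr normrM mulrC ler_wpM2r//.
      exact: layer_cake_error.
  rewrite RintegralZl// -/H /rho.
  rewrite [leLHS](_ : _ = eta / 4 * (H / (H + 1))); last by field; lra.
  by rewrite ler_piMr ?divr_ge0 ?ltW// ltr_pdivrMr; lra.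
pose s0 := e0 ^+ 2 / (e0 ^+ 2 + a).
have e2 : 0 < e0 ^+ 2 by rewrite exprn_gt0.
have s01 : 0 <= s0 <= 1.
  by rewrite divr_ge0//= ?ler_pdivrMr//; lra.
have Tb (i : 'I_K) : `|pv_trunc h t (e i) - L| <=
    eta / 4 + B * (1 - (i.+1%:R < K.+1%:R * s0)%R%:R).
  have -> : (i.+1%:R < K.+1%:R * s0)%R = (e i < e0).
    rewrite -[in RHS](gtr0_norm e00) level_radius_lt ?level_bounds//.
    by rewrite ltr_pdivrMr// [s0 * _]mulrC.
  case: ltP => h0; first by rewrite subrr mulr0 addr0 Te// e_gt0.
  by rewrite subr0 mulr1; apply: le_trans (TB _ h0) _; rewrite lerDr; lra.
have sumT : \sum_(i < K) `|pv_trunc h t (e i) - L| <= K%:R * (eta / 4) + B * (K.+1%:R * (1 - s0)).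
  apply: le_trans (ler_sum _ (fun i _ => Tb i)) _.
  rewrite big_split /= sumr_const card_ord -[_ *+ K]mulr_natl lerD2l.
  rewrite -mulr_sumr ler_wpM2l// sumrB sumr_const card_ord.
  have /andP[+ _] : K.+1%:R * s0 - 1 <= \sum_(i < K) (i.+1%:R < K.+1%:R * s0)%R%:R <= K.+1%:R * s0.
    by apply: count_lt; rewrite mulr_ge0 ?ler_piMr//; lra.
  rewrite mulrBr mulr1 -[K.+1%:R]natr1; lra.
have kK z : k * (K.+1%:R * z) = z by rewrite mulrA mulVf ?mul1r ?gt_eqF.
have main : `|k * \sum_(i < K) pv_trunc h t (e i) - L| <= 3 * (eta / 4).
  have -> : k * \sum_(i < K) pv_trunc h t (e i) - L =
      k * (\sum_(i < K) (pv_trunc h t (e i) - L)) - k * L.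
    rewrite sumrB sumr_const card_ord -[L *+ K]mulr_natl mulrBr.
    by have := kK L; rewrite -natr1 mulrDl mul1r mulrDr; lra.
  apply: le_trans (ler_normB _ _) _; rewrite !normrM (gtr0_norm k0).
  have kL : k * `|L| <= eta / 4.
    have L0 : 0 < `|L| + 1 by rewrite ltr_wpDl.
    move: K2; rewrite ler_pdivlMr ?mulr_gt0// => K2.
    have := ltW k0; nra.
  have Bs : B * (1 - s0) <= eta / 4.
    have -> : 1 - s0 = a / (e0 ^+ 2 + a) by rewrite /s0; field; lra.
    rewrite mulrA ler_pdivrMr; last lra.
    move: aB; rewrite ltr_pdivlMr ?mulr_gt0//; last lra.
    move: (e0 ^+ 2) e2 => E E0 aB; have := mulr_ge0 (ltW a0) (ltW eta0); nra.
  have kS : k * `|\sum_(i < K) (pv_trunc h t (e i) - L)| <= eta / 4 + eta / 4.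
    apply: (@le_trans _ _ (k * (K%:R * (eta / 4) + B * (K.+1%:R * (1 - s0))))).
      by rewrite ler_pM2l//; apply: le_trans sumT; exact: ler_norm_sum.
    rewrite mulrDr; apply: lerD; last by rewrite mulrCA kK.
    rewrite -[leRHS]kK ler_pM2l// ler_wpM2r ?ler_nat//; lra.
  lra.
have -> : \int[mu]_(x in dom11) (h x * ((x - t) / ((x - t) ^+ 2 + a))) - L =
  (\int[mu]_(x in dom11) (h x * ((x - t) / ((x - t) ^+ 2 + a))) -
            k * \sum_(i < K) pv_trunc h t (e i)) + (k * \sum_(i < K) pv_trunc h t (e i) - L).
  by ring.
apply: le_trans (ler_normD _ _) _; lra.
Qed.

End principal_value.

Section real_dominated.
Context {R : realType}.
Local Notation mu := (@lebesgue_measure R).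

Lemma Rintegral_setD1 (D : set R) (g : R -> R) r : measurable D -> measurable_fun D g ->
  \int[mu]_(x in D) g x = \int[mu]_(x in D `\ r) g x.
Proof.
move=> mD mg; have mDr : measurable (D `\ r) by apply: measurableD => //; exact: measurable_set1.
rewrite /Rintegral integral_setD1//; apply/measurable_EFinP.
by apply: (measurable_funS mD) => // x [].
Qed.

Lemma Rdominated_cvg (D : set R) (g_ : nat -> R -> R) (g G : R -> R) :
  measurable D -> (forall n, measurable_fun D (g_ n)) ->
  (forall x, D x -> g_ n x @[n --> \oo] --> g x) ->
  mu.-integrable D (EFin \o G) ->
  (forall n x, D x -> `|g_ n x| <= G x) ->
  \int[mu]_(x in D) g_ n x @[n --> \oo] --> \int[mu]_(x in D) g x.
Proof.
move=> mD mg cg iG gG.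
have cg' x : D x -> (g_ n x)%:E @[n --> \oo] --> (g x)%:E.
  by move=> Dx; apply: cvg_EFin; [exact: nearW|exact: cg].
have mg' : measurable_fun D g by exact: (measurable_fun_cvg mg).
have ig : mu.-integrable D (EFin \o g).
  apply: (integrable_real_le mD mg' _ iG) => x Dx.
  have c : `|g_ n x| @[n --> \oo] --> `|g x| by apply: cvg_norm; exact: cg.
  rewrite -(cvg_lim _ c)//; apply: limr_le; first by apply/cvg_ex; eexists; exact: c.
  by apply: nearW => n; exact: gG.
have := @dominated_cvg _ _ _ mu D mD (fun n x => (g_ n x)%:E) (EFin \o g) (EFin \o G).
move=> /(_ (fun n => (measurable_EFinP _ _).2 (mg n)) cg' (fun _ _ => erefl) iG).
have gG' n x : D x -> (`|(g_ n x)%:E| <= (EFin \o G) x)%E.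
  by move=> Dx /=; rewrite lee_fin gG.
move=> /(_ gG') h.
by apply: fine_cvg; rewrite fineK ?integrable_fin_num.
Qed.

End real_dominated.

(** * The conjugate kernel in algebraic form and its limit *)

Section closed_form.
Context {R : realType}.
Local Notation mu := (@lebesgue_measure R).
Implicit Types (r t x y th ph a : R) (N n : nat).

Lemma sin_den_sum r th ph :
  sin (th - ph) * poisson_den r (th + ph) + sin (th + ph) * poisson_den r (th - ph) =
  2 * sin th * ((1 + r ^+ 2) * cos ph - 2 * r * cos th).
Proof.
rewrite /poisson_den sinB sinD cosB cosD; have := sin2cos2 ph.
set a := sin th; set b := cos th; set c := sin ph; set d := cos ph => cE.
have -> : 2 * a * ((1 + r ^+ 2) * d - 2 * r * b) =
   2 * a * ((1 + r ^+ 2) * d - 2 * r * b * (c ^+ 2 + d ^+ 2)) by rewrite cE; ring.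
by ring.
Qed.

(** The product of the two Poisson denominators at [th - ph] and [th + ph], in the variables
    [t = cos th] and [x = cos ph]. It tends to [4 (x - t)^2] as [r] tends to 1. *)
Definition joint_den r t x : R :=
  (1 - r ^+ 2) ^+ 2 + 4 * r ^+ 2 * (x - t) ^+ 2 - 4 * r * (1 - r) ^+ 2 * (t * x).

Lemma joint_denE r th ph :
  poisson_den r (th - ph) * poisson_den r (th + ph) = joint_den r (cos th) (cos ph).
Proof.
rewrite /poisson_den /joint_den cosB cosD.
have := sin2cos2 ph; have := sin2cos2 th.
set a := sin th; set b := cos th; set c := sin ph; set d := cos ph => aE cE.
have -> : (1 - 2 * r * (b * d + a * c) + r ^+ 2) * (1 - 2 * r * (b * d - a * c) + r ^+ 2) =
  (1 + r ^+ 2 - 2 * r * b * d) ^+ 2 - 4 * r ^+ 2 * a ^+ 2 * c ^+ 2 by ring.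
by rewrite aE cE; ring.
Qed.

Lemma conj_kernelE N r th ph :
  conj_kernel N r th ph = geo_sin r N (th - ph) + geo_sin r N (th + ph).
Proof.
rewrite /conj_kernel /geo_sin -big_split /= mulr_sumr; apply: eq_bigr => i _.
by rewrite mulrBr mulrDr sinB sinD; ring.
Qed.

Lemma geo_sin_approx r N ps : 0 < r < 1 ->
  `|geo_sin r N ps - r * sin ps / poisson_den r ps| <= 2 * r ^+ N.+1 / (1 - r) ^+ 2.
Proof.
move=> r01; have d0 := poisson_den_gt0 ps r01.
have e : 0 < (1 - r) ^+ 2 by rewrite exprn_gt0//; lra.
have q0 : 0 <= r ^+ N.+1 by rewrite exprn_ge0//; lra.
have -> : geo_sin r N ps - r * sin ps / poisson_den r ps =
    (- r ^+ N.+1 * sin (N.+1%:R * ps) + r ^+ N.+2 * sin (N%:R * ps)) / poisson_den r ps.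
  apply: (mulfI (lt0r_neq0 d0)); rewrite mulrBr geo_sinE.
  by field; exact: lt0r_neq0.
rewrite normrM normfV (gtr0_norm d0) ler_pM ?invr_ge0 ?(ltW d0)//; last first.
  by rewrite lef_pV2 ?posrE// poisson_den_ge//; lra.
apply: le_trans (ler_normD _ _) _; rewrite (normrM (- _)) (normrM (r ^+ N.+2)) normrN (ger0_norm q0).
have r2 : `|r ^+ N.+2| <= r ^+ N.+1.
  by rewrite exprS normrM (ger0_norm q0) ler_piMl// ger0_norm; lra.
have s1 := sin_max (N.+1%:R * ps); have s2 := sin_max (N%:R * ps).
have h1 := ler_piMr q0 s1.
have h2 : `|r ^+ N.+2| * `|sin (N%:R * ps)| <= r ^+ N.+1.
  by apply: le_trans r2; rewrite ler_piMr.
lra.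
Qed.

(** The limit of [conj_kernel] as [N] grows, divided by [weight t = sin th]. At [r = 1] it becomes
    [1 / (x - t)]. *)
Definition limit_kernel r t x : R :=
  2 * r * ((1 + r ^+ 2) * x - 2 * r * t) / joint_den r t x.

Lemma conj_kernel_approx N r t x : 0 < r < 1 -> dom11 t -> dom11 x ->
  `|conj_kernel N r (acos t) (acos x) - weight t * limit_kernel r t x| <=
  4 * r ^+ N.+1 / (1 - r) ^+ 2.
Proof.
move=> r01 /dom11E dt /dom11E dx.
have t1 : t \in `[-1, 1] by rewrite in_itv /=; apply/andP; split; lra.
have x1 : x \in `[-1, 1] by rewrite in_itv /=; apply/andP; split; lra.
have E : weight t * limit_kernel r t x =
  r * sin (acos t - acos x) / poisson_den r (acos t - acos x) +
  r * sin (acos t + acos x) / poisson_den r (acos t + acos x).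
  have -> : weight t = sin (acos t) by rewrite sin_acos//; move: t1; rewrite in_itv.
  rewrite /limit_kernel -{2 3}(acosK t1) -{1 2}(acosK x1) -joint_denE.
  have := sin_den_sum r (acos t) (acos x).
  have := poisson_den_gt0 (acos t + acos x) r01.
  have := poisson_den_gt0 (acos t - acos x) r01.
  set A := poisson_den _ _; set B := poisson_den _ _ => A0 B0 S.
  have -> : r * sin (acos t - acos x) / A + r * sin (acos t + acos x) / B =
    r * (sin (acos t - acos x) * B + sin (acos t + acos x) * A) / (A * B).
    by field; rewrite !lt0r_neq0.
  by rewrite S; field; rewrite !lt0r_neq0.
rewrite E conj_kernelE opprD addrACA.
apply: le_trans (ler_normD _ _) _.
have := geo_sin_approx N (acos t - acos x) r01.
have := geo_sin_approx N (acos t + acos x) r01.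
by rewrite [4 * _ / _](_ : _ = 2 * r ^+ N.+1 / (1 - r) ^+ 2 + 2 * r ^+ N.+1 / (1 - r) ^+ 2); [lra|ring].
Qed.

(** Chosen so that [4 r^2 pv_shift r t] is the value of [joint_den r t] on the diagonal [x = t]. *)
Definition pv_shift r t : R :=
  (1 - r) ^+ 2 * ((1 - r) ^+ 2 + 4 * r * (1 - t ^+ 2)) / (4 * r ^+ 2).

Lemma pv_shift_gt0 r t : 0 < r < 1 -> dom11 t -> 0 < pv_shift r t.
Proof.
move=> r01 /one_sub_sqr_gt0 t2; have r0 : 0 < r by lra.
have e0 : 0 < (1 - r) ^+ 2 by rewrite exprn_gt0//; lra.
have r40 : 0 < 4 * r * (1 - t ^+ 2) by rewrite mulr_gt0// mulr_gt0.
have rr0 : 0 < 4 * r ^+ 2 by rewrite mulr_gt0// exprn_gt0.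
by rewrite divr_gt0// mulr_gt0// addr_gt0.
Qed.

Definition odd_poisson a y : R := y / (y ^+ 2 + a).

(** With [y = x - t], [joint_den] is [4 r^2 (y^2 + a)] up to [4 r (1-r)^2 t y], and the numerator is
    a multiple of [y] up to a multiple of [(1-r)^2 t]. Hence the factor [(1-r)^2] in the difference;
    its cofactor is at most [2 + 4]. *)
Lemma limit_kernel_split r t x : 2^-1 <= r < 1 -> dom11 t -> dom11 x ->
  `|limit_kernel r t x - (1 + r ^+ 2) / (2 * r) * odd_poisson (pv_shift r t) (x - t)| <=
  6 * (1 - r) ^+ 2 / joint_den r t x.
Proof.
move=> r01 /dom11E dt /dom11E dx; set y := x - t; set a := pv_shift r t.
have e0 : 0 < (1 - r) ^+ 2 by rewrite exprn_gt0//; lra.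
have w0 : 0 < 1 - t ^+ 2 by nra.
have r0 : 0 < r by lra.
have a0 : 0 < a by apply: pv_shift_gt0; [lra|exact/dom11E].
have y0 := sqr_ge0 y.
have ya : 0 < y ^+ 2 + a by lra.
have tx : 0 < 1 - t * x by nra.
have dE : joint_den r t x = 4 * r ^+ 2 * (y ^+ 2 + a) - 4 * r * (1 - r) ^+ 2 * (t * y).
  by rewrite /joint_den /a /pv_shift /y; field; rewrite lt0r_neq0.
have d0 : 0 < joint_den r t x.
  have -> : joint_den r t x = 4 * r ^+ 2 * y ^+ 2 + (1 - r) ^+ 2 * ((1 - r) ^+ 2 + 4 * r * (1 - t * x)).
    by rewrite /joint_den /y; ring.
  rewrite ltr_wpDl//; first by rewrite mulr_ge0// mulr_ge0// sqr_ge0.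
  by rewrite mulr_gt0// addr_gt0// !mulr_gt0.
have -> : limit_kernel r t x - (1 + r ^+ 2) / (2 * r) * odd_poisson a y =
   (1 - r) ^+ 2 * t * (2 * r + 2 * (1 + r ^+ 2) * (y ^+ 2 / (y ^+ 2 + a))) / joint_den r t x.
  rewrite /limit_kernel /odd_poisson.
  have -> : (1 + r ^+ 2) * x - 2 * r * t = (1 + r ^+ 2) * y + (1 - r) ^+ 2 * t by rewrite /y; ring.
  apply: (mulIf (lt0r_neq0 d0)); rewrite mulrBl !divfK ?lt0r_neq0// [in LHS]dE.
  by field; rewrite !lt0r_neq0.
rewrite normrM normfV (gtr0_norm d0) ler_wpM2r ?invr_ge0 ?(ltW d0)//.
rewrite -mulrA normrM (gtr0_norm e0) [leRHS]mulrC ler_wpM2l ?(ltW e0)// normrM.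
have f0 : 0 <= y ^+ 2 / (y ^+ 2 + a) <= 1.
  by rewrite divr_ge0 ?(ltW ya)//= ler_pdivrMr//; lra.
move: f0; set F := y ^+ 2 / _ => F01.
have t1 : `|t| <= 1 by rewrite ler_norml; lra.
have r2 : r ^+ 2 <= 1 by rewrite exprn_ile1//; lra.
have G0 : 0 <= 2 * r + 2 * (1 + r ^+ 2) * F <= 6.
  have r20 := sqr_ge0 r; apply/andP; split; nra.
have /andP[G1 G2] := G0; rewrite (ger0_norm G1).
apply: (@le_trans _ _ (1 * 6)); last lra.
by rewrite ler_pM.
Qed.

Lemma measurable_limit_kernel r t (D : set R) : measurable_fun D (limit_kernel r t).
Proof.
apply: measurable_funTS; apply: measurable_funM.
  by apply: measurable_funM => //; apply: measurable_funB => //; exact: measurable_funM.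
apply: (measurableT_comp (@measurable_inv R)).
apply: measurable_funB; last by apply: measurable_funM => //; exact: measurable_funM.
apply: measurable_funD => //; apply: measurable_funM => //; apply: measurable_funX.
exact: measurable_shift.
Qed.

Lemma measurable_conj_kernel N r t : measurable_fun dom11 (fun x => conj_kernel N r (acos t) (acos x)).
Proof.
apply: measurable_acos_comp => ph; apply: cvgM; first exact: cvg_cst.
apply: (@continuous_sum_ord _ (fun i ph => r ^+ i * sin (i%:R * acos t) * cos (i%:R * ph))).
by move=> i s; apply: cvgM; [exact: cvg_cst|exact: continuous_cosM].
Qed.

(** The first bound makes the error in [limit_kernel_split] vanish in the limit for [x] different
    from [t]; the second cancels [(1-r)^2] and bounds it uniformly. Both are needed for dominated
    convergence. *)
Lemma joint_den_ge r t x : 0 < r < 1 -> dom11 t -> dom11 x ->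
  4 * r ^+ 2 * (x - t) ^+ 2 <= joint_den r t x /\
  4 * r * (1 - r) ^+ 2 * (1 - `|t|) <= joint_den r t x.
Proof.
move=> r01 /dom11E dt /dom11E dx.
have -> : joint_den r t x = 4 * r ^+ 2 * (x - t) ^+ 2 + (1 - r) ^+ 4 +
    4 * r * (1 - r) ^+ 2 * (1 - t * x) by rewrite /joint_den; ring.
have e4 : 0 <= (1 - r) ^+ 4 by rewrite exprn_ge0//; lra.
have e2 : 0 <= 4 * r * (1 - r) ^+ 2 by rewrite mulr_ge0 ?sqr_ge0//; lra.
have y2 : 0 <= 4 * r ^+ 2 * (x - t) ^+ 2 by rewrite mulr_ge0 ?sqr_ge0// mulr_ge0 ?sqr_ge0.
have tx : 1 - `|t| <= 1 - t * x.
  rewrite lerD2l lerN2; apply: le_trans (ler_norm _) _.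
  by rewrite normrM ler_piMr// ler_norml; lra.
have t1 : 0 <= 1 - `|t| by rewrite subr_ge0 ler_norml; lra.
have h1 := ler_wpM2l e2 tx; have h2 := mulr_ge0 e2 t1.
by split; lra.
Qed.

Lemma cvg_sqr (u : nat -> R) (l : R) :
  u n @[n --> \oo] --> l -> u n ^+ 2 @[n --> \oo] --> l ^+ 2.
Proof. by move=> ul; rewrite expr2; under eq_cvg do rewrite expr2; exact: cvgM. Qed.

Lemma cvg0_le (u v : nat -> R) : (forall n, `|u n| <= v n) ->
  v n @[n --> \oo] --> (0 : R) -> u n @[n --> \oo] --> (0 : R).
Proof.
move=> uv v0; apply: (@squeeze_cvgr _ _ _ _ (fun n => - v n) v) => //.
  by apply: nearW => n; rewrite -ler_norml.
by rewrite -[X in _ --> X]oppr0; exact: cvgN.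
Qed.

Definition radius n : R := 1 - n.+2%:R^-1.

Lemma radius_bounds n : 2^-1 <= radius n < 1.
Proof.
rewrite /radius; have h : n.+2%:R^-1 <= 2^-1 :> R by rewrite lef_pV2 ?posrE// ler_nat.
have : 0 < n.+2%:R^-1 :> R by rewrite invr_gt0.
move: h; set e := n.+2%:R^-1; lra.
Qed.

Lemma cvg_radius : radius n @[n --> \oo] --> (1 : R).
Proof.
rewrite -[X in _ --> X]subr0; apply: cvgB; first exact: cvg_cst.
by have := @cvg_harmonic R; rewrite -(cvg_shiftS (@harmonic R)).
Qed.

Lemma conj_poisson_cvg (f : R -> R) t L (N_ : nat -> nat) :
  dom11 t ->
  mu.-integrable dom11 (EFin \o (fun x => f x / weight x)) ->
  pv_is (fun x => f x / weight x) t L ->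
  (forall n, 4 * radius n ^+ (N_ n).+1 / (1 - radius n) ^+ 2 <= n.+1%:R^-1) ->
  conj_poisson f (N_ n) (radius n) (acos t) @[n --> \oo] --> pi^-1 * (weight t * L).
Proof.
move=> dt ih pvL NE; set h := fun x => f x / weight x in ih pvL.
have mD := @measurable_dom11 R.
have r01 n : 0 < radius n < 1 by have := radius_bounds n; lra.
have rc := cvg_radius.
pose a_ n := pv_shift (radius n) t.
have t2 : 0 < 1 - t ^+ 2 by exact: one_sub_sqr_gt0.
have a_gt0 n : 0 < a_ n.
  exact: pv_shift_gt0.
have e2 : (1 - radius n) ^+ 2 @[n --> \oo] --> (0 : R).
    rewrite -[X in _ --> X](expr0n _ 2) -[X in X ^+ 2](subrr 1).
    by apply: cvg_sqr; apply: cvgB => //; exact: cvg_cst.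
have a_cvg : a_ n @[n --> \oo] --> 0.
  have -> : 0 = 0 * (0 + 4 * 1 * (1 - t ^+ 2)) / (4 * 1 ^+ 2) :> R by rewrite !mul0r.
  apply: cvgM.
    apply: cvgM => //; apply: cvgD => //; apply: cvgM; last exact: cvg_cst.
    by apply: cvgM => //; exact: cvg_cst.
  apply: cvgV; first by rewrite expr1n mulr1.
  by apply: cvgM; [exact: cvg_cst|exact: cvg_sqr].
pose E_ n x := conj_kernel (N_ n) (radius n) (acos t) (acos x) - weight t * limit_kernel (radius n) t x.
pose c_ n := (1 + radius n ^+ 2) / (2 * radius n).
pose d_ n x := limit_kernel (radius n) t x - c_ n * odd_poisson (a_ n) (x - t).
have mE n : measurable_fun dom11 (E_ n).
  apply: measurable_funB; first exact: measurable_conj_kernel.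
  by apply: measurable_funM => //; exact: measurable_limit_kernel.
have md n : measurable_fun dom11 (d_ n).
  apply: measurable_funB; first exact: measurable_limit_kernel.
  by apply: measurable_funM => //; exact: measurable_odd_poisson.
have Eb n x : dom11 x -> `|E_ n x| <= n.+1%:R^-1.
  by move=> dx; apply: le_trans (conj_kernel_approx _ _ _ _) (NE n).
pose B := 3 / (1 - `|t|).
have t1 : 0 < 1 - `|t| by move: dt => /dom11E; rewrite subr_gt0 ltr_norml.
have db n x : dom11 x -> `|d_ n x| <= 6 * (1 - radius n) ^+ 2 / joint_den (radius n) t x.
  by move=> dx; apply: limit_kernel_split => //; exact: radius_bounds.
have dB n x : dom11 x -> `|d_ n x| <= B.
  move=> dx; apply: le_trans (db n x dx) _.
  have [_ h2] := joint_den_ge (r01 n) dt dx.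
  have r := radius_bounds n; have e0 : 0 < (1 - radius n) ^+ 2 by rewrite exprn_gt0//; lra.
  have h3 : 2 * (1 - radius n) ^+ 2 * (1 - `|t|) <= joint_den (radius n) t x.
    by apply: le_trans h2; rewrite ler_wpM2r ?(ltW t1)// ler_wpM2r ?(ltW e0)//; lra.
  have den0 : 0 < 2 * (1 - radius n) ^+ 2 * (1 - `|t|) by rewrite mulr_gt0// mulr_gt0.
  rewrite ler_pdivrMr ?(lt_le_trans den0)//.
  apply: le_trans (ler_wpM2l _ h3); last by rewrite divr_ge0// ltW.
  by rewrite /B le_eqVlt; apply/orP; left; apply/eqP; field; exact: lt0r_neq0.
have ihE n : mu.-integrable dom11 (EFin \o (fun x => h x * E_ n x)).
  exact: (integrable_mul_bounded mD (mE n) (Eb n)).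
have ihd n : mu.-integrable dom11 (EFin \o (fun x => h x * d_ n x)).
  exact: (integrable_mul_bounded mD (md n) (dB n)).
have iho n : mu.-integrable dom11 (EFin \o (fun x => h x * odd_poisson (a_ n) (x - t))).
  exact: integrable_odd_poisson.
(* Three pieces: the truncation error, uniformly small by the choice of [N_]; the remainder [d_],
   handled by dominated convergence; and the odd Poisson mean, whose limit is [abel_pv]. *)
have XE n : conj_poisson f (N_ n) (radius n) (acos t) = pi^-1 * (
    \int[mu]_(x in dom11) (h x * E_ n x) + weight t * (
    \int[mu]_(x in dom11) (h x * d_ n x) +
    c_ n * \int[mu]_(x in dom11) (h x * odd_poisson (a_ n) (x - t)))).
  rewrite /conj_poisson; congr (_ * _).
  rewrite -RintegralZl// -RintegralD//; last exact: integrable_realZl.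
  rewrite -RintegralZl//; last by apply: integrable_realD => //; exact: integrable_realZl.
  rewrite -RintegralD//; last first.
    by apply: integrable_realZl => //; apply: integrable_realD => //; exact: integrable_realZl.
  by apply: eq_Rintegral => x _; rewrite /E_ /d_ -/(h x); ring.
under eq_cvg do rewrite XE.
apply: cvgM; first exact: cvg_cst.
rewrite -[weight t * L]add0r; apply: cvgD.
  pose H := \int[mu]_(x in dom11) `|h x|.
  apply: (@cvg0_le _ (fun n => n.+1%:R^-1 * H)).
  - move=> n; rewrite -RintegralZl//; last exact: integrable_norm ih.
    apply: normr_Rintegral_le => //.
      by apply: integrable_realZl => //; exact: integrable_norm ih.
    by move=> x dx; rewrite normrM mulrC ler_wpM2r// Eb.
  - by rewrite -[X in _ --> X](mul0r H); apply: cvgM; [exact: cvg_harmonic|exact: cvg_cst].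
apply: cvgM; first exact: cvg_cst.
rewrite -[L]add0r; apply: cvgD.
  (* At [x = t] the remainder [d_ n] need not tend to 0, so that point is removed. *)
  have mDt : measurable (dom11 `\ t) by apply: measurableD => //; exact: measurable_set1.
  have sD : dom11 `\ t `<=` dom11 by move=> x [].
  have mhd n : measurable_fun dom11 (fun x => h x * d_ n x).
    by apply/measurable_EFinP; exact: measurable_int (ihd n).
  have -> : 0 = \int[mu]_(x in dom11 `\ t) (0 : R) by rewrite Rintegral_cst// mul0r.
  under eq_cvg do rewrite (Rintegral_setD1 t)//.
  apply: (@Rdominated_cvg _ _ _ _ (fun x => B * `|h x|)) => //.
  - by move=> n; exact: (measurable_funS mD sD).
  - move=> x [dx /= xt].
    rewrite -[X in _ --> X](mulr0 (h x)); apply: cvgM; first exact: cvg_cst.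
    have y2 : 0 < (x - t) ^+ 2 by rewrite lt_neqAle sqr_ge0 eq_sym sqrf_eq0 subr_eq0 andbT; exact/eqP.
    apply: (@cvg0_le _ (fun n => (1 - radius n) ^+ 2 * (6 / (x - t) ^+ 2))).
      move=> n; apply: le_trans (db n x dx) _.
      have [h1 _] := joint_den_ge (r01 n) dt dx.
      have r2 : 1 <= 4 * radius n ^+ 2 by have r := radius_bounds n; nra.
      have h3 : (x - t) ^+ 2 <= joint_den (radius n) t x.
        by apply: le_trans h1; rewrite ler_peMl// ltW.
      rewrite [_ * (6 / _)]mulrCA mulrA ler_wpM2l//; first by rewrite mulr_ge0// sqr_ge0.
      by rewrite lef_pV2// posrE// (lt_le_trans y2).
    rewrite -[X in _ --> X](mul0r (6 / (x - t) ^+ 2)); apply: cvgM; last exact: cvg_cst.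
    exact: e2.
  - apply: (@integrableS _ _ _ mu dom11) => //.
    by apply: integrable_realZl => //; exact: integrable_norm ih.
  - by move=> n x [dx _]; rewrite normrM mulrC ler_wpM2r// dB.
rewrite -[L]mul1r; apply: cvgM.
  have -> : 1 = (1 + 1 ^+ 2) / (2 * 1) :> R by rewrite expr1n mulr1; field.
  apply: cvgM.
    by apply: cvgD; [exact: cvg_cst|exact: cvg_sqr].
  by apply: cvgV; [rewrite mulr1|apply: cvgM => //; exact: cvg_cst].
apply/cvgrPdist_le => eta eta0.
have [a0 a00 Ha] := abel_pv ih pvL eta0.
have : \forall n \near \oo, a_ n < a0.
  move/cvgrPdist_lt : a_cvg => /(_ _ a00); apply: filterS => n.
  by rewrite sub0r normrN gtr0_norm.
apply: filterS => n an; rewrite distrC; apply: Ha.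
by rewrite a_gt0.
Qed.

End closed_form.

(** * Moments of [checkT f] *)

Section pv_measurability.
Context {R : realType}.
Local Notation mu := (@lebesgue_measure R).
Implicit Types (h : R -> R) (t e x y L : R) (n m : nat).

Lemma pv_isP h t L : pv_is h t L <-> pv_trunc h t e @[e --> 0^'+] --> L.
Proof.
split=> [H|/cvgrPdist_le H].
  apply/cvgrPdist_le => eta eta0; have [e0 e00 He] := H _ eta0.
  near=> e; rewrite distrC He//; apply/andP; split.
    by near: e; exact: nbhs_right_gt.
  by near: e; exact: nbhs_right_lt.
move=> eta eta0; have [e0 /= e00 He] := H _ eta0.
exists e0 => // e /andP[ep ee0]; rewrite distrC; apply: He => //=.
by rewrite sub0r normrN gtr0_norm.
Unshelve. all: by end_near.
Qed.

Lemma cvg_cutoff_inv e y (u : nat -> R) : 0 < e -> `|y| != e ->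
  u n @[n --> \oo] --> y -> cutoff_inv e (u n) @[n --> \oo] --> cutoff_inv e y.
Proof.
move=> e0 ye uy; have cu : `|u n| @[n --> \oo] --> `|y| by exact: cvg_norm.
rewrite {2}/cutoff_inv; case: ifPn => [ey|].
  have y0 : y != 0 by rewrite -normr_gt0 (lt_trans e0).
  apply: cvg_trans (cvgV y0 uy); apply: near_eq_cvg.
  near=> n; rewrite /cutoff_inv ifT//; near: n; exact: (cvgr_gt _ cu).
rewrite -leNgt le_eqVlt (negbTE ye) /= => ey.
apply: (@cvg_trans _ ((fun=> 0 : R) n @[n --> \oo])); last exact: cvg_cst.
apply: near_eq_cvg.
near=> n; rewrite /cutoff_inv ifF//; apply/negbTE; rewrite -leNgt.
by near: n; exact: (cvgr_le _ cu).
Unshelve. all: by end_near.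
Qed.

(** For a fixed radius the cutoff jumps only at [x = t - e] and [x = t + e]. Without these two
    points dominated convergence applies along every sequence tending to [t]. *)
Lemma continuous_pv_trunc h e : 0 < e -> mu.-integrable dom11 (EFin \o h) ->
  continuous (pv_trunc h ^~ e).
Proof.
move=> e0 ih t; apply: (@cvg_nbhsP R R^o (pv_trunc h ^~ e) t _).2 => u ut.
have mD := @measurable_dom11 R.
have mg s : measurable_fun dom11 (fun x => h x * cutoff_inv e (x - s)).
  by apply/measurable_EFinP; exact: measurable_int (integrable_cutoff s e0 ih).
pose D := (dom11 `\ (t + e)) `\ (t - e).
have mD1 : measurable (dom11 `\ (t + e)) by apply: measurableD => //; exact: measurable_set1.
have mD2 : measurable D by apply: measurableD => //; exact: measurable_set1.
have sD1 : dom11 `\ (t + e) `<=` dom11 by move=> x [].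
have sD : D `<=` dom11 by move=> x [[]].
have E s : pv_trunc h s e = \int[mu]_(x in D) (h x * cutoff_inv e (x - s)).
  rewrite /pv_trunc (Rintegral_setD1 (t + e))// (Rintegral_setD1 (t - e))//.
  exact: measurable_funS (mg s).
rewrite E; under eq_cvg do rewrite E.
apply: (@Rdominated_cvg _ _ _ _ (fun x => e^-1 * `|h x|)) => //.
- by move=> n; exact: measurable_funS (mg _).
- move=> x [[dx /= xt1] xt2]; apply: cvgM; first exact: cvg_cst.
  apply: cvg_cutoff_inv => //.
    apply/eqP => xe; have [xt|xt] := leP 0 (x - t).
      by apply: xt1; rewrite -xe ger0_norm// addrC subrK.
    by apply: xt2 => /=; rewrite -xe ltr0_norm// opprK addrC subrK.
  by apply: cvgB; [exact: cvg_cst|exact: ut].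
- apply: (@integrableS _ _ _ mu dom11) => //.
  by apply: integrable_realZl => //; exact: integrable_norm ih.
- by move=> n x [_ _]; rewrite normrM mulrC ler_wpM2r// cutoff_inv_le.
Qed.

Definition pv_cauchy_set h n m : set R :=
  [set t | forall e e', 0 < e < m.+1%:R^-1 -> 0 < e' < m.+1%:R^-1 ->
    `|pv_trunc h t e - pv_trunc h t e'| <= n.+1%:R^-1].

(** Closedness survives the intersection over uncountably many pairs of radii, where measurability
    alone would not be enough. *)
Lemma closed_pv_cauchy_set h n m : mu.-integrable dom11 (EFin \o h) ->
  closed (pv_cauchy_set h n m).
Proof.
move=> ih.
pose P := [set p : R * R | 0 < p.1 < m.+1%:R^-1 /\ 0 < p.2 < m.+1%:R^-1].
have -> : pv_cauchy_set h n m = \bigcap_(p in P)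
   ((fun t => `|pv_trunc h t p.1 - pv_trunc h t p.2|) @^-1` [set x | x <= n.+1%:R^-1]).
  apply/seteqP; split => t /=.
    by move=> H [e e'] [/= e0 e0']; exact: H.
  by move=> H e e' e0 e0'; exact: (H (e, e')).
apply: closed_bigI => -[e e'] [/= /andP[e0 _] /andP[e'0 _]].
apply: (continuous_closedP _).1; last exact: closed_le.
move=> t; apply: (@cvg_norm _ R^o); apply: cvgB; exact: continuous_pv_trunc.
Qed.

(** Cauchy's criterion with countably many tolerances and thresholds, which reduces measurability to
    that of the closed sets [pv_cauchy_set]. *)
Lemma pv_existsE h : [set t | exists L, pv_is h t L] =
  \bigcap_n \bigcup_m pv_cauchy_set h n m.
Proof.
apply/seteqP; split => t /=.
- move=> [L HL] n _; have n0 : 0 < n.+1%:R^-1 / 2 :> R by rewrite divr_gt0.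
  have [e0 e00 He] := HL _ n0.
  have [m] : exists m, 0 + m.+1%:R^-1 < e0 by exact: ltr_add_invr.
  rewrite add0r => me; exists m => // e e' /andP[ep em] /andP[ep' em'].
  have h1 := He e _; have h2 := He e' _.
  have {}h1 : `|pv_trunc h t e - L| <= n.+1%:R^-1 / 2 by apply: h1; rewrite ep (lt_trans em).
  have {}h2 : `|pv_trunc h t e' - L| <= n.+1%:R^-1 / 2 by apply: h2; rewrite ep' (lt_trans em').
  have -> : pv_trunc h t e - pv_trunc h t e' =
    (pv_trunc h t e - L) - (pv_trunc h t e' - L) by ring.
  by rewrite [leRHS]splitr (le_trans (ler_normB _ _))// lerD.
- move=> H; suff : cvg (pv_trunc h t e @[e --> 0^'+]).
    by move=> /cvg_ex[/= L cL]; exists L; exact/pv_isP.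
  apply: cauchy_cvg; apply: cauchy_exP => eps eps0.
  have [n] : exists n, 0 + n.+1%:R^-1 < eps by exact: ltr_add_invr.
  rewrite add0r => neps; have [m _ Hm] := H n I.
  pose e1 : R := m.+1%:R^-1 / 2.
  have m0 : 0 < m.+1%:R^-1 :> R by rewrite invr_gt0.
  exists (pv_trunc h t e1).
  suff : \forall e \near 0^'+, ball (pv_trunc h t e1) eps (pv_trunc h t e) by [].
  near=> e.
  rewrite -ball_normE /=; apply: le_lt_trans neps; apply: Hm.
    by rewrite /e1 divr_gt0//= ltr_pdivrMr// ltr_pMr// ltr1n.
  apply/andP; split; first by near: e; exact: nbhs_right_gt.
  by near: e; exact: nbhs_right_lt.
Unshelve. all: by end_near.
Qed.

Lemma measurable_pv_exists h : mu.-integrable dom11 (EFin \o h) ->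
  measurable [set t | exists L, pv_is h t L].
Proof.
move=> ih; rewrite pv_existsE; apply: bigcapT_measurable => n.
by apply: bigcupT_measurable => m; apply: closed_measurable; exact: closed_pv_cauchy_set.
Qed.

End pv_measurability.

(** * The complex limit in terms of two real principal values *)

Section complex_transform.
Context {R : realType}.
Local Notation mu := (@lebesgue_measure R).
Local Notation rc := (real_complex R).
Implicit Types (f g : R -> R[i]) (z : R[i]) (h : R -> R) (t e x r L : R).

Lemma Re_mulr r z : complex.Re (rc r * z) = r * complex.Re z.
Proof. by case: z => a b /=; rewrite mul0r subr0. Qed.

Lemma Im_mulr r z : complex.Im (rc r * z) = r * complex.Im z.
Proof. by case: z => a b /=; rewrite mul0r addr0. Qed.

Lemma ReB (z1 z2 : R[i]) : complex.Re (z1 - z2) = complex.Re z1 - complex.Re z2.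
Proof. by case: z1; case: z2. Qed.

Lemma ImB (z1 z2 : R[i]) : complex.Im (z1 - z2) = complex.Im z1 - complex.Im z2.
Proof. by case: z1; case: z2. Qed.

Lemma Re_divr z r : complex.Re (z / rc r) = complex.Re z / r.
Proof. by rewrite -fmorphV mulrC Re_mulr mulrC. Qed.

Lemma Im_divr z r : complex.Im (z / rc r) = complex.Im z / r.
Proof. by rewrite -fmorphV mulrC Im_mulr mulrC. Qed.

Lemma pv_trunc_split h t e : dom11 t -> 0 < e -> mu.-integrable dom11 (EFin \o h) ->
  \int[mu]_(x in `]-1, t - e[) (h x / (x - t)) +
  \int[mu]_(x in `]t + e, 1[) (h x / (x - t)) = pv_trunc h t e.
Proof.
move=> /dom11E dt e0 ih; have mD := @measurable_dom11 R.
pose U : set R := `]-1, t - e[%classic `|` `]t + e, 1[%classic.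
have UE x : U x <-> dom11 x /\ e < `|x - t|.
  rewrite /U /= !in_itv /= ltr_normr opprB; split.
    by move=> [/andP[x1 x2]|/andP[x1 x2]]; split; [apply/dom11E; lra|apply/orP; right; lra|
      apply/dom11E; lra|apply/orP; left; lra].
  by move=> [/dom11E dx /orP[xe|xe]]; [right|left]; apply/andP; split; lra.
have mU : measurable U by apply: measurableU; exact: measurable_itv.
have sU : U `<=` dom11 by move=> x /UE[].
have ic := integrable_cutoff t e0 ih.
have E1 : pv_trunc h t e = \int[mu]_(x in U) (h x * cutoff_inv e (x - t)).
  rewrite -[U in RHS](setIidr sU).
  rewrite Rintegral_mkcondr; apply: eq_Rintegral => x /set_mem dx.
  rewrite patchE; case: ifPn => //; rewrite notin_setE => xU.
  rewrite /cutoff_inv ifF ?mulr0//; apply/negP => ex; apply: xU; exact/UE.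
rewrite E1 /U Rintegral_setU//.
- congr (_ + _); apply: eq_Rintegral => x /set_mem xU; rewrite /cutoff_inv ifT//.
    by apply: ((UE x).1 _).2; left.
  by apply: ((UE x).1 _).2; right.
- exact: (@integrableS _ _ _ mu dom11).
- apply/disj_setPS => x [/=]; rewrite !in_itv /=; lra.
Qed.

Lemma Re_truncated g t e : dom11 t -> 0 < e ->
  mu.-integrable dom11 (EFin \o (fun x => complex.Re (g x))) ->
  complex.Re (truncated_fht g t e) = pi^-1 * pv_trunc (fun x => complex.Re (g x)) t e.
Proof.
move=> dt e0 ig; rewrite /truncated_fht -fmorphV Re_mulr; congr (_ * _).
rewrite /Cintegral /= -pv_trunc_split//.
by congr (_ + _); apply: eq_Rintegral => x _; rewrite Re_divr.
Qed.

Lemma Im_truncated g t e : dom11 t -> 0 < e ->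
  mu.-integrable dom11 (EFin \o (fun x => complex.Im (g x))) ->
  complex.Im (truncated_fht g t e) = pi^-1 * pv_trunc (fun x => complex.Im (g x)) t e.
Proof.
move=> dt e0 ig; rewrite /truncated_fht -fmorphV Im_mulr; congr (_ * _).
rewrite /Cintegral /= -pv_trunc_split//.
by congr (_ + _); apply: eq_Rintegral => x _; rewrite Im_divr.
Qed.

Variable g : R -> R[i].
Let gr x := complex.Re (g x).
Let gi x := complex.Im (g x).
Hypothesis igr : mu.-integrable dom11 (EFin \o gr).
Hypothesis igi : mu.-integrable dom11 (EFin \o gi).

Lemma pv_fht_cvg t L1 L2 : dom11 t -> pv_is gr t L1 -> pv_is gi t L2 ->
  (truncated_fht g t e @[e --> 0^'+] : set_system (R[i])^o) -->
    (Complex (pi^-1 * L1) (pi^-1 * L2) : (R[i])^o).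
Proof.
move=> dt h1 h2; have pi0 : 0 < pi :> R by exact: pi_gt0.
(* In the order of [R[i]] a positive [eps] has imaginary part 0, so it may be replaced by its real
   part. *)
apply/cvgrPdist_lt => eps; rewrite ltcE /= => /andP[/eqP imeps reps].
have -> : eps = rc (complex.Re eps) by apply/eqP; rewrite eq_complex /= imeps !eqxx.
set d := complex.Re eps in reps *.
have d0 : 0 < d * pi / 4 by rewrite divr_gt0// mulr_gt0.
have [e1 e10 H1] := h1 _ d0; have [e2 e20 H2] := h2 _ d0.
near=> e.
have e0 : 0 < e by near: e; exact: nbhs_right_gt.
have ee1 : e < e1 by near: e; exact: nbhs_right_lt.
have ee2 : e < e2 by near: e; exact: nbhs_right_lt.
rewrite -[truncated_fht g t e](_ : Complex (complex.Re (truncated_fht g t e)) (complex.Im (truncated_fht g t e)) = _); last by case: truncated_fht.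
rewrite Re_truncated// Im_truncated//.
rewrite [ltLHS](_ : _ = rc (cmod (Complex (pi^-1 * L1 - pi^-1 * pv_trunc gr t e)
   (pi^-1 * L2 - pi^-1 * pv_trunc gi t e))))//.
rewrite ltcR; apply: le_lt_trans (normc_le_ReIm _) _ => /=.
rewrite -!mulrBr !normrM (gtr0_norm (_ : 0 < pi^-1)) ?invr_gt0// -mulrDr.
rewrite mulrC ltr_pdivrMr//.
have {}H1 := H1 e _; have {}H2 := H2 e _.
move: H1; rewrite e0 ee1 distrC => /(_ isT) H1.
move: H2; rewrite e0 ee2 distrC => /(_ isT) H2.
have := mulr_gt0 reps pi0; lra.
Unshelve. all: by end_near.
Qed.

Lemma fht_cvgE t L1 L2 : dom11 t -> pv_is gr t L1 -> pv_is gi t L2 ->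
  fht g t = Complex (pi^-1 * L1) (pi^-1 * L2).
Proof.
move=> dt h1 h2; have /cvg_lim := pv_fht_cvg dt h1 h2; apply.
exact: norm_hausdorff.
Qed.

Lemma fht_cvg_pv t (l : R[i]) : dom11 t ->
  (truncated_fht g t e @[e --> 0^'+] : set_system (R[i])^o) --> (l : (R[i])^o) ->
  pv_is gr t (pi * complex.Re l) /\ pv_is gi t (pi * complex.Im l).
Proof.
move=> dt /cvgrPdist_lt H; have pi0 : 0 < pi :> R by exact: pi_gt0.
have K eta : 0 < eta -> exists2 e0, 0 < e0 & forall e, 0 < e < e0 ->
    cmod (l - truncated_fht g t e) < eta / pi.
  move=> eta0; have ep : 0 < rc (eta / pi) :> R[i] by rewrite ltcR divr_gt0.
  have [e0 /= e00 He] := H _ ep; exists e0 => // e /andP[e1 e2].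
  have : `|l - truncated_fht g t e| < rc (eta / pi).
    by apply: He => //=; rewrite sub0r normrN gtr0_norm.
  by rewrite [ltLHS](_ : _ = rc (cmod (l - truncated_fht g t e)))// ltcR.
split=> eta eta0; have [e0 e00 He] := K _ eta0; exists e0 => // e /andP[e1 e2].
- have := He e; rewrite e1 e2 => /(_ isT) /ltW He'.
  have := le_trans (Re_le_normc _) He'; rewrite ReB Re_truncated//.
  rewrite -/gr ler_pdivlMr// -[X in _ * X](gtr0_norm pi0) -normrM mulrBl.
  by rewrite mulrAC mulVf ?gt_eqF// mul1r distrC [_ * pi]mulrC.
- have := He e; rewrite e1 e2 => /(_ isT) /ltW He'.
  have := le_trans (Im_le_normc _) He'; rewrite ImB Im_truncated//.
  rewrite -/gi ler_pdivlMr// -[X in _ * X](gtr0_norm pi0) -normrM mulrBl.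
  by rewrite mulrAC mulVf ?gt_eqF// mul1r distrC [_ * pi]mulrC.
Qed.

(* Where the principal value does not exist, [lim] returns [point], which is [0]
   in [R[i]]; this makes the estimates below insensitive to that set. *)
Lemma fht_dvgE t : dom11 t -> ~ ((exists L, pv_is gr t L) /\ (exists L, pv_is gi t L)) ->
  fht g t = 0.
Proof.
move=> dt H; rewrite /fht /lim /lim_in getPN// => l hl.
by apply: H; have [? ?] := fht_cvg_pv dt hl; split; eexists; eassumption.
Qed.

End complex_transform.

(** * Moments of the principal value for real functions *)

Section moment_bound.
Context {R : realType}.
Local Notation mu := (@lebesgue_measure R).
Implicit Types (h f : R -> R) (t e x r L : R) (n m : nat).

Lemma limn_einf_le (u : (\bar R)^nat) (C : \bar R) : (forall n, (u n <= C)%E) ->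
  (limn_einf u <= C)%E.
Proof.
move=> uC; rewrite limn_einf_lim; apply: lime_le; first exact: is_cvg_einfs.
apply: nearW => n; apply: le_trans (uC n).
by apply: ereal_inf_lbound; exists n => //=.
Qed.

(** One choice of [N_] serves twice: it makes the truncation error of the conjugate kernel tend to
    0, and since [(1-r)^2 <= 1-r] it implies the condition under which [even_kernel] is
    nonnegative. *)
Lemma truncation_index : exists N_ : nat -> nat,
  forall n, 4 * radius n ^+ (N_ n).+1 / (1 - radius n) ^+ 2 <= n.+1%:R^-1 :> R.
Proof.
suff : forall n, exists N, 4 * radius n ^+ N.+1 / (1 - radius n) ^+ 2 <= n.+1%:R^-1 :> R.
  by move=> /boolp.choice[N_ H]; exists N_.
move=> n; have r := @radius_bounds R n; set q : R := radius n in r *.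
have e0 : 0 < (1 - q) ^+ 2 by rewrite exprn_gt0//; lra.
have q1 : `|q| < 1 by rewrite ger0_norm; lra.
have d0 : 0 < n.+1%:R^-1 * (1 - q) ^+ 2 / 4 :> R by rewrite divr_gt0// mulr_gt0.
have := @cvg_geometric R q q q1 => /cvgrPdist_lt/(_ _ d0)[N _ /(_ N (leqnn N))].
rewrite /= sub0r normrN ger0_norm; last by rewrite mulr_ge0 ?exprn_ge0//; lra.
rewrite -exprS => h; exists N; rewrite ler_pdivrMr//.
by move: h; rewrite ltr_pdivlMr// [_ * 4]mulrC => /ltW.
Qed.

Variable f : R -> R.
Let h x := f x / weight x.
Hypothesis ih : mu.-integrable dom11 (EFin \o h).

(** Inserting [1 / weight t >= 1] under the integral turns [t] into the angle, where
    [conj_poisson_bound] applies. *)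
Lemma conj_poisson_moment m N r : (0 < m)%N -> 0 < r < 1 -> 2 * r ^+ N.+1 <= 1 - r ->
  mu.-integrable dom11 (EFin \o (fun x => f x ^+ (2 * m) / weight x)) ->
  (\int[mu]_(t in dom11) (conj_poisson f N r (acos t) ^+ (2 * m))%:E <=
   ((35 * m%:R) ^+ (2 * m) * \int[mu]_(x in dom11) (f x ^+ (2 * m) / weight x))%:E)%E.
Proof.
move=> m0 r01 rN ifm.
pose V th := conj_poisson f N r th ^+ (2 * m).
have V0 th : 0 <= V th by rewrite /V exprM exprn_ge0 ?sqr_ge0.
have cV : continuous V by apply: continuousX_fun; exact: continuous_conj_poisson.
have mD := @measurable_dom11 R.
apply: (@le_trans _ _ (\int[mu]_(t in dom11) (V (acos t) / weight t)%:E)%E).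
  apply: ge0_le_integral => //.
  - by move=> t _; rewrite lee_fin V0.
  - by apply/measurable_EFinP; exact: (@measurable_acos_comp R V).
  - by apply/measurable_EFinP; exact: measurable_acos_weight.
  - move=> t dt; rewrite lee_fin ler_peMr ?V0//.
    by rewrite invf_ge1 ?weight_le1// weight_gt0.
apply: le_trans (acos_subst_le cV V0) _.
have iV := @continuous_integrable_itv R V 0 pi cV.
rewrite -[leLHS]fineK ?integrable_fin_num// lee_fin.
exact: conj_poisson_bound.
Qed.

Let E : set R := [set t | exists L, pv_is h t L].

Definition pv_value t : R := xget 0 [set L | pv_is h t L].

Let pv_valueP t : E t -> pv_is h t (pv_value t).
Proof. by move=> [L hL]; rewrite /pv_value; exact: (xgetPex 0 (ex_intro _ L hL)). Qed.

Let pv_seq (a : nat -> R) t : (forall n, 0 < a n) -> a n @[n --> \oo] --> (0 : R) -> E t ->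
  pv_trunc h t (a n) @[n --> \oo] --> pv_value t.
Proof.
move=> a0 cva /pv_valueP/pv_isP/cvg_at_rightP; apply.
by split.
Qed.

Variable F : set R.
Hypotheses (mF : measurable F) (FE : F `<=` E).

(** A pointwise limit of continuous functions, along the radii [1/(n+1)]. [F] may be smaller than
    [E], since for complex [f] the principal value of the other component has to exist as well. *)
Lemma measurable_pv_value : measurable_fun dom11 (fun t => \1_F t * pv_value t).
Proof.
pose a n : R := n.+1%:R^-1.
apply: (@measurable_fun_cvg _ _ _ _ (fun n t => \1_F t * pv_trunc h t (a n))).
  move=> n; apply: measurable_funM; first exact: measurable_indic.
  apply: measurable_funTS; apply: continuous_measurable_fun; apply: continuous_pv_trunc => //.
  by rewrite invr_gt0.
move=> t _; rewrite indicE; have [/set_mem tF|tF] := boolP (t \in F).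
  apply: cvgM; first exact: cvg_cst.
  by apply: pv_seq; [move=> n; rewrite invr_gt0|exact: cvg_harmonic|exact: FE].
under eq_cvg do rewrite mul0r.
by rewrite mul0r; exact: cvg_cst.
Qed.

Lemma pv_moment m : (0 < m)%N ->
  mu.-integrable dom11 (EFin \o (fun x => f x ^+ (2 * m) / weight x)) ->
  (\int[mu]_(t in dom11) ((weight t * (pi^-1 * (\1_F t * pv_value t))) ^+ (2 * m))%:E <=
   ((35 * m%:R) ^+ (2 * m) * \int[mu]_(x in dom11) (f x ^+ (2 * m) / weight x))%:E)%E.
Proof.
move=> m0 ifm; have [N_ N_P] := truncation_index.
have mD := @measurable_dom11 R.
pose v n t := \1_F t * conj_poisson f (N_ n) (radius n) (acos t).
have cv n : continuous (conj_poisson f (N_ n) (radius n)) by exact: continuous_conj_poisson.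
have mv n : measurable_fun dom11 (v n).
  apply: measurable_funM; first exact: measurable_indic.
  exact: measurable_acos_comp.
have v_cvg t : dom11 t -> v n t @[n --> \oo] --> weight t * (pi^-1 * (\1_F t * pv_value t)).
  move=> dt; rewrite /v indicE; have [/set_mem tF|tF] := boolP (t \in F).
    under eq_cvg do rewrite mul1r.
    rewrite mul1r mulrCA; apply: conj_poisson_cvg => //.
    exact/pv_valueP/FE.
  under eq_cvg do rewrite mul0r.
  by rewrite mul0r !mulr0; exact: cvg_cst.
have ev (x : R) : 0 <= x ^+ (2 * m) by rewrite exprM exprn_ge0 ?sqr_ge0.
pose G n t := (v n t ^+ (2 * m))%:E.
have mG n : measurable_fun dom11 (G n).
  by apply/measurable_EFinP; exact: measurable_funX.
have limE t : dom11 t ->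
   limn_einf (G ^~ t) = ((weight t * (pi^-1 * (\1_F t * pv_value t))) ^+ (2 * m))%:E.
  move=> dt; apply: (cvg_limn_einf_sup _).1; apply: cvg_EFin; first exact: nearW.
  exact: (cvg_comp _ _ (v_cvg t dt) (@exprn_continuous R (2 * m) _)).
under eq_integral => t /set_mem dt do rewrite -limE//.
apply: le_trans (fatou _ _ _ _) _ => //.
  by move=> n t _; rewrite lee_fin.
apply: limn_einf_le => n.
have r := @radius_bounds R n; have r01 : (0 : R) < radius n < (1 : R) by lra.
have rN : 2 * radius n ^+ (N_ n).+1 <= 1 - radius n :> R.
  have e0 : 0 < (1 - radius n) ^+ 2 :> R by rewrite exprn_gt0//; lra.
  have := N_P n; rewrite ler_pdivrMr// => h1.
  have n1 : n.+1%:R^-1 <= 1 :> R by rewrite invf_le1// ler1n.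
  have := ler_wpM2r (ltW e0) n1; rewrite mul1r => /(le_trans h1) {}h1.
  have : (1 - radius n) ^+ 2 <= 1 - radius n :> R by rewrite expr2 ler_piMl//; lra.
  have : 0 <= radius n ^+ (N_ n).+1 :> R by rewrite exprn_ge0//; lra.
  lra.
apply: le_trans (conj_poisson_moment m0 r01 rN ifm).
apply: ge0_le_integral => //.
- by move=> t _; rewrite lee_fin.
- exact: mG.
- by apply/measurable_EFinP; apply: measurable_funX; exact: (measurable_acos_comp (cv n)).
- move=> t _; rewrite lee_fin /v exprMn indicE.
  case: (t \in F); first by rewrite expr1n mul1r.
  by rewrite expr0n muln_eq0 /= gtn_eqF//= mul0r.
Qed.

End moment_bound.

Section integral_le_scaled_sum.
Context {R : realType}.
Local Notation mu := (@lebesgue_measure R).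

Lemma integral_le_scaled_sum (D : set R) (c u v : R -> R) (k : R) : measurable D ->
  measurable_fun D (EFin \o c) -> measurable_fun D (EFin \o u) ->
  measurable_fun D (EFin \o v) -> 0 <= k -> (forall t, D t -> 0 <= c t) ->
  (forall t, D t -> 0 <= u t) -> (forall t, D t -> 0 <= v t) ->
  (forall t, D t -> c t <= k * (u t + v t)) ->
  (\int[mu]_(t in D) (c t)%:E <=
   k%:E * (\int[mu]_(t in D) (u t)%:E + \int[mu]_(t in D) (v t)%:E))%E.
Proof.
move=> mD mc mu' mv k0 c0 u0 v0 cuv.
have muv : measurable_fun D (fun t => (u t)%:E + (v t)%:E)%E by exact: emeasurable_funD.
rewrite -ge0_integralD//.
rewrite -ge0_integralZl//; last by move=> t Dt; rewrite -EFinD lee_fin addr_ge0 ?u0 ?v0.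
by apply: ge0_le_integral => //; exact: emeasurable_funM.
Qed.

End integral_le_scaled_sum.

(** * Moments of the transform of complex functions *)

Section checkT_moment.
Context {R : realType}.
Local Notation mu := (@lebesgue_measure R).
Variable f : R -> R[i].
Hypothesis mf : L0 f.
Let fr x := complex.Re (f x).
Let fi x := complex.Im (f x).
Hypothesis ifw : mu.-integrable dom11 (EFin \o (fun x => cmod (f x) / weight x)).

Lemma measurable_normc (D : set R) (g : R -> R[i]) :
  measurable_fun D (fun x => complex.Re (g x)) ->
  measurable_fun D (fun x => complex.Im (g x)) ->
  measurable_fun D (fun x => cmod (g x)).
Proof.
move=> mr mi.
have -> : (fun x => cmod (g x)) =
    (fun x => Num.sqrt (complex.Re (g x) ^+ 2 + complex.Im (g x) ^+ 2)).
  by apply/funext => x; case: (g x).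
apply: (measurableT_comp (continuous_measurable_fun (@sqrt_continuous R))).
by apply: measurable_funD; apply: measurable_funX.
Qed.

Lemma measurable_div_weight (g : R -> R) : measurable_fun dom11 g ->
  measurable_fun dom11 (fun x => g x / weight x).
Proof.
move=> mg; apply: measurable_funM => //.
by apply/measurable_EFinP; exact: measurable_int (@inv_weight_integrable R).
Qed.

Let ifr : mu.-integrable dom11 (EFin \o (fun x => fr x / weight x)).
Proof.
apply: (integrable_real_le _ _ _ ifw); first exact: measurable_dom11.
  by apply: measurable_div_weight; case: mf.
move=> x dx; rewrite normrM [`|_^-1|]ger0_norm ?invr_ge0 ?weight_ge0//.
by rewrite ler_wpM2r ?invr_ge0 ?weight_ge0// Re_le_normc.
Qed.

Let ifi : mu.-integrable dom11 (EFin \o (fun x => fi x / weight x)).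
Proof.
apply: (integrable_real_le _ _ _ ifw); first exact: measurable_dom11.
  by apply: measurable_div_weight; case: mf.
move=> x dx; rewrite normrM [`|_^-1|]ger0_norm ?invr_ge0 ?weight_ge0//.
by rewrite ler_wpM2r ?invr_ge0 ?weight_ge0// Im_le_normc.
Qed.

Let grE : (fun x => complex.Re (div_w f x)) = (fun x => fr x / weight x).
Proof. by apply/funext => x; rewrite /div_w Re_divr. Qed.

Let giE : (fun x => complex.Im (div_w f x)) = (fun x => fi x / weight x).
Proof. by apply/funext => x; rewrite /div_w Im_divr. Qed.

(** Where one of the two components diverges, [fht] is 0 as a whole; both components are therefore
    cut off by the same indicator. *)
Let F : set R := [set t | exists L, pv_is (fun x => fr x / weight x) t L] `&`
                 [set t | exists L, pv_is (fun x => fi x / weight x) t L].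

Let mF : measurable F.
Proof. by apply: measurableI; exact: measurable_pv_exists. Qed.

Let checkT_valueE t : dom11 t -> checkT f t =
  - Complex (weight t * (pi^-1 * (\1_F t * pv_value fr t)))
            (weight t * (pi^-1 * (\1_F t * pv_value fi t))).
Proof.
move=> dt; rewrite /checkT; congr (- _).
have igr : mu.-integrable dom11 (EFin \o (fun x => complex.Re (div_w f x))) by rewrite grE.
have igi : mu.-integrable dom11 (EFin \o (fun x => complex.Im (div_w f x))) by rewrite giE.
rewrite indicE; have [/set_mem [Fr Fi]|] := boolP (t \in F).
  rewrite (@fht_cvgE _ _ igr igi t (pv_value fr t) (pv_value fi t))//.
  - by apply/eqP; rewrite eq_complex /= !mul0r subr0 addr0 !mul1r !eqxx.
  - by rewrite grE; have [L hL] := Fr; exact: (xgetPex 0 (ex_intro _ L hL)).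
  - by rewrite giE; have [L hL] := Fi; exact: (xgetPex 0 (ex_intro _ L hL)).
rewrite notin_setE => nF; rewrite (fht_dvgE igr igi dt).
  by rewrite !mul0r !mulr0; apply/eqP; rewrite eq_complex /= !eqxx.
by rewrite grE giE => -[Fr Fi]; apply: nF.
Qed.

Lemma L0_checkT : L0 (checkT f).
Proof.
have mw : measurable_fun dom11 (@weight R).
  by apply: measurable_funTS; apply: continuous_measurable_fun; exact: continuous_weight.
split.
- have mv : measurable_fun dom11 (fun t => - (weight t * (pi^-1 * (\1_F t * pv_value fr t)))).
    apply: measurableT_comp => //; apply: measurable_funM => //; apply: measurable_funM => //.
    by apply: measurable_pv_value => // t [].
  by apply: eq_measurable_fun mv => t /set_mem dt; rewrite checkT_valueE.
- have mv : measurable_fun dom11 (fun t => - (weight t * (pi^-1 * (\1_F t * pv_value fi t)))).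
    apply: measurableT_comp => //; apply: measurable_funM => //; apply: measurable_funM => //.
    by apply: measurable_pv_value => // t [].
  by apply: eq_measurable_fun mv => t /set_mem dt; rewrite checkT_valueE.
Qed.

Lemma normc_expr_le (z : R[i]) m :
  cmod z ^+ (2 * m) <= 4 ^+ m * (complex.Re z ^+ (2 * m) + complex.Im z ^+ (2 * m)).
Proof.
have ev (x : R) : x ^+ (2 * m) = `|x| ^+ (2 * m) by rewrite !exprM real_normK ?num_real.
rewrite [complex.Re z ^+ _]ev [complex.Im z ^+ _]ev.
have := normc_le_ReIm z; set a := `|_|; set b := `|_| => zab.
have a0 : 0 <= a by exact: normr_ge0.
have b0 : 0 <= b by exact: normr_ge0.
move: a b a0 b0 zab => a b a0 b0 zab.
have -> : 4 ^+ m = 2 ^+ (2 * m) :> R by rewrite exprM; congr (_ ^+ _); rewrite expr2; ring.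
wlog ab : a b a0 b0 zab / a <= b.
  move=> H; have [ab|/ltW ba] := leP a b; first exact: H.
  by rewrite [a ^+ _ + _]addrC; apply: H => //; rewrite addrC.
apply: (@le_trans _ _ ((2 * b) ^+ (2 * m))).
  by rewrite lerXn2r ?nnegrE ?normc_ge0 ?mulr_ge0//; lra.
by rewrite exprMn ler_wpM2l ?exprn_ge0// lerDr exprn_ge0.
Qed.

Lemma checkT_moment m : (0 < m)%N ->
  mu.-integrable dom11 (EFin \o (fun x => cmod (f x) ^+ (2 * m) / weight x)) ->
  (\int[mu]_(t in dom11) (cmod (checkT f t) ^+ (2 * m))%:E <=
   ((140 * m%:R) ^+ (2 * m) * \int[mu]_(x in dom11) (cmod (f x) ^+ (2 * m) / weight x))%:E)%E.
Proof.
move=> m0 ifm; have mD := @measurable_dom11 R.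
set B := \int[mu]_(x in dom11) (cmod (f x) ^+ (2 * m) / weight x).
have ev (x : R) : 0 <= x ^+ (2 * m) by rewrite exprM exprn_ge0 ?sqr_ge0.
have w0 x : 0 <= (weight x)^-1 :> R by rewrite invr_ge0 weight_ge0.
have part (u : R -> R) : measurable_fun dom11 u -> (forall x, `|u x| <= cmod (f x)) ->
    mu.-integrable dom11 (EFin \o (fun x => u x / weight x)) ->
    F `<=` [set t | exists L, pv_is (fun x => u x / weight x) t L] ->
    (\int[mu]_(t in dom11) ((weight t * (pi^-1 * (\1_F t * pv_value u t))) ^+ (2 * m))%:E <=
     ((35 * m%:R) ^+ (2 * m) * B)%:E)%E.
  move=> mu' uf iu Fu.
  have ux x : u x ^+ (2 * m) / weight x <= cmod (f x) ^+ (2 * m) / weight x.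
    rewrite ler_wpM2r// -[u x ^+ _]ger0_norm// normrX.
    by rewrite lerXn2r ?nnegrE ?normc_ge0.
  have ium : mu.-integrable dom11 (EFin \o (fun x => u x ^+ (2 * m) / weight x)).
    apply: (integrable_real_le mD _ _ ifm).
      by apply: measurable_div_weight; exact: measurable_funX.
    by move=> x dx; rewrite ger0_norm// mulr_ge0.
  apply: le_trans (pv_moment iu mF Fu m0 ium) _.
  rewrite lee_fin ler_wpM2l ?ev//; exact: le_Rintegral.
pose vr t := weight t * (pi^-1 * (\1_F t * pv_value fr t)).
pose vi t := weight t * (pi^-1 * (\1_F t * pv_value fi t)).
have mw : measurable_fun dom11 (@weight R).
  by apply: measurable_funTS; apply: continuous_measurable_fun; exact: continuous_weight.
have mvr : measurable_fun dom11 (fun t => (vr t ^+ (2 * m))%:E).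
  apply/measurable_EFinP; apply: measurable_funX; apply: measurable_funM => //.
  by apply: measurable_funM => //; apply: measurable_pv_value => // t [].
have mvi : measurable_fun dom11 (fun t => (vi t ^+ (2 * m))%:E).
  apply/measurable_EFinP; apply: measurable_funX; apply: measurable_funM => //.
  by apply: measurable_funM => //; apply: measurable_pv_value => // t [].
have mc : measurable_fun dom11 (fun t => (cmod (checkT f t) ^+ (2 * m))%:E).
  apply/measurable_EFinP; apply: measurable_funX; have [? ?] := L0_checkT.
  exact: measurable_normc.
have dom t : dom11 t -> cmod (checkT f t) ^+ (2 * m) <= 4 ^+ m * (vr t ^+ (2 * m) + vi t ^+ (2 * m)).
  move=> dt; apply: le_trans (normc_expr_le _ _) _; rewrite checkT_valueE//=.
  by rewrite -/(vr t) -/(vi t) !(exprM (- _)) !sqrrN -!exprM.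
have c0 t : dom11 t -> 0 <= cmod (checkT f t) ^+ (2 * m) by move=> _; exact: ev.
have k0 : 0 <= 4 ^+ m :> R by rewrite exprn_ge0.
apply: le_trans (integral_le_scaled_sum mD mc mvr mvi k0 c0 (fun t _ => ev _) (fun t _ => ev _) dom) _.
have [mr mi] := mf.
have Hr := part fr mr (fun x => Re_le_normc _) ifr (fun t => @proj1 _ _).
have Hi := part fi mi (fun x => Im_le_normc _) ifi (fun t => @proj2 _ _).
apply: le_trans (lee_wpmul2l _ (leeD Hr Hi)) _; first by rewrite lee_fin exprn_ge0.
rewrite -EFinD -EFinM lee_fin -mulr2n -[(_ * B) *+ 2]mulr_natl !mulrA.
have B0 : 0 <= B.
  by apply: Rintegral_ge0 => x _; rewrite mulr_ge0// exprn_ge0 ?normc_ge0.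
rewrite ler_wpM2r//.
(* Splitting the modulus costs [4^m] and adding the two components costs 2; since [m > 0], their
   product is at most [4^(2m)], and [140 = 4 x 35]. *)
have -> : 140 * m%:R = 4 * (35 * m%:R) :> R by ring.
rewrite [leRHS]exprMn ler_wpM2r ?ev//.
have -> : (4 : R) ^+ (2 * m) = 4 ^+ m * 4 ^+ m by rewrite mul2n -addnn exprD.
rewrite ler_wpM2l ?exprn_ge0//.
have : 4 ^+ 1 <= 4 ^+ m :> R by rewrite ler_weXn2l ?ler1n.
rewrite expr1; lra.
Qed.

End checkT_moment.

(** * From [L^alpha_exp] to weighted moments *)

Section layers.
Context {R : realType}.
Local Notation mu := (@lebesgue_measure R).
Implicit Types (D A : set R) (x y c z : R) (n k j : nat).

(* Unlike [ge0_le_integral], without measurability assumptions. *)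
Lemma ge0_le_integral_nomeas D (f g : R -> \bar R) :
  (forall x, D x -> (0 <= f x)%E) -> (forall x, D x -> (f x <= g x)%E) ->
  (\int[mu]_(x in D) f x <= \int[mu]_(x in D) g x)%E.
Proof.
move=> f0 fg; have g0 x : D x -> (0 <= g x)%E by move=> Dx; rewrite (le_trans (f0 x Dx))// fg.
rewrite !ge0_integralE//; apply: le_ereal_sup => _ [h hf <-]; exists h => // x.
apply: le_trans (hf x) _; rewrite !patchE; case: ifPn => // /set_mem; exact: fg.
Qed.

Lemma nneseries_term_le (u : nat -> \bar R) k : (forall n, (0 <= u n)%E) ->
  (u k <= \sum_(0 <= n <oo) u n)%E.
Proof.
move=> u0; apply: le_trans (nneseries_lim_ge k.+1 (fun n _ _ => u0 n)).
by rewrite big_nat_recr//= leeDr// sume_ge0.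
Qed.

Lemma nneseries_geo_le (u : nat -> \bar R) c z : 0 <= c -> 0 < z < 1 ->
  (forall n, (0 <= u n)%E) -> (forall n, (u n <= (c * z ^+ n)%:E)%E) ->
  (\sum_(0 <= n <oo) u n <= (c / (1 - z))%:E)%E.
Proof.
move=> c0 /andP[z0 z1] u0 uc; apply: lime_le; first exact: is_cvg_nneseries.
apply: nearW => n; apply: (@le_trans _ _ (series (geometric c z) n)%:E).
  by rewrite /series /= -sumEFin; apply: lee_sum.
by rewrite lee_fin geometric_le_lim// gtr0_norm.
Qed.

(** [j] is the index with [16^-(j+1) < y <= 16^-j]. Base 16 keeps the square and fourth roots of the
    layers powers of 4 and 2. *)
Lemma inv_sqrt_dyadic y : 0 < y <= 1 ->
  exists j, y <= 16 ^- j /\ (Num.sqrt y)^-1 <= 4 ^+ j.+1.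
Proof.
move=> /andP[y0 y1].
have P : exists n, (16 ^- n < y).
  have q1 : `|16^-1 : R| < 1 by rewrite gtr0_norm ?invf_lt1 ?ltr1n.
  have := @cvg_geometric R 1 _ q1 => /cvgrPdist_lt/(_ _ y0)[n _ /(_ n (leqnn n))].
  by rewrite /= mul1r sub0r normrN gtr0_norm ?exprn_gt0 ?invr_gt0// exprVn; exists n.
case: (ex_minnP P) => -[|j] jy jmin.
  by move: jy; rewrite expr0 invr1 ltNge y1.
exists j; split; first by rewrite leNgt; apply/negP => /jmin; rewrite ltnn.
have -> : 4 ^+ j.+1 = (Num.sqrt (16 ^- j.+1))^-1 :> R.
  have -> : 16 ^- j.+1 = (4 ^- j.+1) ^+ 2 :> R.
    by rewrite exprVn -exprM mulnC exprM; congr (_ ^- _); rewrite expr2; ring.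
  by rewrite sqrtr_sqr gtr0_norm ?invr_gt0 ?exprn_gt0// invrK.
by rewrite lef_pV2 ?posrE ?sqrtr_gt0 ?invr_gt0 ?exprn_gt0// ler_wsqrtr// ltW.
Qed.

(** The integrand is dominated by the sum of [4^(j+1)] times the indicators of the sublevel sets,
    and the hypothesis makes the integrated series geometric. It serves both for [1/w] and for the
    rearrangement. *)
Lemma integral_inv_sqrt_le D (rho : R -> R) c z : measurable D -> measurable_fun D rho ->
  (forall x, D x -> 0 < rho x <= 1) -> 0 <= c -> 0 < z < 1 ->
  (forall j, (mu (D `&` [set x | (rho x <= 16 ^- j)%R]) <= (c * z ^+ j / 4 ^+ j.+1)%:E)%E) ->
  (\int[mu]_(x in D) ((Num.sqrt (rho x))^-1)%:E <= (c / (1 - z))%:E)%E.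
Proof.
move=> mD mrho rho01 c0 z01 Hmu.
pose B j := D `&` [set x | rho x <= 16 ^- j].
have mB j : measurable (B j).
  rewrite /B (_ : [set x | rho x <= 16 ^- j] = rho @^-1` `]-oo, 16 ^- j]).
    by apply: mrho => //; exact: measurable_itv.
  by apply/seteqP; split => x /=; rewrite in_itv.
have b0 j x : (0 <= (4 ^+ j.+1 * \1_(B j) x)%:E :> \bar R)%E.
  by rewrite lee_fin mulr_ge0.
apply: (@le_trans _ _ (\int[mu]_(x in D) \sum_(0 <= j <oo) (4 ^+ j.+1 * \1_(B j) x)%:E)%E).
  apply: ge0_le_integral_nomeas => x Dx; first by rewrite lee_fin invr_ge0 sqrtr_ge0.
  have [j [yj sj]] := inv_sqrt_dyadic (rho01 x Dx).
  apply: le_trans (@nneseries_term_le _ j (fun j => b0 j x)).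
  by rewrite lee_fin indicE mem_set ?mulr1.
rewrite integral_nneseries//; last first.
  move=> j; apply/measurable_EFinP; apply: measurable_funM => //.
  by apply: measurable_indic; exact: mB.
apply: nneseries_geo_le => // [j|j].
  by apply: integral_ge0 => x _.
under eq_integral do rewrite EFinM.
rewrite ge0_integralZl//; last by apply/measurable_EFinP; apply: measurable_indic; exact: mB.
rewrite integral_indic//; last exact: mB.
rewrite setIidl; last by move=> x [].
apply: le_trans (lee_wpmul2l _ (Hmu j)) _; first by rewrite lee_fin exprn_ge0.
by rewrite -EFinM lee_fin mulrC divfK// lt0r_neq0// exprn_gt0.
Qed.

Lemma weight_ge_sqrt x : dom11 x -> Num.sqrt (1 - `|x|) <= weight x.
Proof.
move=> /dom11E dx; rewrite /weight ler_wsqrtr//.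
have x1 : `|x| < 1 by rewrite ltr_norml.
have := normr_ge0 x; rewrite -[x ^+ 2]real_normK ?num_real//; nra.
Qed.

Lemma measurable_tail A c : measurable A -> measurable (A `&` [set x | 1 - `|x| <= c]).
Proof.
move=> mA; have mt : measurable_fun A (fun x : R => 1 - `|x|).
  by apply: measurable_funB => //; exact: measurable_normr.
have := mt mA _ (measurable_itv `]-oo, c]).
by congr measurable; congr (_ `&` _); apply/seteqP; split => x /=; rewrite in_itv.
Qed.

Lemma lebesgue_tail_le c : 0 < c ->
  (mu (dom11 `&` [set x | (1 - `|x| <= c)%R]) <= (2 * c)%:E)%E.
Proof.
move=> c0; apply: (@le_trans _ _ (mu (`](-1)%R, (-1 + c)%R] `|` `[(1 - c)%R, 1%R[))).
  apply: le_measure; rewrite ?inE; first by apply: measurable_tail; exact: measurable_dom11.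
    by apply: measurableU; exact: measurable_itv.
  move=> x [/dom11E dx /= xc]; rewrite !in_itv /=.
  have [x0|x0] := leP 0 x.
    by right; move: xc; rewrite ger0_norm//; lra.
  by left; move: xc; rewrite ltr0_norm//; lra.
apply: le_trans (measureU2 _ _ _) _; [exact: measurable_itv|exact: measurable_itv|].
have h1 : -1 < -1 + c by lra.
have h2 : 1 - c < 1 by lra.
rewrite [X in (X + _)%E](lebesgue_measure_itv `](-1)%R, (-1 + c)%R]).
rewrite [X in (_ + X)%E](lebesgue_measure_itv `[(1 - c)%R, 1%R[).
rewrite /= !lte_fin h1 h2 -!EFinD lee_fin; lra.
Qed.

(** With [b = 2^-j], the part of [A] within [b^4] of the end points has measure at most
    [2 min(q^4, b^4) <= 2 q b^3]. The factor [q] is kept as the gain, and [b^3] beats [4^j], leaving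
    the ratio [1/2]. *)
Lemma integral_inv_weight_le A q : measurable A -> A `<=` dom11 -> 0 <= q <= 1 ->
  (mu A <= (2 * q ^+ 4)%:E)%E ->
  (\int[mu]_(x in A) ((weight x)^-1)%:E <= (16 * q)%:E)%E.
Proof.
move=> mA AD /andP[q0 q1] muA.
apply: (@le_trans _ _ (\int[mu]_(x in A) ((Num.sqrt (1 - `|x|))^-1)%:E)%E).
  apply: ge0_le_integral_nomeas => x Ax; first by rewrite lee_fin invr_ge0 weight_ge0.
  have dx := AD x Ax; have x1 : 0 < 1 - `|x| by move/dom11E: dx; rewrite subr_gt0 ltr_norml.
  by rewrite lee_fin lef_pV2 ?posrE ?weight_gt0 ?weight_ge_sqrt// sqrtr_gt0.
have -> : 16 * q = (8 * q) / (1 - 2^-1) by field.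
apply: integral_inv_sqrt_le => //.
- by apply: measurable_funB => //; exact: measurable_normr.
- move=> x /AD/dom11E dx; rewrite lerBlDr lerDl normr_ge0 andbT subr_gt0 ltr_norml; lra.
- by rewrite mulr_ge0.
- by rewrite invr_gt0 ltr0n /= invf_lt1// ltr1n.
move=> j; set b : R := 2 ^- j.
have b0 : 0 < b by rewrite invr_gt0 exprn_gt0.
have e16 : 16 ^- j = b ^+ 4 :> R.
  by rewrite /b exprVn -exprM mulnC exprM; congr (_ ^- _); rewrite !exprS expr0; ring.
have e4 : 8 * q * 2^-1 ^+ j / 4 ^+ j.+1 = 2 * (q * b ^+ 3).
  have -> : 4 ^+ j.+1 = 4 * (2 ^+ j) ^+ 2 :> R.
    by rewrite exprS -exprM mulnC exprM; congr (_ * _ ^+ _); rewrite expr2; ring.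
  by rewrite exprVn /b; field; rewrite lt0r_neq0// exprn_gt0.
rewrite e4 e16.
have [qb|bq] := leP q b.
- apply: le_trans (le_measure _ _ _ _) (le_trans muA _); rewrite ?inE//.
  + exact: measurable_tail.
  + rewrite lee_fin ler_wpM2l// (exprS q) ler_wpM2l// lerXn2r ?nnegrE//; exact: ltW.
- apply: (@le_trans _ _ (mu (dom11 `&` [set x | (1 - `|x| <= b ^+ 4)%R]))).
    apply: le_measure; rewrite ?inE; [exact: measurable_tail|by apply: measurable_tail; exact: measurable_dom11|].
    by move=> x [/AD dx xb].
  apply: le_trans (lebesgue_tail_le _) _; first by rewrite exprn_gt0.
  rewrite lee_fin ler_wpM2l// (exprS b) ler_wpM2r ?exprn_ge0//; exact: ltW.
Qed.

End layers.

(** * Level sets and weighted moments of functions in L^alpha_exp *)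

Section source.
Context {R : realType}.
Local Notation mu := (@lebesgue_measure R).
Implicit Types (f : R -> R[i]) (alpha s t x y N : R) (k n p : nat).

Lemma rearrangement_ge0 f s : (0 <= rearrangement f s)%E.
Proof. by apply: le_ereal_inf_tmp => _ [l [l0 _] <-]; rewrite lee_fin. Qed.

Lemma rearrangement_le f s s' : s <= s' -> (rearrangement f s' <= rearrangement f s)%E.
Proof.
move=> ss'; apply: le_ereal_inf => _ [l [l0 lm] <-]; exists l => //; split => //.
by apply: le_trans lm _; rewrite lee_fin.
Qed.

Lemma measurable_level f l : L0 f -> measurable (dom11 `&` [set x | l < cmod (f x)]).
Proof.
move=> [mr mi]; have := measurable_normc mr mi measurable_dom11 (measurable_itv `]l, +oo[).
by congr measurable; congr (_ `&` _); apply/seteqP; split => x /=; rewrite in_itv /= andbT.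
Qed.

Lemma rearrangement_lt_measure f s l : L0 f -> (rearrangement f s < l%:E)%E ->
  (mu (dom11 `&` [set x | (l < cmod (f x))%R]) <= s%:E)%E.
Proof.
move=> mf /ereal_inf_lt[_ [l' [l'0 ml'] <-]]; rewrite lte_fin => l'l.
apply: le_trans ml'; apply: le_measure; rewrite ?inE; [exact: measurable_level|exact: measurable_level|].
by move=> x [dx /= lx]; split => //=; exact: lt_trans lx.
Qed.

Lemma measure_itv0 t : 0 < t -> mu `]0%R, t[ = t%:E.
Proof. by move=> t0; rewrite lebesgue_measure_itv /= lte_fin t0 oppr0 addr0. Qed.

Lemma measure_dom11 : mu dom11 = 2%:E.
Proof.
rewrite lebesgue_measure_itv /= lte_fin ifT; last lra.
by rewrite -EFinD; congr EFin; ring.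
Qed.

(** A decreasing function is at most its mean over [(0, t)]. Strictness is kept so that an
    admissible level can be extracted from the infimum defining the rearrangement. *)
Lemma rearrangement_le_norm alpha f N t : 0 < t < 2 -> (norm_Lexp alpha f < N%:E)%E ->
  (rearrangement f t < (N * (ln (2 * expR 1 / t)) `^ alpha)%:E)%E.
Proof.
move=> t02; have t0 : 0 < t by lra.
set L := _ `^ alpha.
have L0 : 0 < L.
  rewrite powR_gt0// ln_gt0// ltr_pdivlMr// mul1r.
  have := @expR_gt1 R 1; rewrite ltr01; lra.
move=> h; have : ((\int[mu]_(s in `]0%R, t[) rearrangement f s) * ((t * L)^-1)%:E < N%:E)%E.
  apply: le_lt_trans h; apply: ereal_sup_ubound; exists t => //=.
have tL0 : 0 < t * L by rewrite mulr_gt0.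
rewrite lte_pdivrMr// => h1.
have : (rearrangement f t * t%:E < N%:E * (t * L)%:E)%E.
  apply: le_lt_trans h1; rewrite -(measure_itv0 t0) -(integral_cst mu (measurable_itv _)).
  apply: ge0_le_integral_nomeas => s; first by move=> _; exact: rearrangement_ge0.
  by rewrite /= in_itv /= => /andP[_ /ltW]; exact: rearrangement_le.
by rewrite -lte_pdivlMr// => /lt_le_trans; apply; rewrite -!EFinM lee_fin [leLHS](_ : _ = N * L)//; field; exact: lt0r_neq0.
Qed.

Definition level_set alpha N f k : set R :=
  dom11 `&` [set x | N * k.+2%:R `^ alpha < cmod (f x)].

Lemma level_set_measure alpha N f k : L0 f -> (norm_Lexp alpha f < N%:E)%E ->
  (mu (level_set alpha N f k) <= (2 * expR (- k%:R / 4) ^+ 4)%:E)%E.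
Proof.
(* For this [t], [ln (2e/t)] is exactly [k + 2]; using [k + 1] in the exponent keeps [t < 2] also at
   [k = 0]. The fourth power prepares [integral_inv_weight_le]. *)
move=> mf fN; pose t : R := 2 * expR (- k.+1%:R).
have t02 : 0 < t < 2.
  by rewrite mulr_gt0 ?expR_gt0//= /t gtr_pMr// expR_lt1 oppr_lt0.
have := rearrangement_le_norm t02 fN.
have -> : 2 * expR 1 / t = expR k.+2%:R :> R.
  rewrite /t expRN invfM invrK -[k.+2%:R]natr1 -[k.+1%:R + _]addrC expRD.
  by field.
rewrite expRK => /(rearrangement_lt_measure mf)/le_trans; apply.
rewrite lee_fin /t ler_pM2l// -expRM_natr ler_expR divfK//.
by rewrite lerN2 ler_nat.
Qed.

Lemma one_le_powR alpha y : 0 <= alpha -> 1 <= y -> 1 <= y `^ alpha.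
Proof.
move=> a0 y1; have -> : 1 = 1 `^ alpha :> R by rewrite powR1.
by rewrite ge0_ler_powR// nnegrE; lra.
Qed.

(** From [y <= B e^(y/B)] with [B = 8 (alpha + 1) p], a nonzero number even at [alpha = 0]. The rate
    [1/8] is half of the decay rate [1/4] gained on the level sets, so the product still decays
    geometrically. *)
Lemma powR_exp_bound alpha y p : 0 <= alpha -> 0 <= y -> (0 < p)%N ->
  (y `^ alpha) ^+ p <= ((8 * (alpha + 1) * p%:R) `^ alpha) ^+ p * expR (y / 8).
Proof.
move=> a0 y0 p0; set B := 8 * (alpha + 1) * p%:R.
have pr : 0 < p%:R :> R by rewrite ltr0n.
have B0 : 0 < B by rewrite !mulr_gt0//; lra.
have yB : y <= B * expR (y / B).
  have := expR_ge1Dx (y / B) => h.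
  have : y / B <= expR (y / B) by lra.
  by rewrite ler_pdivrMr// mulrC.
have h1 : y `^ alpha <= (B * expR (y / B)) `^ alpha.
  by rewrite ge0_ler_powR// nnegrE mulr_ge0 ?expR_ge0 ?(ltW B0).
have h2 : (B * expR (y / B)) `^ alpha = B `^ alpha * expR (y / B * alpha).
  by rewrite powRM ?expR_ge0 ?(ltW B0)// [in RHS]expRM.
apply: (@le_trans _ _ ((B `^ alpha * expR (y / B * alpha)) ^+ p)).
  by rewrite -h2 lerXn2r ?nnegrE ?powR_ge0.
rewrite exprMn -expRM_natr ler_wpM2l ?exprn_ge0 ?powR_ge0// ler_expR.
have -> : y / B * alpha * p%:R = y / 8 * (alpha / (alpha + 1)).
  by rewrite /B; field; rewrite !lt0r_neq0//; lra.
rewrite ler_piMr ?divr_ge0// ler_pdivrMr; lra.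
Qed.

(** The first 16 bounds the integral of [1/w]. The rest sums [16 e^((k+3)/8) e^(-k/4)] over the
    layers [k]. *)
Definition source_const : R := 16 + 16 * expR (3 / 8) / (1 - expR (- 8^-1)).

Lemma source_const_ge1 : 1 <= source_const.
Proof.
rewrite /source_const.
have : 0 <= 16 * expR (3 / 8) / (1 - expR (- 8^-1)) :> R.
  by rewrite divr_ge0 ?mulr_ge0 ?expR_ge0// subr_ge0 expR_le1 oppr_le0 invr_ge0.
lra.
Qed.

Lemma source_moment alpha f N p : 0 <= alpha -> L0 f -> 0 < N ->
  (norm_Lexp alpha f < N%:E)%E -> (0 < p)%N ->
  (\int[mu]_(x in dom11) (cmod (f x) ^+ p / weight x)%:E <=
   ((source_const * N * (8 * (alpha + 1) * p%:R) `^ alpha) ^+ p)%:E)%E.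
Proof.
move=> a0 mf N0 fN p0; have mD := @measurable_dom11 R.
have [mr mi] := mf.
have mn := measurable_normc mr mi.
set D := (8 * (alpha + 1) * p%:R) `^ alpha.
pose A := level_set alpha N f.
have mA k : measurable (A k) by exact: measurable_level.
have AD k : A k `<=` dom11 by move=> x [].
have w0 x : 0 <= (weight x)^-1 :> R by rewrite invr_ge0 weight_ge0.
have D1 : 1 <= D.
  have p1 : 1 <= p%:R :> R by rewrite ler1n.
  by apply: one_le_powR => //; nra.
(* [c k] bounds [|f|^p] on [A k] outside [A k.+1], whence the index [k.+3]. *)
pose c k := N ^+ p * (k.+3%:R `^ alpha) ^+ p.
have c0 k : 0 <= c k by rewrite mulr_ge0 ?exprn_ge0 ?powR_ge0// ltW.
pose g k x : \bar R := (c k * (\1_(A k) x * (weight x)^-1))%:E.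
have g0 k x : (0 <= g k x)%E by rewrite lee_fin mulr_ge0// mulr_ge0.
pose c_ := N ^+ p * (2 `^ alpha) ^+ p.
have c_0 : 0 <= c_ by rewrite mulr_ge0 ?exprn_ge0 ?powR_ge0// ltW.
have pw x : dom11 x -> ((cmod (f x) ^+ p / weight x)%:E <=
    (c_ * (weight x)^-1)%:E + \sum_(0 <= k <oo) g k x)%E.
  move=> dx.
  have S0 : (0 <= \sum_(0 <= k <oo) g k x)%E by exact: nneseries_ge0.
  have bound y : cmod (f x) <= N * y `^ alpha -> cmod (f x) ^+ p / weight x <=
      N ^+ p * (y `^ alpha) ^+ p * (weight x)^-1.
    move=> h; rewrite ler_wpM2r// -exprMn lerXn2r ?nnegrE ?normc_ge0//.
    by rewrite mulr_ge0 ?powR_ge0// ltW.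
  have [[k hk]|none] := pselect (exists k, cmod (f x) <= N * k.+2%:R `^ alpha).
    have P : exists k, cmod (f x) <= N * k.+2%:R `^ alpha by exists k.
    case: (ex_minnP P) => -[|j] hj jmin.
      apply: le_trans (leeDl _ S0); rewrite lee_fin; exact: bound.
    apply: le_trans (leeDr _ _); last by rewrite lee_fin mulr_ge0.
    apply: le_trans (@nneseries_term_le _ _ j (fun k => g0 k x)).
    rewrite lee_fin indicE mem_set ?mul1r; first exact: bound.
    by split => //=; rewrite ltNge; apply/negP => /jmin; rewrite ltnn.
  (* No level bounds [|f x|], which can happen only for [alpha = 0]. Then [x] lies in every [A k]
     and every term is at least [N^p / w], so enough terms exceed the left-hand side. *)
  apply: le_trans (leeDr _ _); last by rewrite lee_fin mulr_ge0.
  have [n hn] : exists n, cmod (f x) ^+ p / N ^+ p <= n%:R.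
    by exists (Num.truncn (cmod (f x) ^+ p / N ^+ p)).+1; exact/ltW/truncnS_gt.
  apply: le_trans (nneseries_lim_ge n (fun k _ _ => g0 k x)).
  apply: (@le_trans _ _ (\sum_(0 <= k < n) (N ^+ p / weight x)%:E)%E).
    rewrite sumEFin big_const_nat subn0 iter_addr_0 lee_fin -mulr_natl mulrA ler_wpM2r//.
    by rewrite -ler_pdivrMr// exprn_gt0.
  apply: lee_sum => k _; rewrite lee_fin indicE mem_set ?mul1r.
    rewrite ler_wpM2r// /c ler_peMr ?exprn_ge0 ?(ltW N0)//.
    by rewrite exprn_ege1// one_le_powR// ler1n.
  by split => //=; rewrite ltNge; apply/negP => h; apply: none; exists k.
apply: (@le_trans _ _ (\int[mu]_(x in dom11) ((c_ * (weight x)^-1)%:E + \sum_(0 <= k <oo) g k x))%E).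
  apply: ge0_le_integral_nomeas => x dx; last exact: pw.
  by rewrite lee_fin mulr_ge0// exprn_ge0// normc_ge0.
have miw : measurable_fun dom11 (fun x : R => (weight x)^-1).
  by apply/measurable_EFinP; exact: measurable_int (@inv_weight_integrable R).
have mg k : measurable_fun dom11 (g k).
  by apply/measurable_EFinP; apply: measurable_funM => //; apply: measurable_funM.
rewrite ge0_integralD//; last 4 first.
- by move=> x _; rewrite lee_fin mulr_ge0.
- by apply/measurable_EFinP; exact: measurable_funM.
- by move=> x _; exact: nneseries_ge0.
- exact: (@ge0_emeasurable_sum _ _ _ _ g xpredT (fun k x _ _ => g0 k x) (fun k _ => mg k)).
rewrite integral_nneseries//.
have Np0 : 0 <= N ^+ p by rewrite exprn_ge0// ltW.
have part1 : (\int[mu]_(x in dom11) (c_ * (weight x)^-1)%:E <= (N ^+ p * D ^+ p * 16)%:E)%E.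
  under eq_integral do rewrite EFinM.
  rewrite ge0_integralZl//; [|by apply/measurable_EFinP|by move=> x _; rewrite lee_fin].
  have := @integral_inv_weight_le R dom11 1 mD (fun x dx => dx).
  rewrite ler01 lexx => /(_ isT) h.
  have {}h := h _; apply: (@le_trans _ _ (c_%:E * (16 * 1)%:E)%E).
    apply: lee_wpmul2l; first by rewrite lee_fin.
    by apply: h; rewrite expr1n mulr1 measure_dom11.
  rewrite -EFinM lee_fin mulr1 ler_wpM2r// ler_wpM2l// lerXn2r ?nnegrE ?powR_ge0//.
  have p1 : 1 <= p%:R :> R by rewrite ler1n.
  by rewrite ge0_ler_powR// ?nnegrE//; nra.
have part2 : (\sum_(0 <= k <oo) \int[mu]_(x in dom11) g k x <=
   (N ^+ p * D ^+ p * (16 * expR (3 / 8)) / (1 - expR (- 8^-1)))%:E)%E.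
  apply: nneseries_geo_le.
  - by rewrite !mulr_ge0 ?expR_ge0// exprn_ge0// powR_ge0.
  - by rewrite expR_gt0 expR_lt1 oppr_lt0 invr_gt0 ltr0n.
  - by move=> k; apply: integral_ge0 => x _.
  move=> k; under eq_integral do rewrite /g EFinM.
  rewrite ge0_integralZl//; [|by apply/measurable_EFinP; apply: measurable_funM => //;
    apply: measurable_indic; exact: mA|by move=> x _; rewrite lee_fin mulr_ge0|by rewrite lee_fin].
  have -> : (\int[mu]_(x in dom11) (\1_(A k) x * (weight x)^-1)%:E =
             \int[mu]_(x in A k) ((weight x)^-1)%:E)%E.
    rewrite -[in RHS](setIidr (AD k)) integral_mkcondr; apply: eq_integral => x _.
    by rewrite patchE indicE; case: (x \in A k); rewrite ?mul1r ?mul0r.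
  have q01 : (0 : R) <= expR (- k%:R / 4) <= (1 : R).
    by rewrite expR_ge0 expR_le1 mulNr oppr_le0 divr_ge0.
  have H := integral_inv_weight_le (mA k) (AD k) q01 (level_set_measure k mf fN).
  apply: (@le_trans _ _ ((c k)%:E * (16 * expR (- k%:R / 4))%:E)%E).
    by apply: lee_wpmul2l; rewrite ?lee_fin.
  rewrite -EFinM lee_fin /c -!mulrA ler_wpM2l//.
  have := powR_exp_bound a0 (ler0n R k.+3) p0; rewrite -/D => h.
  apply: le_trans (ler_wpM2r _ h) _; first by rewrite mulr_ge0 ?expR_ge0.
  rewrite -!mulrA ler_wpM2l ?exprn_ge0 ?powR_ge0// mulrCA ler_wpM2l//.
  rewrite -expRM_natr -!expRD ler_expR -[k.+3%:R]/((3 + k)%:R) natrD.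
  by rewrite le_eqVlt; apply/orP; left; apply/eqP; field.
apply: le_trans (leeD part1 part2) _.
rewrite -EFinD lee_fin.
have -> : N ^+ p * D ^+ p * 16 + N ^+ p * D ^+ p * (16 * expR (3 / 8)) / (1 - expR (- 8^-1)) =
  source_const * (N ^+ p * D ^+ p) by rewrite /source_const; ring.
rewrite -mulrA !exprMn ler_wpM2r//.
  by rewrite mulr_ge0// exprn_ge0// powR_ge0.
by rewrite -[leLHS]expr1 ler_weXn2l// source_const_ge1.
Qed.

End source.

(** * From moments to [L^(alpha+1)_exp] *)

Section target.
Context {R : realType}.
Local Notation mu := (@lebesgue_measure R).
Implicit Types (f : R -> R[i]) (alpha beta s t x y l N A : R) (k n m : nat).

Lemma markov_level f l m B : L0 f -> 0 < l ->
  (\int[mu]_(x in dom11) (cmod (f x) ^+ m)%:E <= B%:E)%E ->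
  (mu (dom11 `&` [set x | (l < cmod (f x))%R]) <= (B / l ^+ m)%:E)%E.
Proof.
move=> mf l0 fB; have lm : 0 < l ^+ m by rewrite exprn_gt0.
have mL := measurable_level l mf.
rewrite EFinM lee_pdivlMr// muleC -(integral_cst mu mL).
apply: le_trans fB; apply: (@le_trans _ _ (\int[mu]_(x in dom11 `&` [set x | (l < cmod (f x))%R]) (cmod (f x) ^+ m)%:E)%E).
  apply: ge0_le_integral_nomeas => x; first by rewrite lee_fin ltW.
  by move=> [_ /= /ltW lx]; rewrite lee_fin lerXn2r ?nnegrE ?normc_ge0 ?(ltW l0).
have [mr mi] := mf; apply: ge0_subset_integral => //.
- exact: measurable_dom11.
- by apply/measurable_EFinP; apply: measurable_funX; exact: measurable_normc.
- by move=> x _; rewrite lee_fin exprn_ge0 ?normc_ge0.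
Qed.

Lemma rearrangement_le_level f s l : 0 <= l ->
  (mu (dom11 `&` [set x | (l < cmod (f x))%R]) <= s%:E)%E -> (rearrangement f s <= l%:E)%E.
Proof. by move=> l0 h; apply: ereal_inf_lbound; exists l. Qed.

(** The layer [s/t <= 16^-j] has length at most [16^-j t], so the series has ratio [1/4] and first
    term [4 t]. *)
Lemma integral_inv_sqrt_itv t : 0 < t ->
  (\int[mu]_(s in `]0%R, t[) ((Num.sqrt (s / t))^-1)%:E <= (16 / 3 * t)%:E)%E.
Proof.
move=> t0; have -> : 16 / 3 * t = (4 * t) / (1 - 4^-1) by field.
apply: integral_inv_sqrt_le => //.
- exact: measurable_funM.
- move=> s; rewrite /= in_itv /= => /andP[s0 st].
  by rewrite divr_gt0//= ler_pdivrMr// mul1r ltW.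
- by rewrite mulr_ge0// ltW.
- by rewrite invr_gt0 ltr0n /= invf_lt1// ltr1n.
move=> j; have q0 : 0 < 16 ^- j :> R by rewrite invr_gt0 exprn_gt0.
apply: (@le_trans _ _ (mu `]0%R, (t * 16 ^- j)%R])).
  apply: le_measure; rewrite ?inE; [|exact: measurable_itv|].
    have mr : measurable_fun `]0, t[ (fun s : R => s / t) by exact: measurable_funM.
    have := mr (measurable_itv _) _ (measurable_itv `]-oo, 16 ^- j]).
    by congr measurable; congr (_ `&` _); apply/seteqP; split => x /=; rewrite in_itv.
  move=> s [/= +]; rewrite !in_itv /= => /andP[-> _].
  by rewrite ler_pdivrMr// mulrC.
rewrite lebesgue_measure_itv /= lte_fin mulr_gt0// oppr0 addr0 lee_fin.
have -> : 4 * t * 4^-1 ^+ j / 4 ^+ j.+1 = t * 16 ^- j; last exact: lexx.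
have -> : 16 ^- j = (4 ^- j) * (4 ^- j) :> R.
  by rewrite -invfM -exprMn; congr (_ ^- _); ring.
by rewrite exprVn exprS; field; rewrite lt0r_neq0// exprn_gt0.
Qed.

(* The exponent [2m] is chosen of the order of [ln (2e/t)], for which the factor
   [t^(-1/2m)] lost in Markov's inequality is bounded. *)
Lemma norm_Lexp_of_moments beta f A : 0 <= beta -> L0 f -> 0 < A ->
  (forall m, (0 < m)%N -> (\int[mu]_(x in dom11) (cmod (f x) ^+ (2 * m))%:E <=
     ((A * m%:R `^ beta) ^+ (2 * m))%:E)%E) ->
  (norm_Lexp beta f <= (expR 1 * (16 / 3) * 2 `^ beta * A)%:E)%E.
Proof.
move=> b0 mf A0 fA; apply: ge_ereal_sup => _ [t /= t02 <-].
move: t02; rewrite in_itv /= => t02; have t0 : 0 < t by lra.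
set L := ln (2 * expR 1 / t).
have tE : t = 2 * expR 1 * expR (- L).
  rewrite expRN lnK ?posrE ?divr_gt0 ?mulr_gt0 ?expR_gt0//.
  by field; rewrite !lt0r_neq0// ?expR_gt0.
have L1 : 1 < L.
  rewrite -ltr_expR lnK ?posrE ?divr_gt0 ?mulr_gt0 ?expR_gt0//.
  by rewrite ltr_pdivlMr//; have := expR_gt0 (1 : R); nra.
(* [m > L] makes [e^-m] smaller than [t], and [m <= 2 L] turns [m^beta] into a multiple of
   [L^beta]. *)
pose m := (Num.truncn L).+1.
have Lm : L < m%:R by exact: truncnS_gt.
have m2L : m%:R <= 2 * L.
  have : (Num.truncn L)%:R <= L by rewrite truncn_le//; lra.
  by rewrite /m -natr1; lra.
have Lb : 0 < L `^ beta by rewrite powR_gt0//; lra.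
set M := A * m%:R `^ beta.
have M0 : 0 < M by rewrite mulr_gt0// powR_gt0// ltr0n.
have e0 := expR_gt0 (1 : R).
have re s : 0 < s < t -> (rearrangement f s <= (expR 1 * M * (Num.sqrt (s / t))^-1)%:E)%E.
  move=> st; have u0 : 0 < s / t by rewrite divr_gt0//; lra.
  have su0 : 0 < Num.sqrt (s / t) by rewrite sqrtr_gt0.
  have l0 : 0 < expR 1 * M * (Num.sqrt (s / t))^-1 by rewrite divr_gt0// mulr_gt0.
  apply: rearrangement_le_level; first exact: ltW.
  apply: le_trans (markov_level mf l0 (fA m isT)) _; rewrite lee_fin.
  (* At this level Markov's inequality gives [(s/t)^m e^(-2m)]. One power of [s/t] is retained and
     [e^(-2m) <= e^-m <= t], so the product is at most [s]. *)
  have -> : M ^+ (2 * m) / (expR 1 * M * (Num.sqrt (s / t))^-1) ^+ (2 * m) =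
      (s / t) ^+ m * (expR 1 ^- m) ^+ 2.
    rewrite -expr_div_n.
    have -> : M / (expR 1 * M * (Num.sqrt (s / t))^-1) = Num.sqrt (s / t) / expR 1.
      by field; rewrite !lt0r_neq0.
    rewrite expr_div_n [Num.sqrt _ ^+ _]exprM sqr_sqrtr ?(ltW u0)//; congr (_ * _).
    by rewrite exprVn -exprM mulnC.
  have eE : expR 1 ^- m = expR (- m%:R) :> R by rewrite -exprVn -expRN -expRM_natl mulrN1.
  have E0 : 0 < expR 1 ^- m :> R by rewrite eE expR_gt0.
  have E1 : expR 1 ^- m <= 1 :> R by rewrite eE expR_le1 oppr_le0.
  have Et : expR 1 ^- m <= t.
    rewrite tE eE; apply: (@le_trans _ _ (expR (- L))); first by rewrite ler_expR lerN2 ltW.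
    have e1 : 1 <= expR 1 :> R by rewrite -expR0 ler_expR.
    by rewrite ler_peMl ?expR_ge0// (le_trans e1)// ler_peMl ?expR_ge0// ler1n.
  have um : (s / t) ^+ m <= s / t.
    rewrite -[leRHS]expr1 ler_wiXn2l//; first exact: ltW.
    by rewrite ler_pdivrMr// mul1r; case/andP: st => _ /ltW.
  have sE : s = s / t * t by rewrite divfK// lt0r_neq0.
  rewrite [leRHS]sE ler_pM ?exprn_ge0 ?(ltW u0) ?sqr_ge0//.
  by rewrite expr2 -[leRHS]mulr1 ler_pM// ltW.
rewrite lee_pdivrMr ?mulr_gt0//.
apply: (@le_trans _ _ (\int[mu]_(s in `]0%R, t[) ((expR 1 * M)%:E * ((Num.sqrt (s / t))^-1)%:E))%E).
  apply: ge0_le_integral_nomeas => s /=; first by move=> _; exact: rearrangement_ge0.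
  by rewrite in_itv /= -EFinM; exact: re.
have eM : 0 < expR 1 * M by rewrite mulr_gt0.
have msq : measurable_fun `]0, t[ (fun s => ((Num.sqrt (s / t))^-1)%:E).
  apply/measurable_EFinP; apply: (measurableT_comp (@measurable_inv R)).
  apply: (measurableT_comp (continuous_measurable_fun (@sqrt_continuous R))).
  exact: measurable_funM.
rewrite ge0_integralZl//; last by rewrite lee_fin ltW.
apply: (@le_trans _ _ ((expR 1 * M)%:E * (16 / 3 * t)%:E)%E).
  by apply: lee_wpmul2l; [rewrite lee_fin ltW|exact: integral_inv_sqrt_itv].
rewrite -!EFinM lee_fin.
have ML : M <= A * (2 `^ beta * L `^ beta).
  have L0 : 0 <= L by lra.
  rewrite /M ler_pM2l// -powRM// ge0_ler_powR// nnegrE//.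
  by rewrite mulr_ge0.
have -> : expR 1 * (16 / 3) * 2 `^ beta * A * (t * L `^ beta) =
  (expR 1 * (16 / 3 * t)) * (A * (2 `^ beta * L `^ beta)) by ring.
have -> : expR 1 * M * (16 / 3 * t) = (expR 1 * (16 / 3 * t)) * M by ring.
by rewrite ler_wpM2l// mulr_ge0 ?(ltW e0)// mulr_ge0// ltW.
Qed.

Lemma norm_Lexp_ge0 beta f : (0 <= norm_Lexp beta f)%E.
Proof.
apply: ereal_sup_ge.
exists ((\int[mu]_(s in `]0%R, 1%R[) rearrangement f s) *
  ((1 * (ln (2 * expR 1 / 1)) `^ beta)^-1)%:E)%E.
  by exists 1 => //=; rewrite in_itv /= ltr01 ltr1n.
rewrite mule_ge0//; first by apply: integral_ge0 => s _; exact: rearrangement_ge0.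
by rewrite lee_fin invr_ge0 mulr_ge0// powR_ge0.
Qed.

Lemma integrable_normc_expr f p B : L0 f ->
  (\int[mu]_(x in dom11) (cmod (f x) ^+ p / weight x)%:E <= B%:E)%E ->
  mu.-integrable dom11 (EFin \o (fun x => cmod (f x) ^+ p / weight x)).
Proof.
move=> [mr mi] h; apply/integrableP; split.
  apply/measurable_EFinP; apply: measurable_div_weight; apply: measurable_funX.
  exact: measurable_normc.
apply: le_lt_trans (ltry B); apply: le_trans h.
apply: ge0_le_integral_nomeas => x dx; first exact: abse_ge0.
by rewrite /= ger0_norm// divr_ge0 ?weight_ge0// exprn_ge0// normc_ge0.
Qed.

Lemma checkT_domP f : L0 f -> mu.-integrable dom11 (EFin \o (fun x => cmod (f x) / weight x)) ->
  checkT_dom f.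
Proof.
move=> mf ifw; have [mr mi] := mf.
have fin : (\int[mu]_(x in dom11) (cmod (f x) / weight x)%:E < +oo)%E.
  have /integrableP[_] := ifw; apply: le_lt_trans.
  apply: ge0_le_integral_nomeas => x dx; first by rewrite lee_fin divr_ge0 ?normc_ge0 ?weight_ge0.
  by rewrite lee_fin ler_norm.
have cE x : cmod (div_w f x) = cmod (f x) / weight x.
  rewrite /div_w ComplexField.Normc.normcM ComplexField.Normc.normcV normc_real.
  by rewrite ger0_norm ?weight_ge0.
split; split => //.
- apply: le_lt_trans fin; apply: ge0_le_integral_nomeas => x dx.
    by rewrite lee_fin normc_ge0.
  by rewrite lee_fin ler_peMr ?normc_ge0// invf_ge1 ?weight_le1// weight_gt0.
- split.
    have := measurable_div_weight mr; congr measurable_fun.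
    by apply/funext => x; rewrite /div_w Re_divr.
  have := measurable_div_weight mi; congr measurable_fun.
  by apply/funext => x; rewrite /div_w Im_divr.
- by under eq_integral do rewrite cE.
Qed.

Definition checkT_const alpha : R :=
  expR 1 * (16 / 3) * 2 `^ (alpha + 1) * (140 * source_const * (16 * (alpha + 1)) `^ alpha).

Lemma checkT_const_gt0 alpha : 0 <= alpha -> 0 < checkT_const alpha.
Proof.
move=> a0; have := @source_const_ge1 R => s1.
have s0 : 0 < source_const :> R by exact: lt_le_trans s1.
have p1 : 0 < 2 `^ (alpha + 1) :> R by rewrite powR_gt0.
have p2 : 0 < (16 * (alpha + 1)) `^ alpha :> R by rewrite powR_gt0// mulr_gt0//; lra.
have e1 : 0 < expR 1 * (16 / 3) :> R by rewrite mulr_gt0// expR_gt0.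
by rewrite /checkT_const mulr_gt0// ?mulr_gt0//.
Qed.

(** A strict positive upper bound [N] replaces the norm itself, which may be 0 and then gives no
    usable scale for the level sets. *)
Lemma checkT_norm_lt alpha f N : 0 <= alpha -> L0 f -> 0 < N ->
  (norm_Lexp alpha f < N%:E)%E ->
  [/\ checkT_dom f, L0 (checkT f) &
      (norm_Lexp (alpha + 1) (checkT f) <= (checkT_const alpha * N)%:E)%E].
Proof.
move=> a0 mf N0 fN.
have mom p p0 := @source_moment R alpha f N p a0 mf N0 fN p0.
have ifp p (p0 : (0 < p)%N) := integrable_normc_expr mf (mom p p0).
have ifw := ifp 1%N isT.
have LT := L0_checkT mf ifw.
split => //; first exact: checkT_domP.
have s0 : 0 < source_const :> R by apply: lt_le_trans (@source_const_ge1 R).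
have p2 : 0 < (16 * (alpha + 1)) `^ alpha by rewrite powR_gt0// mulr_gt0//; lra.
pose A := 140 * source_const * (16 * (alpha + 1)) `^ alpha * N.
have A0 : 0 < A by rewrite mulr_gt0// mulr_gt0// mulr_gt0.
have -> : checkT_const alpha * N = expR 1 * (16 / 3) * 2 `^ (alpha + 1) * A.
  by rewrite /checkT_const /A !mulrA.
apply: norm_Lexp_of_moments => //; first lra.
move=> m m0; have m20 : (0 < 2 * m)%N by rewrite muln_gt0.
apply: le_trans (checkT_moment mf ifw m0 (ifp _ m20)) _; rewrite lee_fin.
have mr0 : 0 < m%:R :> R by rewrite ltr0n.
have mE : (8 * (alpha + 1) * (2 * m)%:R) `^ alpha = (16 * (alpha + 1)) `^ alpha * m%:R `^ alpha.
  rewrite -powRM//; last by rewrite mulr_ge0//; lra.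
  by congr (_ `^ _); rewrite natrM; ring.
(* The moments of [f] supply [m^alpha], and the factor [140 m] of [checkT_moment] supplies the last
   [m]. *)
have mS : m%:R `^ (alpha + 1) = m%:R `^ alpha * m%:R.
  by rewrite powRD ?powRr1//; apply/implyP => _; rewrite gt_eqF.
have RI : \int[mu]_(x in dom11) (cmod (f x) ^+ (2 * m) / weight x) <=
    (source_const * N * (8 * (alpha + 1) * (2 * m)%:R) `^ alpha) ^+ (2 * m).
  rewrite -lee_fin /Rintegral fineK ?mom//.
  by apply: integrable_fin_num; [exact: measurable_dom11|exact: ifp].
apply: le_trans (ler_wpM2l _ RI) _.
  by rewrite exprn_ge0// mulr_ge0.
rewrite -exprMn mE mS /A le_eqVlt; apply/orP; left; apply/eqP; congr (_ ^+ _).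
by ring.
Qed.

Lemma checkT_bounded alpha : 0 <= alpha ->
  bounded_operator checkT_dom checkT (@norm_Lexp R alpha) (norm_Lexp (alpha + 1)).
Proof.
move=> a0; have C0 := checkT_const_gt0 a0.
exists (checkT_const alpha); first exact: ltW.
move=> f [mf fN]; have n0 := norm_Lexp_ge0 alpha f.
have nE : norm_Lexp alpha f = (fine (norm_Lexp alpha f))%:E by rewrite fineK// ge0_fin_numE.
set n := fine _ in nE; rewrite nE in n0 *.
have {}n0 : 0 <= n by move: n0; rewrite lee_fin.
have H N : n < N -> [/\ checkT_dom f, L0 (checkT f) &
      (norm_Lexp (alpha + 1) (checkT f) <= (checkT_const alpha * N)%:E)%E].
  move=> nN; apply: checkT_norm_lt => //; first exact: le_lt_trans nN.
  by rewrite nE lte_fin.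
have n1 : n < n + 1 by rewrite ltrDl.
have [h1 h2 h3] := H _ n1.
split; [exact: h1|by split; [exact: h2|exact: le_lt_trans h3 (ltry _)]|].
rewrite -EFinM; apply/lee_addgt0Pr => e e0.
(* [N] decreases to the norm; the increment is divided by the constant so that the excess is exactly
   [e]. *)
have ne : n < n + e / checkT_const alpha by rewrite ltrDl divr_gt0.
have [_ _] := H _ ne; rewrite mulrDr mulrCA divff ?lt0r_neq0// mulr1.
by rewrite EFinD.
Qed.

(** At [alpha = 0] the logarithm disappears and the quotient is the mean of the rearrangement over
    [(0, t)]; the rearrangement stays below the essential supremum because the level set above it is
    null. *)
Lemma norm_Lexp0_le_Linfty f : L0 f -> (norm_Lexp 0 f <= norm_Linfty f)%E.
Proof.
move=> mf; rewrite /norm_Linfty Lnorm.unlock.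
set nu := mrestr _ _.
have nu0 : (0 < nu [set: R])%E by rewrite /nu /mrestr setTI; rewrite [X in (_ < X)%E]measure_dom11 lte_fin.
rewrite nu0; set M := ess_sup _ _.
have aeM := ess_sup_ge nu (abse \o (fun x => (cmod (f x))%:E)).
have M0 : (0 <= M)%E.
  by apply: ess_sup_gee => //; apply: nearW => x; exact: abse_ge0.
move: M0 aeM; rewrite -/M; case: M => [r| |] // r0 aeM; last exact: leey.
have re s : 0 <= s -> (rearrangement f s <= r%:E)%E.
  move=> s0; apply: ereal_inf_lbound; exists r => //; split; first by [].
  case: aeM => N [mN N0 sN].
  have Ns : (nu N <= s%:E)%E by have -> : nu N = 0%E := N0; rewrite lee_fin.
  apply: le_trans Ns.
  apply: le_outer_measure => x [dx rx]; split => //.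
  by apply: sN => /=; rewrite lee_fin ger0_norm ?normc_ge0// leNgt rx.
apply: ge_ereal_sup => _ [t + <-] => /=.
rewrite in_itv /= => /andP[t0 t2].
rewrite powRr0 mulr1 lee_pdivrMr//.
have /le_trans : (\int[mu]_(s in `]0%R, t[) rearrangement f s <= \int[mu]_(s in `]0%R, t[) r%:E)%E.
  apply: ge0_le_integral_nomeas => s /=; first by move=> _; exact: rearrangement_ge0.
  by rewrite in_itv /= => /andP[/ltW s0 _]; exact: re.
by apply; rewrite integral_cst//= lebesgue_measure_itv/= lte_fin t0 sube0.
Qed.

End target.

Theorem corollary4p3 (R : realType) :
  (forall alpha : R, 0 <= alpha ->
     bounded_operator checkT_dom checkT
       (norm_Lexp alpha) (norm_Lexp (alpha + 1))) /\
  bounded_operator checkT_dom checkT (@norm_Linfty R) (norm_Lexp (1 : R)).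
Proof.
split; first exact: checkT_bounded.
have [C C0 H] := checkT_bounded (lexx (0 : R)).
exists C => // f [mf fN]; have le0 := norm_Lexp0_le_Linfty mf.
have /H[h1] : function_space (norm_Lexp (0 : R)) f by split=> //; exact: le_lt_trans fN.
rewrite add0r => h2 h3; split => //; apply: le_trans h3 _.
by apply: lee_wpmul2l => //; rewrite lee_fin.
Qed.
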